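(* Assume that (A1) and (B1) hold (see context) and that $p\in(0,\pi]$ satisfies $E^1_{\min}(p)<\sqrt2\,p$. Let $(\psi_n)_{n\ge1}\subset\mathcal{E}(\mathbb{R})$ be a sequence satisfying $$\lfloor P\rfloor(\psi_n)\to\lfloor p\rfloor\quad\text{and}\quad E^1(\psi_n)\to E^1_{\min}(p)\qquad\text{as }n\to\infty.$$ Then there exist a subsequence $(\psi_{n_k})_{k\ge1}$, a sequence $(x_k)_{k\ge1}\subset\mathbb{R}$ and $\psi\in\mathcal{E}(\mathbb{R})$ satisfying $\lfloor P\rfloor(\psi)=\lfloor p\rfloor$, $E^1(\psi)=E^1_{\min}(p)$, and - $\psi_{n_k}(\cdot+x_k)\to\psi$ uniformly on $[-R,R]$ for any $R>0$, - $\psi_{n_k}'(\cdot+x_k)\to\psi'$ in $L^2(\mathbb{R})$, - $|\psi_{n_k}(\cdot+x_k)|-|\psi|\to0$ in $L^r(\mathbb{R})$ for $2\le r<\infty$.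
   Context: Let $F:[0,\infty)\to\mathbb{R}$ and $V(s)=\int_s^1F(\tau)\,d\tau$. (A1): $F$ is continuous on $[0,\infty)$, $C^1$ near $1$, $F(1)=0$ and (normalization) $F'(1)=-1$. (B1): $V>0$ on $[0,\infty)\setminus\{1\}$ and $H(s)=\int_1^s|V(\tau^2)|^{1/2}\,d\tau\to\infty$ as $s\to\infty$. $\mathcal{E}(\mathbb{R})=\{\psi\in L^1_{loc}(\mathbb{R};\mathbb{C}):\psi'\in L^2(\mathbb{R}),\ V(|\psi|^2)\in L^1(\mathbb{R})\}$ (continuous representatives are used) and $E^1(\psi)=\int_{\mathbb{R}}|\psi'|^2+V(|\psi|^2)\,dx$. Momentum. $\langle z,w\rangle=\mathrm{Re}(z\bar w)$ on $\mathbb{C}$; $\dot H^1(\mathbb{R})$ is the set of $L^1_{loc}$ functions with derivative in $L^2(\mathbb{R})$; $\lfloor x\rfloor=x+2\pi\mathbb{Z}\in\mathbb{R}/2\pi\mathbb{Z}$, where $\mathbb{R}/2\pi\mathbb{Z}$ carries the quotient distance $\mathrm{dist}(\lfloor a\rfloor,\lfloor b\rfloor)=\min_{k\in\mathbb{Z}}|a-b+2k\pi|$. For real-valued $\varphi\in\dot H^1(\mathbb{R})$ and $w\in H^1(\mathbb{R};\mathbb{C})$ put $p(\varphi,w)=\int_{\mathbb{R}}-2\langle\varphi'e^{i\varphi},w\rangle+\langle iw',w\rangle\,dx$. Every $\psi\in\mathcal{E}(\mathbb{R})$ can be written $\psi=e^{i\varphi}+w$ with such $\varphi,w$, and $p(\varphi,w)$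 is determined by $\psi$ modulo $2\pi\mathbb{Z}$; set $\lfloor P\rfloor(\psi)=\lfloor p(\varphi,w)\rfloor$. $E^1_{\min}(p)=\inf\{E^1(\psi):\psi\in\mathcal{E}(\mathbb{R}),\ \lfloor P\rfloor(\psi)=\lfloor p\rfloor\}$. *)

(* Defs.v *)
From HB Require Import structures.
From mathcomp Require Import all_boot all_order all_algebra.
From mathcomp Require Import complex.
From mathcomp Require Import all_classical all_reals all_analysis.

Set Implicit Arguments.
Unset Strict Implicit.
Unset Printing Implicit Defensive.

Import Order.TTheory GRing.Theory Num.Theory.
Import numFieldNormedType.Exports.

Local Open Scope classical_set_scope.
Local Open Scope ring_scope.

(* Values of F and V at negative reals are irrelevant: these maps are only ever
   constrained, or evaluated, on [0, +oo[. *)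
Section Nonlinearity.
Context {R : realType}.
Local Notation leb := (@lebesgue_measure R).
Implicit Types (F f : R -> R) (a b s : R).

(* Oriented integral from a to b, with the usual sign change if b < a. *)
Definition oriented_integral a b f : R :=
  if a <= b then \int[leb]_(x in `[a, b]) f x
  else - \int[leb]_(x in `[b, a]) f x.

Definition potential F s : R := oriented_integral s 1 F.

Definition primitive_sqrt_potential F s : R :=
  oriented_integral 1 s (fun t => Num.sqrt `|potential F (t ^+ 2)|).

Definition assumption_A1 F : Prop :=
  [/\ {within `[0, +oo[, continuous F},
      (\forall x \near (1 : R), derivable F x 1 /\ {for x, continuous (derive1 F)}),
      F 1 = 0 & derive1 F 1 = -1].

Definition assumption_B1 F : Prop :=
  (forall s, 0 <= s -> s != 1 -> 0 < potential F s) /\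
  primitive_sqrt_potential F s @[s --> +oo] --> +oo.

End Nonlinearity.

Section Sobolev.
Context {R : realType}.
Local Notation leb := (@lebesgue_measure R).
Local Notation Re := (@complex.Re R).
Local Notation Im := (@complex.Im R).
Implicit Types (f g phi : R -> R) (psi w u : R -> R[i]).

Definition test_function phi : Prop :=
  (forall n x, derivable (derive1n n phi) x 1) /\
  exists r : R, forall x, r < `|x| -> phi x = 0.

Definition weak_derivative f g : Prop :=
  [/\ locally_integrable setT f, locally_integrable setT g &
      forall phi, test_function phi ->
        \int[leb]_x (f x * derive1 phi x) = - \int[leb]_x (g x * phi x)].

Definition weak_derivativeC psi u : Prop :=
  weak_derivative (Re \o psi) (Re \o u) /\
  weak_derivative (Im \o psi) (Im \o u).

(* A weak derivative is unique almost everywhere; wderive and wderiveC choose a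
   representative when there is one, and are only used under integral signs. *)
Definition wderive f : R -> R := xget (fun=> 0) [set g | weak_derivative f g].

Definition wderiveC psi : R -> R[i] :=
  xget (fun=> 0) [set u | weak_derivativeC psi u].

Definition square_integrable f : Prop := f \in Lfun leb 2%:E.

Definition square_integrableC u : Prop :=
  square_integrable (Re \o u) /\ square_integrable (Im \o u).

Definition continuousC psi : Prop :=
  continuous (Re \o psi) /\ continuous (Im \o psi).

(* In dimension one, a locally integrable function whose weak derivative is in
   L^2 has a unique continuous representative.  Elements of the three spaces
   below are these representatives. *)
Definition homogeneous_H1 f : Prop :=
  continuous f /\ exists2 g, weak_derivative f g & square_integrable g.

Definition homogeneous_H1C psi : Prop :=
  continuousC psi /\ exists2 u, weak_derivativeC psi u & square_integrableC u.

Definition H1C w : Prop := homogeneous_H1C w /\ square_integrableC w.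

End Sobolev.

Section Energy.
Context {R : realType}.
Local Notation leb := (@lebesgue_measure R).
Implicit Types (F : R -> R) (psi : R -> R[i]).

Definition energy_space F psi : Prop :=
  homogeneous_H1C psi /\
  leb.-integrable setT (fun x => (potential F (Normc.normc (psi x) ^+ 2))%:E).

Definition energy F psi : \bar R :=
  (\int[leb]_x (Normc.normc (wderiveC psi x) ^+ 2
                + potential F (Normc.normc (psi x) ^+ 2))%:E)%E.

End Energy.

Section Momentum.
Context {R : realType}.
Local Notation leb := (@lebesgue_measure R).
Implicit Types (F phi : R -> R) (psi w : R -> R[i]) (A B : set R).

Definition real_inner (z w : R[i]) : R := complex.Re (z * conjc w).

Definition expi (t : R) : R[i] := Complex (cos t) (sin t).

(* The class x + 2 pi Z; elements of R / 2 pi Z are represented by such sets. *)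
Definition class2pi (x : R) : set R :=
  [set x + 2 * pi * k%:~R | k in [set: int]].

(* On two classes this is min_k |a - b + 2 k pi|. *)
Definition dist2pi A B : R :=
  inf [set d | exists a b, [/\ A a, B b & d = `|a - b|]].

Definition momentum phi w : R :=
  \int[leb]_x (- 2 * real_inner ((wderive phi x)%:C%C * expi (phi x)) (w x)
               + real_inner ('i%C * wderiveC w x) (w x)).

Definition phase_decomposition psi phi w : Prop :=
  [/\ homogeneous_H1 phi, H1C w & forall x, psi x = expi (phi x) + w x].

(* Every decomposition of an element of the energy space gives the same class,
   so the union below is that single class. *)
Definition untwisted_momentum psi : set R :=
  [set q | exists phi w,
     phase_decomposition psi phi w /\ class2pi (momentum phi w) q].

Definition energy_min F (p : R) : \bar R :=
  ereal_inf [set energy F psi | psi in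
    [set psi | energy_space F psi /\ untwisted_momentum psi = class2pi p]].

End Momentum.

(* Main.v *)
(* The modulus of a function psi of finite energy tends to 1 at both ends, and if J
   is a primitive of <i psi', psi> then e^{iJ} psi has limits there, whose quotient
   is e^{iP}.  Reflecting either half of psi at a suitable point shows that the
   energy at momentum q is a mean of energies at q - d and q + d, so a lower bound
   by an affine function of q passes from the ends of an interval to its interior.
   Since the energy is at least kap q with kap close to sqrt 2 for small q, the
   minimum m < sqrt 2 p at p gives E(psi) >= (m/p) min(p, |P(psi)|), strictly if
   0 < |P(psi)| < p.

   If |psi_n| were uniformly close to 1, then E(psi_n) >= kap p > m; so |psi_n|
   stays away from 1 at some x_n, and the translates converge locally uniformly to
   a nontrivial psi.  Cutting psi_n at -A and A and closing both outer parts by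
   short caps of constant phase gives m >= E(psi) + (m/p) min(p, dist(p, P(psi))).
   With the lower bound this forces P(psi) = p and E(psi) = m.  The energies then
   converge, which gives strong convergence of the derivatives by the parallelogram
   identity, and of the moduli by Fatou's lemma. *)
Require Import Defs.
From HB Require Import structures.
From mathcomp Require Import all_boot all_order all_algebra.
From mathcomp Require Import complex.
From mathcomp Require Import all_classical all_reals all_analysis.
From mathcomp Require Import measurable_realfun.
From mathcomp Require Import ring lra.
Import Order.TTheory GRing.Theory Num.Theory.
Import numFieldNormedType.Exports.
Local Open Scope classical_set_scope.
Local Open Scope ring_scope.

(** Compactness is decided by the function t -> (m/p) min(p, t) of the distance t from the momentum
    to 0 in R/2piZ. It is continuous and subadditive. By the triangle inequality, the lower bound
    for psi and the bound left after cutting can hold together only with equality; the positive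
    energy of psi excludes momentum 0, and the strict bound excludes a splitting. Continuity makes
    it harmless that the momenta of the psi_n only tend to p: nothing is required of the minimal
    energy at momenta other than p. The obstacle is that psi may vanish, so it has no global phase
    to cut or to prescribe. Hence e^{iP} is handled instead of P, distances on the circle are read
    off as acos of a real part, and competitors are made by conjugation, reflection and gluing,
    which preserve the energy density. The slope sqrt 2 is dictated by F'(1) = -1: V(s) is close to
    (s - 1)^2 / 2 near 1. No weak compactness in L^2 is invoked: lower semicontinuity too rests on
    midpoints of almost minimal elements. *)

Section IntegralToolkit.
Context {R : realType}.
Local Notation mu := (@lebesgue_measure R).
Local Notation ig A f := (mu.-integrable A (EFin \o f)).
Implicit Types (f g h : R -> R) (a b c s t x y k : R) (A B : set (measurableTypeR R)).

(** * Real-valued integrals, and functions that are integrals of a density *)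

Lemma igS {A B f} : measurable A -> measurable B -> B `<=` A -> ig A f -> ig B f.
Proof. by move=> mA mB BA; exact: integrableS. Qed.

Lemma ig_itvS {a b c d : R} {f} : a <= c -> d <= b -> ig `[a, b] f -> ig `[c, d] f.
Proof.
move=> ac db; apply: igS => // x /=; rewrite !in_itv/= => /andP[cx xd].
by rewrite (le_trans ac cx) (le_trans xd db).
Qed.

Lemma ig_itvT {a b : R} {f} : ig setT f -> ig `[a, b] f.
Proof. exact: igS. Qed.

Lemma igD {A f g} : measurable A -> ig A f -> ig A g -> ig A (fun x => f x + g x).
Proof. by move=> mA fi gi; have := integrableD mA fi gi. Qed.

Lemma igZ {A f} k : measurable A -> ig A f -> ig A (fun x => k * f x).
Proof. by move=> mA fi; have := integrableZl mA k fi. Qed.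

Lemma igN {A f} : measurable A -> ig A f -> ig A (fun x => - f x).
Proof. by move=> mA fi; have := integrableN fi. Qed.

Lemma igB {A f g} : measurable A -> ig A f -> ig A g -> ig A (fun x => f x - g x).
Proof. by move=> mA fi gi; apply: igD => //; exact: igN. Qed.

Lemma ig_norm {A f} : measurable A -> ig A f -> ig A (fun x => `|f x|).
Proof. by move=> mA fi; have := integrable_abse fi. Qed.

Lemma ig_meas {A f} : measurable A -> ig A f -> measurable_fun A f.
Proof. by move=> mA /integrableP[/measurable_EFinP]. Qed.

Lemma ig_le {A f g} : measurable A -> measurable_fun A f -> ig A g ->
  (forall x, A x -> `|f x| <= g x) -> ig A f.
Proof.
move=> mA mf gi fg; apply: (le_integrable mA _ _ gi).
  exact/measurable_EFinP.
by move=> x Ax /=; rewrite lee_fin (le_trans (fg x Ax))// ler_norm.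
Qed.

Lemma ig_ext {A f g} : measurable A -> (forall x, A x -> f x = g x) -> ig A f -> ig A g.
Proof.
by move=> mA fg; apply: eq_integrable => // x; rewrite inE => Ax /=; rewrite fg.
Qed.

Lemma I_ext {A f g} : (forall x, A x -> f x = g x) ->
  \int[mu]_(x in A) f x = \int[mu]_(x in A) g x.
Proof. by move=> fg; apply: eq_Rintegral => x; rewrite inE; exact: fg. Qed.

Lemma cont_meas {A f} : continuous f -> measurable_fun A f.
Proof. by move=> cf; apply: measurable_funTS; exact: continuous_measurable_fun. Qed.

Lemma cont_bounded_itv {f} a b : continuous f ->
  exists M, 0 < M /\ forall x, a <= x -> x <= b -> `|f x| <= M.
Proof.
move=> cf; have [ab|ba] := leP a b; last first.
  by exists 1; split => // x ax xb; move: (le_lt_trans (le_trans ax xb) ba); rewrite ltxx.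
have cn : {within `[a, b], continuous (fun x => `|f x|)}.
  apply: continuous_subspaceT => x.
  by apply: cvg_norm; exact: cf.
have [c _ cM] := EVT_max ab cn.
exists (`|f c| + 1); split; first by rewrite ltr_wpDl.
move=> x ax xb; rewrite (le_trans (cM x _)) ?lerDl//.
by rewrite in_itv/= ax xb.
Qed.

Lemma ig_cont {f a b} : continuous f -> ig `[a, b] f.
Proof.
move=> cf; apply: continuous_compact_integrable; first exact: segment_compact.
exact: continuous_subspaceT.
Qed.

Lemma ig_mulC {g f a b} : ig `[a, b] g -> continuous f ->
  ig `[a, b] (fun x => g x * f x).
Proof.
move=> gi cf; have [M [M0 fM]] := cont_bounded_itv a b cf.
apply: (@ig_le _ _ (fun x => M * `|g x|)) => //.
- apply: measurable_funM; first exact: ig_meas.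
  exact: cont_meas.
- by apply: igZ => //; exact: ig_norm.
- move=> x; rewrite /= in_itv/= => /andP[ax xb].
  by rewrite normrM mulrC ler_wpM2r// fM.
Qed.

Lemma I_cat {f a b c} : a <= b -> b <= c -> ig `[a, c] f ->
  \int[mu]_(x in `[a, c]) f x =
  \int[mu]_(x in `[a, b]) f x + \int[mu]_(x in `[b, c]) f x.
Proof.
move=> ab bc fi; apply/eqP; rewrite addrC -subr_eq; apply/eqP.
rewrite (@Rintegral_itvB _ f (BLeft a) (BRight c) b)// ?bnd_simp//.
rewrite Rintegral_itv_obnd_cbnd//.
by apply: (igS _ _ _ fi) => // x /=; rewrite !in_itv/= => /andP[bx ->]; rewrite (le_trans ab (ltW bx)).
Qed.

Lemma I_ge0 {A f} : (forall x, A x -> 0 <= f x) -> 0 <= \int[mu]_(x in A) f x.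
Proof. by move=> f0; apply: Rintegral_ge0 => x Ax; exact: f0. Qed.

Lemma I_le {A f g} : measurable A -> ig A f -> ig A g ->
  (forall x, A x -> f x <= g x) ->
  \int[mu]_(x in A) f x <= \int[mu]_(x in A) g x.
Proof. by move=> mA fi gi fg; apply: le_Rintegral. Qed.

Lemma I_D {A f g} : measurable A -> ig A f -> ig A g ->
  \int[mu]_(x in A) (f x + g x) = \int[mu]_(x in A) f x + \int[mu]_(x in A) g x.
Proof. by move=> mA fi gi; apply: RintegralD. Qed.

Lemma I_B {A f g} : measurable A -> ig A f -> ig A g ->
  \int[mu]_(x in A) (f x - g x) = \int[mu]_(x in A) f x - \int[mu]_(x in A) g x.
Proof. by move=> mA fi gi; apply: RintegralB. Qed.

Lemma I_Z {A f} k : measurable A -> ig A f ->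
  \int[mu]_(x in A) (k * f x) = k * \int[mu]_(x in A) f x.
Proof. by move=> mA fi; exact: RintegralZl. Qed.

Lemma I_N {A f} : measurable A -> ig A f ->
  \int[mu]_(x in A) (- f x) = - \int[mu]_(x in A) f x.
Proof.
by move=> mA fi; rewrite -mulN1r -I_Z//; apply: I_ext => x _; rewrite mulN1r.
Qed.

Lemma I_norm {A f} : measurable A -> ig A f ->
  `|\int[mu]_(x in A) f x| <= \int[mu]_(x in A) `|f x|.
Proof. by move=> mA fi; apply: le_normr_Rintegral. Qed.

Lemma I_cst a b k : a <= b -> \int[mu]_(x in `[a, b]) k = k * (b - a).
Proof.
move=> ab; rewrite Rintegral_cst//= lebesgue_measure_itv/= lte_fin.
move: ab; rewrite le_eqVlt => /predU1P[->|->//].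
by rewrite ltxx subrr.
Qed.

Lemma I_fin {A f} : measurable A -> ig A f ->
  (\int[mu]_(x in A) (f x)%:E)%E = (\int[mu]_(x in A) f x)%:E.
Proof. by move=> mA fi; rewrite /Rintegral fineK//; exact: integrable_fin_num. Qed.

Lemma I_setU {A B f} : measurable A -> measurable B -> ig (A `|` B) f ->
  [disjoint A & B] ->
  \int[mu]_(x in A `|` B) f x = \int[mu]_(x in A) f x + \int[mu]_(x in B) f x.
Proof. by move=> mA mB fi AB; apply: Rintegral_setU. Qed.

Lemma I_subset {A B f} : measurable A -> measurable B -> A `<=` B -> ig B f ->
  (forall x, B x -> 0 <= f x) ->
  \int[mu]_(x in A) f x <= \int[mu]_(x in B) f x.
Proof.
move=> mA mB AB fB f0; rewrite -lee_fin -!I_fin//; last exact: (igS mB).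
apply: ge0_subset_integral => //; by apply/measurable_EFinP; exact: ig_meas fB.
Qed.

Lemma ge0_ig {A f} M : measurable A -> measurable_fun A f ->
  (forall x, A x -> 0 <= f x) ->
  (\int[mu]_(x in A) (f x)%:E <= M%:E)%E ->
  ig A f /\ \int[mu]_(x in A) f x <= M.
Proof.
move=> mA mf f0 fM; have fi : ig A f.
  apply/integrableP; split; first exact/measurable_EFinP.
  apply: (@le_lt_trans _ _ M%:E); last exact: ltry.
  apply: le_trans fM; rewrite le_eqVlt; apply/orP; left; apply/eqP.
  by apply: eq_integral => x; rewrite inE => Ax /=; rewrite ger0_norm// f0.
by split => //; rewrite -lee_fin -I_fin.
Qed.

(* Cousin's lemma: only intervals straddling a point have to be controlled, so
   no uniform continuity is needed. *)
Lemma creeping (Q : R -> R -> Prop) a b : a <= b ->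
  (forall s t u, a <= s -> s <= t -> t <= u -> u <= b ->
     Q s t -> Q t u -> Q s u) ->
  (forall c, a <= c -> c <= b -> exists2 d, 0 < d & forall s t,
     a <= s -> s <= c -> c <= t -> t <= b -> c - d < s -> t < c + d -> Q s t) ->
  Q a b.
Proof.
move=> ab Qtr Qloc.
pose S := [set t | a <= t <= b /\ Q a t].
have Sa : S a.
  split; first by rewrite lexx.
  have [d d0 Qd] := Qloc a (lexx a) ab.
  by apply: Qd; rewrite // ?ltrDl// ltrBlDr ltrDl.
have Sb : has_ubound S by exists b => t [/andP[]].
have S0 : has_sup S by split => //; exists a.
pose m := sup S.
have am : a <= m by exact: sup_upper_bound.
have mb : m <= b by apply: sup_le_ub => //; [exists a|move=> t [/andP[]]].
have [d d0 Qd] := Qloc m am mb.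
have [t [/andP[at_ tb] Qat] tm] := sup_adherent d0 S0.
have tm' : t <= m by apply: sup_upper_bound => //; split => //; rewrite at_.
pose u := Num.min (m + d / 2) b.
have mu_ : m <= u by rewrite le_min mb andbT lerDl divr_ge0// ltW.
have ub : u <= b by rewrite ge_min lexx orbT.
have Qtu : Q t u.
  apply: Qd => //; rewrite (le_lt_trans (y := m + d / 2))//.
    by rewrite ge_min lexx.
  by rewrite ltrD2l ltr_pdivrMr// ltr_pMr// ltr1n.
have Su : S u.
  split; first by rewrite (le_trans am mu_).
  by apply: (Qtr a t u) => //; exact: le_trans mu_.
have um : u <= m by exact: sup_upper_bound.
have : u = b.
  have [h|h] := leP (m + d / 2) b; last by rewrite /u min_r// ltW.
  by move: um; rewrite /u min_l//; lra.
by move=> <-; case: Su.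
Qed.

Lemma le_addeps (x y : R) : (forall e, 0 < e -> x <= y + e) -> x <= y.
Proof. by move=> h; apply/ler_addgt0Pr. Qed.

(* The integral form in which weak derivatives of continuous functions are used;
   see [ac_weak] and [weak_ac]. *)
Definition acon a b f g := ig `[a, b] g /\
  forall s t, a <= s -> s <= t -> t <= b -> f t - f s = \int[mu]_(x in `[s, t]) g x.

Definition ac f g := forall a b, acon a b f g.

Lemma acP f g : (forall a b, ig `[a, b] g) ->
  (forall s t, s <= t -> f t - f s = \int[mu]_(x in `[s, t]) g x) -> ac f g.
Proof. by move=> gi fg a b; split => // s t _ st _; exact: fg. Qed.

Lemma ac_ig {f g a b} : ac f g -> ig `[a, b] g.
Proof. by move=> /(_ a b)[]. Qed.

Lemma acE {f g s t} : ac f g -> s <= t ->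
  f t - f s = \int[mu]_(x in `[s, t]) g x.
Proof. by move=> /(_ s t)[_ h] st; exact: h. Qed.

(** An error of at most e times the integral of K adds up over adjacent intervals, so [creeping]
    carries the local estimate to [s, t]; then e tends to 0. Measuring the error by an integral
    rather than by length is what suits a merely integrable g. *)
Lemma acon_local {a b f g K} : ig `[a, b] g -> ig `[a, b] K ->
  (forall x, a <= x -> x <= b -> 0 <= K x) ->
  (forall e c, 0 < e -> a <= c -> c <= b -> exists2 d, 0 < d & forall s t,
     a <= s -> s <= c -> c <= t -> t <= b -> c - d < s -> t < c + d ->
     `|f t - f s - \int[mu]_(x in `[s, t]) g x| <=
       e * \int[mu]_(x in `[s, t]) K x) ->
  acon a b f g.
Proof.
move=> gi Ki K0 loc; split => // s0 t0 as0 st0 tb0.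
apply/eqP; rewrite -subr_eq0 -normr_le0; apply: le_addeps => e e0; rewrite add0r.
pose I1 := \int[mu]_(x in `[s0, t0]) K x.
have I10 : 0 <= I1.
  apply: I_ge0 => x /=; rewrite in_itv/= => /andP[sx xt]; apply: K0.
    exact: le_trans sx.
  exact: le_trans tb0.
(* Dividing by I1 + 1 rather than I1 covers the case I1 = 0. *)
suff H : `|f t0 - f s0 - \int[mu]_(x in `[s0, t0]) g x| <= (e / (I1 + 1)) * I1.
  apply: (le_trans H); rewrite -mulrA ler_piMr//; first exact: ltW.
  by rewrite mulrC ler_pdivrMr ?ltr_wpDl// mul1r lerDl.
pose Q s t := `|f t - f s - \int[mu]_(x in `[s, t]) g x| <=
   e / (I1 + 1) * \int[mu]_(x in `[s, t]) K x.
apply: (@creeping Q) => //.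
- move=> s t u ss st tu ub; rewrite /Q => H1 H2.
  have asu : a <= s by exact: le_trans ss.
  have ubb : u <= b by exact: le_trans tb0.
  rewrite (I_cat st tu) ?(ig_itvS asu ubb)// (@I_cat K _ _ _ st tu) ?(ig_itvS asu ubb)//.
  rewrite mulrDr; apply: le_trans (lerD H1 H2).
  apply: le_trans (ler_normD _ _); rewrite le_eqVlt; apply/orP; left; apply/eqP.
  by congr (`|_|); ring.
- move=> c sc ct.
  have [d d0 h] := loc (e / (I1 + 1)) c (divr_gt0 e0 (ltr_wpDl I10 ltr01))
     (le_trans as0 sc) (le_trans ct tb0).
  exists d => // s t ss scc cst tt ds td; apply: h => //.
    exact: le_trans ss.
  exact: le_trans tb0.
Qed.

Lemma acon_cont {a b f g} c : acon a b f g -> a <= c -> c <= b ->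
  forall e, 0 < e -> exists2 d, 0 < d & forall x, a <= x -> x <= b ->
    `|x - c| < d -> `|f x - f c| < e.
Proof.
move=> [gi fg] ac cb e e0.
have [ab|ba] := ltP a b; last first.
  exists 1 => // x ax xb _.
  have -> : x = c by apply/eqP; rewrite eq_le (le_trans xb)//= ?(le_trans cb)//; apply: le_trans ba _.
  by rewrite subrr normr0.
have := parameterized_integral_continuous (ltW ab) gi.
move=> /subspace_continuousP /(_ c); rewrite /= in_itv/= ac cb => /(_ isT).
move=> /cvgrPdist_lt /(_ e e0); rewrite near_withinE /= => -[d /= d0 dP].
exists d => // x ax xb xc.
have H : `|\int[mu]_(t in `[a, c]) g t - \int[mu]_(t in `[a, x]) g t| < e.
  by apply: dP; [rewrite /= distrC|rewrite /= in_itv/= ax xb].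
by move: H; rewrite -!fg// distrC [_ - (_ - _)](_ : _ = f x - f c); last ring.
Qed.

Lemma ac_cont {f g} : ac f g -> continuous f.
Proof.
move=> fg c; apply/cvgrPdist_lt => e e0.
have lt1 : c - 1 <= c by rewrite gerBl.
have lt2 : c <= c + 1 by rewrite lerDl.
have [d d0 h] := acon_cont c (fg (c - 1) (c + 1)) lt1 lt2 e e0.
apply/nbhs_ballP; exists (Num.min d 1); first by rewrite /= lt_min d0 ltr01.
move=> x; rewrite /ball/= lt_min distrC => /andP[xd].
rewrite ltr_norml => /andP[x1 x2].
by rewrite distrC; apply: h => //; lra.
Qed.

End IntegralToolkit.

(** * Calculus of absolutely continuous functions: product, chain rule, uniqueness of the density *)

Section AbsoluteContinuity.
Context {R : realType}.
Local Notation mu := (@lebesgue_measure R).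
Local Notation ig A f := (mu.-integrable A (EFin \o f)).
Implicit Types (f g h dh kk df : R -> R) (a b c s t x y k : R) (A B : set (measurableTypeR R)).

(** On a short interval around c the increment of the product is f2(s) times that of f1 plus f1(t)
    times that of f2; replacing f2(s) and f1(t) by the values under the integral costs at most e, by
    continuity at c. *)
Lemma acon_mul {a b f1 g1 f2 g2} : continuous f1 -> continuous f2 ->
  acon a b f1 g1 -> acon a b f2 g2 ->
  acon a b (fun x => f1 x * f2 x) (fun x => g1 x * f2 x + g2 x * f1 x).
Proof.
move=> c1 c2 [i1 h1] [i2 h2].
have i12 := ig_mulC i1 c2; have i21 := ig_mulC i2 c1.
pose K x := `|g1 x| + `|g2 x|.
have iK : ig `[a, b] K by apply: igD => //; exact: ig_norm.
apply: (@acon_local _ _ _ _ _ K) => //; first exact: igD.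
  by move=> x _ _; rewrite addr_ge0.
move=> e c e0 ac cb; have e20 : 0 < e / 2 by lra.
have /cvgrPdist_lt /(_ _ e20) /nbhs_ballP[d1 /= d10 D1] := c1 c.
have /cvgrPdist_lt /(_ _ e20) /nbhs_ballP[d2 /= d20 D2] := c2 c.
exists (Num.min d1 d2); first by rewrite lt_min d10 d20.
move=> s t as_ sc ct tb ds td.
have near x : s <= x -> x <= t -> `|f1 c - f1 x| < e / 2 /\ `|f2 c - f2 x| < e / 2.
  move=> sx xt; have : `|c - x| < Num.min d1 d2.
    by rewrite ltr_norml; apply/andP; split; lra.
  by rewrite lt_min => /andP[xd1 xd2]; split; [exact: D1|exact: D2].
have st : s <= t by exact: le_trans ct.
have J1 : ig `[s, t] g1 by exact: ig_itvS i1.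
have J2 : ig `[s, t] g2 by exact: ig_itvS i2.
have J12 : ig `[s, t] (fun x => g1 x * f2 x) by exact: ig_itvS i12.
have J21 : ig `[s, t] (fun x => g2 x * f1 x) by exact: ig_itvS i21.
have P1 : ig `[s, t] (fun x => f2 s * g1 x) by exact: igZ.
have P2 : ig `[s, t] (fun x => f1 t * g2 x) by exact: igZ.
have -> : f1 t * f2 t - f1 s * f2 s -
    \int[mu]_(x in `[s, t]) (g1 x * f2 x + g2 x * f1 x) =
  \int[mu]_(x in `[s, t]) (f2 s * g1 x + f1 t * g2 x - (g1 x * f2 x + g2 x * f1 x)).
  rewrite I_B//; [|exact: igD|exact: igD].
  rewrite [in RHS]I_D// !I_Z// -h1// -h2//; ring.
apply: (le_trans (I_norm _ _)) => //.
  by apply: igB => //; exact: igD.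
rewrite -I_Z//; last exact: ig_itvS iK.
apply: I_le => //.
- by apply: ig_norm => //; apply: igB => //; exact: igD.
- by apply: igZ => //; exact: ig_itvS iK.
move=> x /=; rewrite in_itv/= => /andP[sx xt].
have [_ x2] := near x sx xt; have [x1 _] := near x sx xt.
have [_ s2] := near s (lexx _) st; have [t1 _] := near t st (lexx _).
have A1 : `|f2 s - f2 x| <= e.
  rewrite (_ : f2 s - f2 x = (f2 c - f2 x) - (f2 c - f2 s)); last ring.
  by rewrite (le_trans (ler_normB _ _))// (splitr e) lerD// ltW.
have A2 : `|f1 t - f1 x| <= e.
  rewrite (_ : f1 t - f1 x = (f1 c - f1 x) - (f1 c - f1 t)); last ring.
  by rewrite (le_trans (ler_normB _ _))// (splitr e) lerD// ltW.
rewrite (_ : f2 s * g1 x + f1 t * g2 x - (g1 x * f2 x + g2 x * f1 x) =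
  (f2 s - f2 x) * g1 x + (f1 t - f1 x) * g2 x); last ring.
by rewrite (le_trans (ler_normD _ _))// /K mulrDr !normrM lerD// ler_wpM2r.
Qed.

Lemma ac_mul {f1 g1 f2 g2} : ac f1 g1 -> ac f2 g2 ->
  ac (fun x => f1 x * f2 x) (fun x => g1 x * f2 x + g2 x * f1 x).
Proof. by move=> h1 h2 a b; apply: acon_mul => //; exact: ac_cont. Qed.

Lemma mvt_ball {h dh : R -> R} {p r u v : R} :
  (forall y, `|p - y| < r -> is_derive y 1 h (dh y)) ->
  `|p - u| < r -> `|p - v| < r ->
  exists2 w, `|p - w| < r & h v - h u = dh w * (v - u).
Proof.
move=> hd.
wlog uv : u v / u <= v => [W|] pu pv.
  have [uv|/ltW vu] := leP u v; first exact: W.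
  have [w pw E] := W v u vu pv pu; exists w => //.
  by rewrite -opprB E; ring.
have inb w : u <= w -> w <= v -> `|p - w| < r.
  move: pu pv; rewrite !ltr_norml => /andP[? ?] /andP[? ?] ? ?.
  by apply/andP; split; lra.
have [| |w] := @MVT_segment R h dh u v uv.
- by move=> w; rewrite in_itv/= => /andP[/ltW uw /ltW wv]; apply: hd; exact: inb.
- apply: continuous_in_subspaceT => w; rewrite inE/= in_itv/= => /andP[uw wv].
  apply: differentiable_continuous; apply/derivable1_diffP.
  by have [] := hd w (inb _ uw wv).
by rewrite in_itv/= => /andP[uw wv] E; exists w => //; exact: inb.
Qed.

(** By the mean value theorem h(f t) - h(f s) = dh(w) (f t - f s) with w close to f c.
    Differentiability is required only near the values of f on [a, b]: the intended h is [isqrt],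
    which has a kink at 1/4. *)
Lemma acon_chain {a b f g h dh kk} : continuous f -> continuous kk ->
  (forall x, a <= x -> x <= b -> [/\ kk x = dh (f x), {for f x, continuous dh} &
     \forall y \near f x, is_derive (y : R) 1 h (dh y)]) ->
  acon a b f g -> acon a b (fun x => h (f x)) (fun x => g x * kk x).
Proof.
move=> cf ck hyp [gi fg].
have gki := ig_mulC gi ck.
apply: (@acon_local _ _ _ _ _ (fun x => `|g x|)) => //; first exact: ig_norm.
move=> e c e0 ac cb; have e20 : 0 < e / 2 by lra.
have [_ cdh nd] := hyp c ac cb.
move: (cdh) => /cvgrPdist_lt /(_ _ e20) /nbhs_ballP[r1 /= r10 D1].
move: nd => /nbhs_ballP[r2 /= r20 D2].
pose r := Num.min r1 r2; have r0 : 0 < r by rewrite lt_min r10 r20.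
have /cvgrPdist_lt /(_ _ r0) /nbhs_ballP[d /= d0 D] := cf c.
exists d => // s t as_ sc ct tb ds td.
have near x : s <= x -> x <= t -> `|f c - f x| < r.
  by move=> sx xt; apply: D; rewrite /ball/= ltr_norml; apply/andP; split; lra.
have st : s <= t by exact: le_trans ct.
have hd y : `|f c - y| < r -> is_derive y 1 h (dh y).
  by rewrite lt_min => /andP[_ yr]; exact: D2.
have [w wr E] := mvt_ball hd (near s (lexx _) st) (near t st (lexx _)).
have J : ig `[s, t] g by exact: ig_itvS gi.
have Jk : ig `[s, t] (fun x => g x * kk x) by exact: ig_itvS gki.
have -> : h (f t) - h (f s) - \int[mu]_(x in `[s, t]) (g x * kk x) =
  \int[mu]_(x in `[s, t]) (dh w * g x - g x * kk x).
  rewrite I_B//; [|exact: igZ].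
  by rewrite I_Z// -fg// E.
apply: (le_trans (I_norm _ _)) => //; first by apply: igB => //; exact: igZ.
rewrite -I_Z//; last exact: ig_norm.
apply: I_le => //.
- by apply: ig_norm => //; apply: igB => //; exact: igZ.
- by apply: igZ => //; exact: ig_norm.
move=> x /=; rewrite in_itv/= => /andP[sx xt].
have [-> _ _] := hyp x (le_trans as_ sx) (le_trans xt tb).
rewrite (_ : dh w * g x - _ = (dh w - dh (f x)) * g x); last ring.
rewrite normrM ler_wpM2r//.
rewrite (_ : dh w - dh (f x) = (dh (f c) - dh (f x)) - (dh (f c) - dh w)); last ring.
rewrite (le_trans (ler_normB _ _))// (splitr e) lerD// ltW//; apply: D1 => //.
  by have := near x sx xt; rewrite lt_min => /andP[].
by move: wr; rewrite lt_min => /andP[].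
Qed.

Lemma ac_chain {f g h dh} : (forall y : R, is_derive y 1 h (dh y)) ->
  continuous dh -> ac f g -> ac (fun x => h (f x)) (fun x => g x * dh (f x)).
Proof.
move=> hd cdh fg a b; apply: (acon_chain (dh := dh)); last exact: fg.
- exact: ac_cont fg.
- by move=> x; apply: continuous_comp; [exact: (ac_cont fg)|exact: cdh].
- by move=> x _ _; split; [|exact: cdh|apply/nbhs_ballP; exists 1 => //= y _; exact: hd].
Qed.

Lemma ac_id : ac (fun x : R => x) (fun=> 1).
Proof.
apply: acP => [a b|s t st]; first by apply: ig_cont => x; exact: cvg_cst.
by rewrite I_cst// mul1r.
Qed.

Lemma ac_ext {f g f' g'} : ac f g -> f =1 f' -> g =1 g' -> ac f' g'.
Proof. by move=> fg /funext <- /funext <-. Qed.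

Lemma ac_C1 {f df} : (forall x, is_derive x 1 f (df x)) -> continuous df -> ac f df.
Proof.
move=> fd cdf; apply: (ac_ext (ac_chain fd cdf ac_id)) => // x.
by rewrite mul1r.
Qed.

Lemma ac_D {f1 g1 f2 g2} : ac f1 g1 -> ac f2 g2 ->
  ac (fun x => f1 x + f2 x) (fun x => g1 x + g2 x).
Proof.
move=> h1 h2; apply: acP => [a b|s t st].
  by apply: igD => //; [exact: ac_ig h1|exact: ac_ig h2].
rewrite I_D//; [|exact: ac_ig h1|exact: ac_ig h2].
by rewrite -(acE h1 st) -(acE h2 st); ring.
Qed.

Lemma ac_Z {f g} k : ac f g -> ac (fun x => k * f x) (fun x => k * g x).
Proof.
move=> h; apply: acP => [a b|s t st]; first by apply: igZ => //; exact: ac_ig h.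
by rewrite I_Z//; [rewrite -(acE h st) mulrBr|exact: ac_ig h].
Qed.

Lemma ac_N {f g} : ac f g -> ac (fun x => - f x) (fun x => - g x).
Proof. by move=> /(ac_Z (-1)) h; apply: (ac_ext h) => x; rewrite mulN1r. Qed.

Lemma ac_B {f1 g1 f2 g2} : ac f1 g1 -> ac f2 g2 ->
  ac (fun x => f1 x - f2 x) (fun x => g1 x - g2 x).
Proof. by move=> h1 /ac_N h2; exact: ac_D. Qed.

Lemma ac_cst k : ac (fun=> k) (fun=> 0 : R).
Proof.
apply: acP => [a b|s t st]; first by apply: ig_cont => x; exact: cvg_cst.
by rewrite I_cst// mul0r subrr.
Qed.

Lemma ac_shift_cst {f g} k : ac f g -> ac (fun x => f x + k) g.
Proof. by move=> h; apply: (ac_ext (ac_D h (ac_cst k))) => // x; rewrite addr0. Qed.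

Lemma ac_exists {g} : (forall a b, ig `[a, b] g) -> exists f, ac f g.
Proof.
move=> gi.
exists (fun x => if 0 <= x then \int[mu]_(y in `[0, x]) g y
                 else - \int[mu]_(y in `[x, 0]) g y).
apply: acP => // s t st; case: ifPn => t0; case: ifPn => s0.
- by rewrite (I_cat s0 st)//; ring.
- by rewrite opprK (@I_cat _ g s 0 t)//; [rewrite addrC|rewrite leNgt; lra].
- by rewrite (le_trans s0 st) in t0.
- by rewrite (@I_cat _ g s t 0)//; [ring|rewrite leNgt; lra].
Qed.

Lemma ac_meas {f g} : ac f g -> measurable_fun setT g.
Proof.
move=> fg; have -> : setT = \bigcup_(n in setT) ([set` `[- n%:R, n%:R]] : set (measurableTypeR R)).
  apply/seteqP; split => // x _; exists (Num.truncn `|x|).+1 => //=.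
  by rewrite in_itv/= -ler_norml ltW// truncnS_gt.
apply/measurable_fun_bigcup => // n _; apply: ig_meas => //; exact: ac_ig fg.
Qed.

Lemma locint_ac {g} : locally_integrable setT g <->
  measurable_fun setT g /\ forall a b, ig `[a, b] g.
Proof.
split=> [[mg _ gi]|[mg gi]].
  split => // a b; apply/integrableP; split.
    by apply/measurable_EFinP; exact: measurable_funTS.
  by apply: gi => //; exact: segment_compact.
split => //; first exact: openT.
move=> K _ cK; have [M [_ bK]] := compact_bounded cK.
have : ig `[- (`|M| + 1), `|M| + 1] g by exact: gi.
move=> /integrableP[_]; apply: le_lt_trans.
apply: ge0_subset_integral => //.
- exact: compact_measurable.
- by apply/measurable_EFinP; apply: measurableT_comp => //; exact: measurable_funTS.
- move=> x Kx /=; rewrite in_itv/= -ler_norml.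
  by apply: (bK (`|M| + 1)) => //; rewrite (le_lt_trans (ler_norm M))// ltrDl.
Qed.

Lemma ac_locint {f g} : ac f g -> locally_integrable setT g.
Proof.
by move=> fg; apply/locint_ac; split; [exact: ac_meas fg|move=> a b; exact: ac_ig fg].
Qed.

Lemma aeS (P Q : R -> Prop) : (forall x, P x -> Q x) ->
  {ae mu, forall x, P x} -> {ae mu, forall x, Q x}.
Proof. by move=> PQ; apply: filterS => //; exact: (ae_filter_ringOfSetsType mu). Qed.

Lemma aeS2 (P Q S : R -> Prop) : (forall x, P x -> Q x -> S x) ->
  {ae mu, forall x, P x} -> {ae mu, forall x, Q x} -> {ae mu, forall x, S x}.
Proof.
by move=> PQ; apply: filterS2 => //; exact: (ae_filter_ringOfSetsType mu).
Qed.

(** Lebesgue differentiation of the primitive based at -n treats the points x > -n; the countably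
    many exceptional null sets are then united. *)
Lemma ac0_ae {k g} : ac (fun=> k) g -> {ae mu, forall x, g x = 0}.
Proof.
move=> fg; have gi a b := ac_ig (a := a) (b := b) fg.
have gl := ac_locint fg.
have H n : {ae mu, forall x, - n%:R < x -> g x = 0}.
  have Hi y : mu.-integrable [set` Interval (BLeft (- n%:R)) (BRight y)] (EFin \o g).
    exact: gi.
  have := FTC1 Hi gl; apply: aeS => x + nx.
  case=> [|_ <-]; first by rewrite /= lte_fin.
  rewrite derive1E (@near_eq_derive _ _ _ _ (cst 0)) ?derive_cst//.
  near=> y; rewrite /=; have ny : - n%:R <= y.
    by apply: ltW; near: y; exact: lt_nbhsr.
  by rewrite -(acE fg ny) subrr.
have := (ae_foralln (fun n => H n)); apply: aeS => x Hx.
apply: (Hx (Num.truncn `|x|).+1).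
by rewrite ltrNl (le_lt_trans _ (truncnS_gt _))// -normrN ler_norm.
Unshelve. all: by end_near. Qed.

Lemma ac_uniq_ae {f g1 g2} : ac f g1 -> ac f g2 -> {ae mu, forall x, g1 x = g2 x}.
Proof.
move=> h1 h2; have : ac (fun=> 0) (fun x => g1 x - g2 x).
  by apply: (ac_ext (ac_B h1 h2)) => // x; rewrite subrr.
by move=> /ac0_ae; apply: aeS => x /eqP; rewrite subr_eq0 => /eqP.
Qed.

End AbsoluteContinuity.

(** * Translation, reflection, gluing and clamping; limits at infinity of primitives *)

Section ChangeOfVariables.
Context {R : realType}.
Local Notation mu := (@lebesgue_measure R).
Local Notation ig A f := (mu.-integrable A (EFin \o f)).
Implicit Types (f g h df : R -> R) (a b c s t x y k : R) (A B : set (measurableTypeR R)).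

Definition measure_preserving (phi : measurableTypeR R -> measurableTypeR R) :=
  measurable_fun setT phi /\ forall A, measurable A -> mu (phi @^-1` A) = mu A.

Lemma mp_meas {phi A} : measure_preserving phi -> measurable A ->
  measurable (phi @^-1` A).
Proof. by move=> [mphi _] mA; rewrite -[X in measurable X]setTI; exact: mphi. Qed.

Lemma mp_ge0_integral {phi A} {F : R -> \bar R} : measure_preserving phi ->
  measurable A -> measurable_fun A F -> (forall x, A x -> (0 <= F x)%E) ->
  (\int[mu]_(x in phi @^-1` A) F (phi x) = \int[mu]_(x in A) F x)%E.
Proof.
move=> mp mA mF F0; case: (mp) => mphi phiE.
transitivity (\int[pushforward mu phi]_(y in A) F y)%E.
  symmetry; apply: ge0_integral_pushforward => // y; rewrite inE; exact: F0.
by apply: eq_measure_integral => B mB _; exact: phiE.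
Qed.

Lemma mp_integral {phi A} {f : R -> R} : measure_preserving phi -> measurable A ->
  measurable_fun A f ->
  \int[mu]_(x in phi @^-1` A) f (phi x) = \int[mu]_(x in A) f x.
Proof.
move=> mp mA mf; rewrite /Rintegral integralE [in RHS]integralE.
have mF : measurable_fun A (EFin \o f) by exact/measurable_EFinP.
have P := mp_ge0_integral mp mA (measurable_funepos mF) (fun x _ => funepos_ge0 _ x).
have N := mp_ge0_integral mp mA (measurable_funeneg mF) (fun x _ => funeneg_ge0 _ x).
rewrite -P -N; congr (fine (_ - _)%E); apply: eq_integral => x _.
  by rewrite !funeposE.
by rewrite !funenegE.
Qed.

Lemma mp_ig {phi A} {f : R -> R} : measure_preserving phi -> measurable A ->
  ig A f -> ig (phi @^-1` A) (f \o phi).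
Proof.
move=> mp mA /integrableP[mf fi]; apply/integrableP; split.
  rewrite compA; apply: (measurable_comp mA _ mf); first by move=> _ [x Ax <-].
  by apply: measurable_funTS; case: mp.
rewrite (@mp_ge0_integral _ _ (fun x => `|(f x)%:E|%E))//.
exact: measurableT_comp.
Qed.

Lemma mp_shift c : measure_preserving (fun x => x + c).
Proof.
have mphi : measurable_fun setT (fun x : measurableTypeR R => x + c : measurableTypeR R).
  apply: continuous_measurable_fun => x.
  by apply: cvgD; [exact: cvg_id|exact: cvg_cst].
split => // A mA; symmetry.
pose phi : {mfun measurableTypeR R >-> measurableTypeR R} :=
  HB.pack (fun x : measurableTypeR R => x + c : measurableTypeR R)
    (isMeasurableFun.Build _ _ _ _ _ mphi).
apply: (@lebesgue_measure_unique R (pushforward mu phi)) => // X [[a b] _ <-].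
rewrite /pushforward /phi/=.
rewrite [X in _ = mu X](_ : _ = [set` `]a - c, b - c]]); last first.
  by apply/seteqP; split=> x /=; rewrite !in_itv/= => /andP[? ?]; apply/andP; split; lra.
rewrite /= !lebesgue_measure_itv/= !lte_fin ltrD2r; case: ifP => // _.
by rewrite -!EFinB; congr EFin; ring.
Qed.

Lemma mp_opp : measure_preserving (fun x => - x).
Proof.
split; last by move=> A mA; exact: lebesgue_measureN.
by apply: continuous_measurable_fun; exact: opp_continuous.
Qed.

Lemma mp_refl c : measure_preserving (fun x => c - x).
Proof.
have [m1 p1] := mp_shift c; have [m2 p2] := mp_opp.
have -> : (fun x => c - x) = (fun x => x + c) \o (fun x => - x).
  by apply/funext => x /=; rewrite addrC.
split; first exact: measurableT_comp.
move=> A mA; rewrite comp_preimage p2 ?p1//.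
by apply: mp_meas => //; exact: mp_shift.
Qed.

Lemma ac_shift {f g} c : ac f g -> ac (fun x => f (x + c)) (fun x => g (x + c)).
Proof.
move=> fg; have pre a b : (fun x => x + c) @^-1` `[a + c, b + c] = [set` `[a, b]].
  by apply/seteqP; split=> x /=; rewrite !in_itv/= !lerD2r.
apply: acP => [a b|s t st].
  rewrite -pre; apply: (mp_ig (mp_shift c)) => //; exact: ac_ig fg.
rewrite -(pre s t) (mp_integral (mp_shift c))//.
  by rewrite -(acE fg)// lerD2r.
by apply: measurable_funTS; exact: ac_meas fg.
Qed.

Lemma ac_refl {f g} c : ac f g -> ac (fun x => f (c - x)) (fun x => - g (c - x)).
Proof.
move=> fg; have pre a b : (fun x => c - x) @^-1` `[c - b, c - a] = [set` `[a, b]].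
  apply/seteqP; split=> x /=; rewrite !in_itv/= => /andP[? ?];
  by apply/andP; split; lra.
have gi a b : ig `[a, b] (fun x => g (c - x)).
  by rewrite -pre; apply: (mp_ig (mp_refl c)) => //; exact: ac_ig fg.
apply: acP => [a b|s t st]; first exact: igN.
rewrite I_N// -(pre s t) (mp_integral (mp_refl c))//.
  by rewrite -(acE fg) ?opprB// lerD2l lerN2.
by apply: measurable_funTS; exact: ac_meas fg.
Qed.

Lemma I_open_ext {a b f g} : measurable_fun `[a, b] f -> measurable_fun `[a, b] g ->
  (forall x, a < x -> x < b -> f x = g x) ->
  \int[mu]_(x in `[a, b]) f x = \int[mu]_(x in `[a, b]) g x.
Proof.
move=> mf mg fg; rewrite /Rintegral; congr fine.
apply: eq_integral_itv_bounded.
- by apply: measurable_funS mf => //; exact: subset_itv_oo_cc.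
- by apply: measurable_funS mg => //; exact: subset_itv_oo_cc.
- by move=> x; rewrite in_itv/= => /andP[ax xb]; exact: fg.
Qed.

Lemma ac_glue {f1 g1 f2 g2} c : ac f1 g1 -> ac f2 g2 -> f1 c = f2 c ->
  ac (fun x => if x <= c then f1 x else f2 x) (fun x => if x <= c then g1 x else g2 x).
Proof.
move=> h1 h2 fc.
have mg : measurable_fun setT (fun x => if x <= c then g1 x else g2 x).
  apply: measurable_fun_ifT => //; [|exact: ac_meas h1|exact: ac_meas h2].
  apply: measurable_fun_ler => //.
have gi a b : ig `[a, b] (fun x => if x <= c then g1 x else g2 x).
  apply: (@ig_le _ _ _ (fun x => `|g1 x| + `|g2 x|)) => //.
  - exact: measurable_funTS.
  - by apply: igD => //; apply: ig_norm => //; [exact: ac_ig h1|exact: ac_ig h2].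
  - by move=> x _; case: ifP => _; [rewrite lerDl|rewrite lerDr].
have L s t : s <= t -> t <= c ->
    \int[mu]_(x in `[s, t]) (if x <= c then g1 x else g2 x) = f1 t - f1 s.
  move=> st tc; rewrite (acE h1 st); apply: I_ext => x /=; rewrite in_itv/=.
  by move=> /andP[_ xt]; rewrite (le_trans xt tc).
have Rt s t : s <= t -> c <= s ->
    \int[mu]_(x in `[s, t]) (if x <= c then g1 x else g2 x) = f2 t - f2 s.
  (* For s = c the density at the left end point is [g1 c]; a comparison on the open interval
     ignores it. *)
  move=> st cs; rewrite (acE h2 st); apply: I_open_ext.
  - exact: measurable_funTS.
  - by apply: measurable_funTS; exact: ac_meas h2.
  - by move=> x sx _; rewrite leNgt (le_lt_trans cs sx).
apply: acP => // s t st; have [tc|ct] := leP t c.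
  by rewrite (le_trans st tc) L.
have [sc|cs] := leP s c; last by rewrite Rt// ltW.
by rewrite (I_cat sc (ltW ct))// L// Rt ?(ltW ct)// fc; ring.
Qed.

(** Freezing f outside [a, b] restricts its density to [a, b]. This localises lower semicontinuity
    and, with f the identity, yields piecewise linear ramps. *)
Lemma ac_clamp {f g a b} : a <= b -> ac f g ->
  ac (fun x => f (Num.max a (Num.min x b))) (g \_ `[a, b]).
Proof.
move=> ab fg; have gi := ac_ig (a := a) (b := b) fg.
have gi' s t : ig `[s, t] (g \_ `[a, b]).
  apply: ig_itvT; have := (@integrable_mkcond _ _ R mu `[a, b] (EFin \o g) _).1.
  by rewrite -restrict_EFin; apply.
apply: acP => // s t st; rewrite -Rintegral_mkcondr.
have -> : `[s, t] `&` `[a, b] = [set` `[Num.max s a, Num.min t b]] :> set R.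
  apply/seteqP; split=> x /=; rewrite !in_itv/= ge_max le_min.
    by move=> [/andP[-> ->] /andP[-> ->]].
  by move=> /andP[/andP[-> ->] /andP[-> ->]].
have [mn|mn] := leP (Num.max s a) (Num.min t b).
  rewrite -(acE fg mn); move: mn; rewrite ge_max !le_min => /andP[/andP[_ sb] /andP[at_ _]].
  congr (f _ - f _).
    by rewrite max_r// le_min at_ ab.
  by rewrite min_l// maxC.
rewrite set_itv_ge ?Rintegral_set0; last by rewrite bnd_simp -ltNge.
apply/eqP; rewrite subr_eq0; apply/eqP; congr f.
move: mn; rewrite gt_min !lt_max => /orP[/orP[ts|ta]|/orP[bs|ba]].
- by move: (le_lt_trans st ts); rewrite ltxx.
- have sa := le_lt_trans st ta.
  by rewrite !max_l// ge_min ?(ltW ta) ?(ltW sa).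
- by rewrite !min_r// ltW// (lt_le_trans bs).
- by move: (le_lt_trans ab ba); rewrite ltxx.
Qed.

Lemma ig_tail {g e} : ig setT g -> 0 < e -> exists2 A, 0 < A &
  forall a b, a <= - A -> A <= b ->
    \int[mu]_x `|g x| - e < \int[mu]_(x in `[a, b]) `|g x|.
Proof.
move=> gi e0; have gn := ig_norm measurableT gi.
pose F n : set (measurableTypeR R) := [set` `[- n%:R, n%:R]].
have ndF : nondecreasing_seq F.
  move=> m n mn; apply/subsetPset => x; rewrite /F/= !in_itv/= -!ler_norml => h.
  by rewrite (le_trans h)// ler_nat.
have FT : \bigcup_i F i = setT.
  apply/seteqP; split => // x _; exists (Num.truncn `|x|).+1 => //.
  by rewrite /F/= in_itv/= -ler_norml ltW// truncnS_gt.
have mF i : measurable (F i) by exact: measurable_itv.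
have mf i : measurable_fun (F i) (fun x => `|g x|%:E).
  by apply/measurable_EFinP; apply: measurable_funTS; exact: ig_meas gn.
have f0 i x : F i x -> (0 <= `|g x|%:E)%E by rewrite lee_fin.
have := @ge0_nondecreasing_set_cvg_integral _ _ R F _ mu ndF mF mf f0.
rewrite FT (I_fin measurableT gn).
under eq_fun do rewrite (I_fin _ (igS measurableT _ _ gn))//.
move=> /fine_cvgP[_] /cvgrPdist_lt /(_ e e0) [N _ /(_ N (leqnn N))] /=.
rewrite ltr_norml => /andP[_ H].
exists (N%:R + 1) => // a b aN Nb; rewrite ltrBlDr -ltrBlDl.
apply: le_lt_trans H; rewrite lerB//.
apply: I_subset => //; last exact: ig_itvT.
by move=> x; rewrite /F/= !in_itv/= => /andP[x1 x2]; apply/andP; split; lra.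
Qed.

Lemma ac_tail {f g e} : ac f g -> ig setT g -> 0 < e -> exists2 A, 0 < A &
  (forall s t, A <= s -> A <= t -> `|f t - f s| <= e) /\
  (forall s t, s <= - A -> t <= - A -> `|f t - f s| <= e) /\
  (forall s t, s <= - A -> A <= t -> `|f t - f s - \int[mu]_x g x| <= e).
Proof.
move=> fg gi e0; have [A A0 HA] := ig_tail gi e0; exists A => //.
have gn := ig_norm measurableT gi.
have H s t : s <= t -> `|f t - f s| <= \int[mu]_(x in `[s, t]) `|g x|.
  by move=> st; rewrite (acE fg st); apply: I_norm => //; exact: ig_itvT.
have tot a b : \int[mu]_(x in `[a, b]) `|g x| <= \int[mu]_x `|g x|.
  by apply: I_subset.
split; [|split].
- move=> s t; wlog st : s t / s <= t => [W|] As At.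
    by have [/W|/ltW/W] := leP s t; [exact|rewrite distrC; exact].
  apply: (le_trans (H s t st)).
  have := HA (- A) s (lexx _) As; have := tot (- A) t.
  rewrite (@I_cat _ _ (- A) s t) ?(ig_itvT gn)//; lra.
- move=> s t; wlog st : s t / s <= t => [W|] As At.
    by have [/W|/ltW/W] := leP s t; [exact|rewrite distrC; exact].
  apply: (le_trans (H s t st)).
  have := HA t A At (lexx _); have := tot s A.
  rewrite (@I_cat _ _ s t A) ?(ig_itvT gn)//; lra.
- move=> s t sA At; have st : s <= t by lra.
  rewrite (acE fg st) distrC.
  have mO : measurable (~` [set` `[s, t]] : set (measurableTypeR R)) by exact: measurableC.
  have TE : setT = ([set` `[s, t]] : set (measurableTypeR R)) `|` ~` [set` `[s, t]].
    by rewrite setUv.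
  have dj : [disjoint ([set` `[s, t]] : set (measurableTypeR R)) & ~` [set` `[s, t]]].
    by apply/disj_setPS => x [].
  have E (k : R -> R) : ig setT k ->
    \int[mu]_x k x = \int[mu]_(x in `[s, t]) k x + \int[mu]_(x in ~` `[s, t]) k x.
    by move=> ki; rewrite [X in \int[mu]_(x in X) _]TE I_setU// -TE.
  rewrite (E g gi) addrAC subrr add0r.
  apply: (le_trans (I_norm mO _)); first exact: igS gi.
  by have := HA s t sA At; rewrite (E _ gn); lra.
Qed.

Lemma cvgyP {f} {l : R} : (f x @[x --> +oo] --> l) <->
  forall e, 0 < e -> exists M : R, forall x, M <= x -> `|f x - l| <= e.
Proof.
split=> [/cvgrPdist_le H e /H [A [_ HA]]|H].
  exists (A + 1) => x Ax; rewrite distrC; apply: HA; lra.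
apply/cvgrPdist_le => e /H [A HA].
exists A; split; first exact: num_real.
by move=> x Ax; rewrite distrC HA// ltW.
Qed.

Lemma cvgNyP {f} {l : R} : (f x @[x --> -oo] --> l) <->
  forall e, 0 < e -> exists M : R, forall x, x <= M -> `|f x - l| <= e.
Proof.
split=> [/cvgrPdist_le H e /H [A [_ HA]]|H].
  exists (A - 1) => x Ax; rewrite distrC; apply: HA; lra.
apply/cvgrPdist_le => e /H [A HA].
exists A; split; first exact: num_real.
by move=> x Ax; rewrite distrC HA// ltW.
Qed.

Lemma cvgnP {u : nat -> R} {l : R} : (u n @[n --> \oo] --> l) <->
  forall e, 0 < e -> exists N, forall n, (N <= n)%N -> `|u n - l| <= e.
Proof.
split=> [/cvgrPdist_le H e /H [N _ HN]|H].
  by exists N => n Nn; rewrite distrC; exact: HN.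
apply/cvgrPdist_le => e /H [N HN].
by exists N => // n /= Nn; rewrite distrC HN.
Qed.

Lemma ac_cvgy {f g} : ac f g -> ig setT g -> exists l : R, f x @[x --> +oo] --> l.
Proof.
move=> fg gi.
have : cvgn (fun n => f n%:R).
  apply/cauchy_cvgP/cauchy_ballP => e e0.
  have e20 : 0 < e / 2 by lra.
  have [A A0 [H _]] := ac_tail fg gi e20.
  have near : \forall n \near \oo, A <= n%:R :> R by exact: nbhs_infty_ger.
  pose S := [set y : R | exists2 n : nat, A <= n%:R & y = f n%:R].
  exists (S, S); first by split; apply: filterS near => n An; exists n.
  move=> [_ _] /= [[m Am ->] [n An ->]]; rewrite /ball/=; apply: (@le_lt_trans _ _ (e / 2)); last lra.
  exact: H.
move=> /cvg_ex[l fl]; exists l; apply/cvgyP => e e0.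
have e20 : 0 < e / 2 by lra.
have [A A0 [H _]] := ac_tail fg gi e20.
have /cvgnP/(_ _ e20)[N /(_ (maxn N (Num.truncn A).+1))] := fl.
rewrite leq_maxl => /(_ isT) HN; exists A => x Ax.
have : `|f x - f (maxn N (Num.truncn A).+1)%:R| <= e / 2.
  apply: H => //; apply: (le_trans (ltW (truncnS_gt A))).
  by rewrite ler_nat leq_maxr.
move=> H2.
rewrite (_ : f x - l = (f x - f (maxn N (Num.truncn A).+1)%:R) +
   (f (maxn N (Num.truncn A).+1)%:R - l)); last ring.
by rewrite (le_trans (ler_normD _ _))// (splitr e) lerD.
Qed.

Lemma cvgNy_refl {f} {l : R} : (f (- x) @[x --> +oo] --> l) -> f x @[x --> -oo] --> l.
Proof.
move=> /cvgyP H; apply/cvgNyP => e /H[A HA]; exists (- A) => x xA.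
by rewrite -[x]opprK; apply: HA; lra.
Qed.

(** The fundamental theorem of calculus on the whole line: through it a momentum integral becomes a
    difference of limits at the two ends. *)
Lemma ac_lims {f g} : ac f g -> ig setT g -> exists l1 l2 : R,
  [/\ f x @[x --> -oo] --> l1, f x @[x --> +oo] --> l2 & l2 - l1 = \int[mu]_x g x].
Proof.
move=> fg gi; have [l2 H2] := ac_cvgy fg gi.
have fg' := ac_refl 0 fg.
have [l1 H1] : exists l : R, f (0 - x) @[x --> +oo] --> l.
  apply: (ac_cvgy fg'); apply: igN => //.
  by have := mp_ig (mp_refl 0) measurableT gi; rewrite preimage_setT.
have H1' : f x @[x --> -oo] --> l1.
  by apply: cvgNy_refl; under eq_fun do rewrite -sub0r.
exists l1, l2; split => //; apply/eqP; rewrite -subr_eq0 -normr_le0.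
apply: le_addeps => e e0; rewrite add0r; have e30 : 0 < e / 3 by lra.
have [A A0 [_ [_ H]]] := ac_tail fg gi e30.
have /cvgyP/(_ _ e30)[A2 HA2] := H2; have /cvgNyP/(_ _ e30)[A1 HA1] := H1'.
pose t := Num.max A A2; pose s := Num.min (- A) A1.
have h2 := HA2 t _; have h1 := HA1 s _; have h := H s t _ _.
have {}h2 : `|f t - l2| <= e / 3 by apply: HA2; rewrite /t le_max lexx orbT.
have {}h1 : `|f s - l1| <= e / 3 by apply: HA1; rewrite /s ge_min lexx orbT.
have {}h : `|f t - f s - \int[mu]_x g x| <= e / 3.
  by apply: H; [rewrite /s ge_min lexx|rewrite /t le_max lexx].
rewrite (_ : l2 - l1 - _ = (f t - f s - \int[mu]_x g x) - (f t - l2) + (f s - l1)); last ring.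
apply: (le_trans (ler_normD _ _)).
rewrite (_ : e = (e / 3 + e / 3) + e / 3); last by field.
by rewrite lerD// (le_trans (ler_normB _ _))// lerD.
Qed.

End ChangeOfVariables.

(** * Fatou's lemma for real functions and completeness of L^2 *)

Section SquareIntegrable.
Context {R : realType}.
Local Notation mu := (@lebesgue_measure R).
Local Notation ig A f := (mu.-integrable A (EFin \o f)).
Implicit Types (f g h df : R -> R) (a b c s t x y e : R) (A B : set (measurableTypeR R)).

Lemma cvg_toEFin {u : nat -> R} {l : R} : u n @[n --> \oo] --> l ->
  (u n)%:E @[n --> \oo] --> l%:E.
Proof. by move=> ul; apply: cvg_EFin => //; exact: nearW. Qed.

Lemma fatou_real {A} {F_ : nat -> R -> R} {F : R -> R} {M : R} : measurable A ->
  (forall n, ig A (F_ n)) -> (forall n x, A x -> 0 <= F_ n x) ->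
  measurable_fun A F -> (forall x, A x -> 0 <= F x) ->
  {ae mu, forall x, A x -> F_ n x @[n --> \oo] --> F x} ->
  (forall n, \int[mu]_(x in A) F_ n x <= M) ->
  ig A F /\ \int[mu]_(x in A) F x <= M.
Proof.
move=> mA iF F_0 mF F0 cF FM; apply: ge0_ig => //.
have mF_ n : measurable_fun A (fun x => (F_ n x)%:E).
  by apply/measurable_EFinP; exact: ig_meas (iF n).
have -> : (\int[mu]_(x in A) (F x)%:E =
    \int[mu]_(x in A) limn_einf (fun n => (F_ n x)%:E))%E.
  apply: ae_eq_integral => //.
  - exact/measurable_EFinP.
  - rewrite /limn_einf; apply: measurableT_comp => //.
    apply: (@measurable_fun_limn_esup _ _ _ _ (fun n x => (- (F_ n x)%:E)%E)) => n.
    rewrite (_ : (fun x => _) = EFin \o (fun x => - F_ n x))//.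
    by apply/measurable_EFinP; apply: measurableT_comp => //; exact: ig_meas (iF n).
  - move: cF; apply: aeS => x cx Ax; symmetry.
    by have [] := @cvg_limn_einf_sup R _ (F x)%:E (cvg_toEFin (cx Ax)).
apply: le_trans (@fatou _ _ _ mu A mA (fun n x => (F_ n x)%:E) mF_ _) _.
  by move=> n x Ax; rewrite lee_fin F_0.
rewrite limn_einf_lim; apply: lime_le; first exact: is_cvg_einfs.
apply: nearW => n; apply: (@le_trans _ _ (\int[mu]_(x in A) (F_ n x)%:E)%E).
  by apply: ereal_inf_lbound; exists n => //=.
by rewrite I_fin// lee_fin.
Qed.

Lemma sum_geo4 (n : nat) : \sum_(0 <= i < n) (4 ^- i : R) = 4 / 3 * (1 - 4 ^- n).
Proof.
elim: n => [|n IH]; first by rewrite big_geq// expr0 invr1 subrr mulr0.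
rewrite big_nat_recr//= IH exprS invfM; field.
by rewrite expf_neq0.
Qed.

(** The squared increments, bounded by K 8^-i, are summed with weights 2^i: the sum S has integral
    at most K sum 4^-i, hence is finite almost everywhere. There |y| <= (2^-i + 2^i y^2) / 2 makes
    the increments absolutely summable. *)
Lemma L2_cauchy_cvg_ae {h_ : nat -> R -> R} {K : R} :
  (forall n, measurable_fun setT (h_ n)) ->
  (forall k, ig setT (fun x => (h_ k.+1 x - h_ k x) ^+ 2) /\
     \int[mu]_x (h_ k.+1 x - h_ k x) ^+ 2 <= K * 8 ^- k) ->
  {ae mu, forall x, cvgn (fun n => h_ n x)}.
Proof.
move=> mh hk.
pose S n x := \sum_(0 <= i < n) 2 ^+ i * (h_ i.+1 x - h_ i x) ^+ 2.
have igS n : ig setT (S n) /\ \int[mu]_x S n x <= K * (4 / 3 * (1 - 4 ^- n)).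
  rewrite -sum_geo4; elim: n => [|n [IH1 IH2]].
    rewrite /S; split.
      apply: (@ig_ext _ _ (fun=> 0)) => // [x _|]; first by rewrite big_geq.
      exact: integrable0.
    under eq_Rintegral do rewrite big_geq//.
    by rewrite big_geq// mulr0 /Rintegral integral0.
  have [i1 i2] := hk n.
  have i3 := igZ (2 ^+ n) measurableT i1.
  have E x : S n x + 2 ^+ n * (h_ n.+1 x - h_ n x) ^+ 2 = S n.+1 x.
    by rewrite /S big_nat_recr.
  split; first by apply: (ig_ext _ (fun x _ => E x)) => //; exact: igD.
  rewrite -(I_ext (fun x _ => E x)) I_D// big_nat_recr//= mulrDr lerD// I_Z//.
  have -> : K * 4 ^- n = 2 ^+ n * (K * 8 ^- n).
    rewrite (_ : 8 = 2 * 4 :> R); last by ring.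
    by rewrite exprMn; field; rewrite !expf_neq0.
  by rewrite ler_wpM2l// exprn_ge0.
have S0 n x : 0 <= S n x.
  by apply: sumr_ge0 => i _; apply: mulr_ge0; [exact: exprn_ge0|exact: sqr_ge0].
have ndS x : {homo (fun n => S n x) : n m / (n <= m)%N >-> n <= m}.
  apply/nondecreasing_seqP => n; rewrite /S big_nat_recr//= lerDl.
  by apply: mulr_ge0; [exact: exprn_ge0|exact: sqr_ge0].
have K0 : 0 <= K.
  have [_ h] := hk 0%N; move: h; rewrite expr0 invr1 mulr1; apply: le_trans.
  by apply: I_ge0 => x _; rewrite sqr_ge0.
have mSE n : measurable_fun setT (fun x => (S n x)%:E).
  by apply/measurable_EFinP; exact: ig_meas (igS n).1.
have S0E n x : setT x -> (0 <= (S n x)%:E)%E by move=> _; rewrite lee_fin.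
have ndSE x : setT x -> {homo (fun n => (S n x)%:E) : n m / (n <= m)%N >-> (n <= m)%E}.
  by move=> _ n m nm; rewrite lee_fin; exact: ndS.
have cS x : cvgn (fun n => (S n x)%:E).
  by apply: ereal_nondecreasing_is_cvgn; exact: ndSE.
have mc := @monotone_convergence _ _ _ mu setT measurableT (fun n x => (S n x)%:E) mSE S0E ndSE.
have intS : mu.-integrable setT (fun x => limn (fun n => (S n x)%:E)).
  apply/integrableP; split.
    apply: (emeasurable_fun_cvg (fun n x => (S n x)%:E)) => [n|x _]; first exact: mSE.
    by have := cS x.
  have -> : (\int[mu]_x `|limn (fun n => (S n x)%:E)| =
      \int[mu]_x limn (fun n => (S n x)%:E))%E.
    apply: eq_integral => x _; rewrite gee0_abs//; apply: lime_ge => //.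
    by apply: nearW => n; rewrite lee_fin.
  rewrite mc; apply: (@le_lt_trans _ _ (K * (4 / 3))%:E); last exact: ltry.
  apply: lime_le.
    apply: ereal_nondecreasing_is_cvgn => n m nm.
    by apply: ge0_le_integral; [by []|exact: S0E|exact: mSE|exact: mSE|move=> x xT; exact: ndSE].
  apply: nearW => n; rewrite I_fin//; last exact: (igS n).1.
  rewrite lee_fin (le_trans (igS n).2)// ler_wpM2l//.
  have p : 0 <= 4 ^- n :> R by rewrite invr_ge0 exprn_ge0.
  by lra.
have := integrable_ae measurableT intS; apply: aeS => x /(_ I) fin.
pose M := fine (limn (fun n => (S n x)%:E)).
have SM n : S n x <= M.
  rewrite -lee_fin fineK//; apply: lime_ge => //.
  by exists n => // m /= nm; rewrite lee_fin ndS.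
pose y_ i := h_ i.+1 x - h_ i x.
have : cvgn (series y_).
  have E n : [normed series y_] n = \sum_(0 <= i < n) `|y_ i| by [].
  apply: normed_cvg; apply: nondecreasing_is_cvgn.
    by apply/nondecreasing_seqP => n; rewrite !E big_nat_recr//= lerDl.
  exists (1 + M / 2) => _ [n _ <-]; rewrite E.
  apply: (@le_trans _ _ (\sum_(0 <= i < n) (2^-1 * 2 ^- i +
     2^-1 * (2 ^+ i * (h_ i.+1 x - h_ i x) ^+ 2)))).
    apply: ler_sum => i _; rewrite -/(y_ i) -[X in _ * (_ * X)]real_normK ?num_real//.
    set z := `|y_ i|; have t0 : 0 < 2 ^+ i :> R by rewrite exprn_gt0.
    rewrite -subr_ge0 (_ : _ - z = 2^-1 * 2 ^- i * (2 ^+ i * z - 1) ^+ 2).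
      by apply: mulr_ge0; [apply: mulr_ge0; rewrite invr_ge0// ltW|exact: sqr_ge0].
    by field; rewrite gt_eqF.
  rewrite big_split/= -!mulr_sumr lerD//; last first.
    by rewrite (mulrC M); apply: ler_wpM2l; [rewrite invr_ge0|exact: SM].
  rewrite (_ : \sum_(0 <= i < n) 2 ^- i = 2 * (1 - 2 ^- n)).
    have p : 0 <= 2 ^- n :> R by rewrite invr_ge0 exprn_ge0.
    by lra.
  elim: (n) => [|m IH]; first by rewrite big_geq// expr0 invr1 subrr mulr0.
  by rewrite big_nat_recr//= IH exprS invfM; field; rewrite expf_neq0.
move=> cy; have -> : (fun n => h_ n x) = (fun n => series y_ n + h_ 0%N x).
  apply/funext => n; rewrite seriesEnat/= /y_.
  by rewrite telescope_sumr// addrNK.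
apply: is_cvgD => //; exact: is_cvg_cst.
Qed.

Lemma L2_complete {h_ : nat -> R -> R} {K : R} :
  (forall n, measurable_fun setT (h_ n)) ->
  (forall k j, (k <= j)%N -> ig setT (fun x => (h_ j x - h_ k x) ^+ 2) /\
     \int[mu]_x (h_ j x - h_ k x) ^+ 2 <= K * 8 ^- k) ->
  exists g, [/\ measurable_fun setT g, {ae mu, forall x, h_ n x @[n --> \oo] --> g x} &
    forall k, ig setT (fun x => (g x - h_ k x) ^+ 2) /\
     \int[mu]_x (g x - h_ k x) ^+ 2 <= K * 8 ^- k].
Proof.
(* The limit superior is measurable without knowing where the sequence converges; [fine] gives 0
   where it is infinite, which happens only on a null set. *)
move=> mh hk; pose g x := fine (limn_esup (fun n => (h_ n x)%:E)).
have mg : measurable_fun setT g.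
  apply: measurableT_comp => //.
  apply: (@measurable_fun_limn_esup _ _ _ _ (fun n x => (h_ n x)%:E)) => n.
  exact/measurable_EFinP.
have cg : {ae mu, forall x, h_ n x @[n --> \oo] --> g x}.
  have : {ae mu, forall x, cvgn (fun n => h_ n x)}.
    apply: (L2_cauchy_cvg_ae (K := K)) => // k; exact: hk.
  apply: aeS => x /cvg_ex[l hl].
  by have [_ E] := @cvg_limn_einf_sup R _ _ (cvg_toEFin hl); rewrite /g E.
exists g; split => // k.
apply: (@fatou_real _ (fun n x => (h_ (n + k)%N x - h_ k x) ^+ 2)) => //.
- by move=> n; have [] := hk k (n + k)%N (leq_addl _ _).
- by move=> n x _; rewrite sqr_ge0.
- apply: measurable_funX; apply: measurable_funB; [exact: mg|exact: mh].
- by move=> x _; rewrite sqr_ge0.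
- move: cg; apply: aeS => x cx _.
  have cs : h_ (n + k)%N x - h_ k x @[n --> \oo] --> g x - h_ k x.
    by apply: cvgB; [rewrite (cvg_shiftn k (fun n => h_ n x))|exact: cvg_cst].
  under eq_fun do rewrite expr2.
  by rewrite expr2; exact: cvgM.
- by move=> n; have [] := hk k (n + k)%N (leq_addl _ _).
Qed.

End SquareIntegrable.

(** * Closedness and lower semicontinuity of the L^2 norm of derivatives *)

Section WeakClosure.
Context {R : realType}.
Local Notation mu := (@lebesgue_measure R).
Local Notation ig A f := (mu.-integrable A (EFin \o f)).
Implicit Types (f g h df : R -> R) (a b c s t x y e : R) (A B : set (measurableTypeR R)).

Lemma sq_D {A f g} : measurable A -> measurable_fun A f -> measurable_fun A g ->
  ig A (fun x => f x ^+ 2) -> ig A (fun x => g x ^+ 2) ->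
  ig A (fun x => (f x + g x) ^+ 2).
Proof.
move=> mA mf mg fi gi.
apply: (@ig_le _ _ _ (fun x => 2 * f x ^+ 2 + 2 * g x ^+ 2)) => //.
- by apply: measurable_funX; exact: measurable_funD.
- by apply: igD => //; exact: igZ.
- move=> x _; rewrite ger0_norm ?sqr_ge0//; have := sqr_ge0 (f x - g x); nra.
Qed.

Lemma sq_Z {A f} k : measurable A -> ig A (fun x => f x ^+ 2) ->
  ig A (fun x => (k * f x) ^+ 2).
Proof.
move=> mA fi; apply: (ig_ext _ _ (igZ (k ^+ 2) mA fi)) => // x _.
by rewrite exprMn.
Qed.

Lemma sq_B {A f g} : measurable A -> measurable_fun A f -> measurable_fun A g ->
  ig A (fun x => f x ^+ 2) -> ig A (fun x => g x ^+ 2) ->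
  ig A (fun x => (f x - g x) ^+ 2).
Proof.
move=> mA mf mg fi gi; apply: sq_D => //; first exact: measurableT_comp.
by apply: (ig_ext _ _ gi) => // x _; rewrite sqrrN.
Qed.

Lemma sq_M {A f g} : measurable A -> measurable_fun A f -> measurable_fun A g ->
  ig A (fun x => f x ^+ 2) -> ig A (fun x => g x ^+ 2) ->
  ig A (fun x => f x * g x).
Proof.
move=> mA mf mg fi gi.
apply: (@ig_le _ _ _ (fun x => f x ^+ 2 + g x ^+ 2)) => //.
- exact: measurable_funM.
- exact: igD.
- move=> x _; rewrite ler_norml; apply/andP.
  have := sqr_ge0 (f x - g x); have := sqr_ge0 (f x + g x).
  by move=> h1 h2; have := sqr_ge0 (f x); have := sqr_ge0 (g x); split; nra.
Qed.

Lemma sq_ig {f a b} : measurable_fun setT f -> ig setT (fun x => f x ^+ 2) ->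
  ig `[a, b] f.
Proof.
move=> mf fi; apply: (@ig_le _ _ _ (fun x => 1 + f x ^+ 2)) => //.
- exact: measurable_funTS.
- by apply: igD => //; [apply: ig_cont => x; exact: cvg_cst|exact: ig_itvT].
- move=> x _; rewrite ler_norml; apply/andP.
  by have := sqr_ge0 (f x - 1); have := sqr_ge0 (f x + 1); split; nra.
Qed.

(** AM-GM with a free weight, |f| <= (t f^2 + 1/t) / 2, takes the place of the Cauchy-Schwarz
    inequality. *)
Lemma L1_le_L2 {f a b} t : measurable_fun setT f -> ig `[a, b] (fun x => f x ^+ 2) ->
  0 < t -> a <= b ->
  \int[mu]_(x in `[a, b]) `|f x| <=
    (t * \int[mu]_(x in `[a, b]) f x ^+ 2 + t^-1 * (b - a)) / 2.
Proof.
move=> mf fi t0 ab.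
have ci : ig `[a, b] (fun=> t^-1) by apply: ig_cont => x; exact: cvg_cst.
have ti : ig `[a, b] (fun x => t * f x ^+ 2) by exact: igZ.
have fi1 : ig `[a, b] (fun x => 2^-1 * (t * f x ^+ 2 + t^-1)).
  by apply: igZ => //; exact: igD.
have pw x : `|f x| <= 2^-1 * (t * f x ^+ 2 + t^-1).
  have -> : f x ^+ 2 = `|f x| ^+ 2 by rewrite real_normK ?num_real.
  set z := `|f x|.
  rewrite -subr_ge0 (_ : _ - z = 2^-1 * t^-1 * (t * z - 1) ^+ 2).
    by apply: mulr_ge0; [apply: mulr_ge0; rewrite invr_ge0// ltW|exact: sqr_ge0].
  by field; rewrite gt_eqF.
rewrite mulrC -I_Z// -(@I_cst _ a b)// -I_D// -I_Z//; last exact: igD.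
apply: I_le => //; apply: (@ig_le _ _ _ (fun x => 2^-1 * (t * f x ^+ 2 + t^-1))) => //.
  by apply: measurable_funTS; apply: measurableT_comp.
by move=> x _; rewrite normr_id.
Qed.

Lemma nat_above (x : R) : exists n : nat, x < n%:R.
Proof. by exists (Num.truncn x).+1; exact: truncnS_gt. Qed.

(* The derivatives of functions close to f on [-n, n] form a decreasing
   sequence of convex sets; by the parallelogram law, elements of almost minimal
   norm are Cauchy in L^2.  This replaces weak compactness. *)
Lemma closure_L2 {f} {C : R} :
  (forall n : nat, exists u h, [/\ ac u h, ig setT (fun x => h x ^+ 2),
     \int[mu]_x h x ^+ 2 <= C &
     forall x, `|x| <= n%:R -> `|u x - f x| <= n.+1%:R^-1]) ->
  exists g, [/\ ac f g, ig setT (fun x => g x ^+ 2) & \int[mu]_x g x ^+ 2 <= C].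
Proof.
move=> H.
pose P (n : nat) h := exists u, [/\ ac u h, ig setT (fun x => h x ^+ 2),
     \int[mu]_x h x ^+ 2 <= C &
     forall x, `|x| <= n%:R -> `|u x - f x| <= n.+1%:R^-1].
have Pn m n h : (m <= n)%N -> P n h -> P m h.
  move=> mn [u [u1 u2 u3 u4]]; exists u; split => // x xm.
  apply: (le_trans (u4 x _)); first by rewrite (le_trans xm)// ler_nat.
  by rewrite lef_pV2 ?posrE// ler_nat.
have half n h1 h2 : P n h1 -> P n h2 -> P n (fun x => 2^-1 * (h1 x + h2 x)).
  move=> [u [u1 u2 u3 u4]] [v [v1 v2 v3 v4]].
  exists (fun x => 2^-1 * (u x + v x)).
  have mh1 := ac_meas u1; have mh2 := ac_meas v1.
  have isq : ig setT (fun x => (2^-1 * (h1 x + h2 x)) ^+ 2).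
    by apply: sq_Z => //; exact: sq_D.
  split => //; first by apply: ac_Z; exact: ac_D.
    apply: (@le_trans _ _ (\int[mu]_x (2^-1 * (h1 x ^+ 2 + h2 x ^+ 2)))).
      apply: I_le => //; first by apply: igZ => //; exact: igD.
      move=> x _; rewrite -subr_ge0.
      rewrite (_ : _ - _ = 4^-1 * (h1 x - h2 x) ^+ 2); last by field.
      by apply: mulr_ge0; [rewrite invr_ge0|exact: sqr_ge0].
    rewrite I_Z ?I_D//; last exact: igD.
    by rewrite mulrC ler_pdivrMr// mulr_natr mulr2n lerD.
  move=> x xn; rewrite (_ : _ - f x = 2^-1 * ((u x - f x) + (v x - f x))); last by field.
  rewrite normrM ger0_norm// ?invr_ge0//.
  rewrite mulrC ler_pdivrMr// mulr_natr mulr2n.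
  by rewrite (le_trans (ler_normD _ _))// lerD ?u4 ?v4.
pose E n := [set \int[mu]_x h x ^+ 2 | h in P n].
have E0 n : has_inf (E n).
  split.
    by have [u [h [h1 h2 h3 h4]]] := H n; exists (\int[mu]_x h x ^+ 2), h => //; exists u.
  by exists 0 => _ [h _ <-]; apply: I_ge0 => x _; rewrite sqr_ge0.
pose d n := inf (E n).
have dE n h : P n h -> d n <= \int[mu]_x h x ^+ 2.
  by move=> Ph; apply: ge_inf; [exact: (E0 n).2|exists h].
have PH n : exists h, P n h.
  by have [u [h [h1 h2 h3 h4]]] := H n; exists h, u.
have dC n : d n <= C.
  have [h Ph] := PH n; apply: (le_trans (dE n h Ph)).
  by have [u []] := Ph.
have dnd m n : (m <= n)%N -> d m <= d n.
  move=> mn; apply: lb_le_inf; first by have [] := E0 n.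
  by move=> _ [h Ph <-]; apply: dE; exact: Pn Ph.
have hsD : has_sup (range d).
  by split; [exists (d 0%N), 0%N|exists C => _ [n _ <-]; exact: dC].
pose D := sup (range d).
have dD n : d n <= D by apply: sup_upper_bound => //; exists n.
pose q k : R := 8 ^- k.
have q0 k : 0 < q k by rewrite /q invr_gt0 exprn_gt0.
have ex k : exists Nh : nat * (R -> R), [/\ (k <= Nh.1)%N, D - q k <= d Nh.1,
    P Nh.1 Nh.2 & \int[mu]_x Nh.2 x ^+ 2 <= D + q k].
  have [_ [n _ <-] nD] := sup_adherent (q0 k) hsD.
  pose N := maxn k n.
  have [_ [h Ph <-] hN] := inf_adherent (q0 k) (E0 N).
  exists (N, h) => /=; split => //; first exact: leq_maxl.
    by rewrite (le_trans (ltW nD))// dnd// leq_maxr.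
  by rewrite (le_trans (ltW hN))// lerD2r; exact: dD.
have [Nh HNh] := choice ex.
pose h_ k := (Nh k).2; pose N_ k := (Nh k).1.
have Ph k : P (N_ k) (h_ k) by have [] := HNh k.
have mh k : measurable_fun setT (h_ k).
  by have [u [u1 _ _ _]] := Ph k; exact: ac_meas u1.
have sqh k : ig setT (fun x => h_ k x ^+ 2) by have [u []] := Ph k.
(* Parallelogram law: the midpoint belongs to a set of index at least k, so its squared norm is at
   least D - q k, and 2 (D + q j) + 2 (D + q k) - 4 (D - q k) <= 8 q k. *)
have key k j : (k <= j)%N -> ig setT (fun x => (h_ j x - h_ k x) ^+ 2) /\
     \int[mu]_x (h_ j x - h_ k x) ^+ 2 <= 8 * 8 ^- k.
  move=> kj; have sB : ig setT (fun x => (h_ j x - h_ k x) ^+ 2).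
    exact: (sq_B measurableT (mh j) (mh k) (sqh j) (sqh k)).
  split => //; have qjk : q j <= q k.
    by rewrite lef_pV2 ?posrE ?exprn_gt0// ler_weXn2l// ler1n.
  pose M := minn (N_ j) (N_ k).
  have DM : D - q k <= d M.
    rewrite /M /minn; case: ifP => _; last by have [] := HNh k.
    by have [_ + _ _] := HNh j; rewrite -/(N_ j); lra.
  have PM : P M (fun x => 2^-1 * (h_ j x + h_ k x)).
    by apply: half; [apply: Pn (Ph j); exact: geq_minl|apply: Pn (Ph k); exact: geq_minr].
  have := dE _ _ PM.
  have [_ _ _ hj] := HNh j; have [_ _ _ hk] := HNh k.
  rewrite -/(h_ j) in hj; rewrite -/(h_ k) in hk.
  have sD : ig setT (fun x => (2^-1 * (h_ j x + h_ k x)) ^+ 2).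
    by have [u []] := PM.
  have -> : \int[mu]_x (h_ j x - h_ k x) ^+ 2 = 2 * \int[mu]_x h_ j x ^+ 2 +
      2 * \int[mu]_x h_ k x ^+ 2 - 4 * \int[mu]_x (2^-1 * (h_ j x + h_ k x)) ^+ 2.
    rewrite -!I_Z// -I_D//; [|exact: igZ|exact: igZ].
    rewrite -I_B//; [|by apply: igD => //; exact: igZ|exact: igZ].
    by apply: I_ext => x _; field.
  rewrite -/(q k); have := q0 k; lra.
have [g [mg cg gh]] := L2_complete mh key.
have [sg gC] : ig setT (fun x => g x ^+ 2) /\ \int[mu]_x g x ^+ 2 <= C.
  apply: (@fatou_real _ _ (fun n x => h_ n x ^+ 2)) => //.
  - by move=> n x _; rewrite sqr_ge0.
  - exact: measurable_funX.
  - by move=> x _; rewrite sqr_ge0.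
  - apply: aeS cg => x cx _; under eq_fun do rewrite expr2.
    by rewrite expr2; exact: cvgM.
  - by move=> n; have [u []] := Ph n.
exists g; split => //; apply: acP => [a b|s t st]; first exact: sq_ig.
have pow2 k : 2 ^- k <= k.+1%:R^-1 :> R.
  rewrite lef_pV2 ?posrE ?exprn_gt0// -natrX ler_nat.
  exact: ltn_expl.
apply/eqP; rewrite -subr_eq0 -normr_le0; apply: le_addeps => e e0; rewrite add0r.
have [k k0P] := nat_above (Num.max (Num.max `|s| `|t|) ((2 + (4 + (t - s) / 2)) / e)).
move: k0P; rewrite !gt_max => /andP[/andP[sk tk] ek].
have [u [u1 u2 u3 u4]] := Ph k.
have kN : (k <= N_ k)%N by have [] := HNh k.
have uf x : `|x| < k%:R -> `|u x - f x| <= k.+1%:R^-1.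
  move=> xk; apply: (le_trans (u4 x _)).
    by rewrite (le_trans (ltW xk))// ler_nat.
  by rewrite lef_pV2 ?posrE// ler_nat.
have ih : ig `[s, t] (h_ k) by exact: sq_ig.
have igg : ig `[s, t] g by exact: sq_ig.
have [gk1 gk2] := gh k.
have B1 : `|\int[mu]_(x in `[s, t]) (g x - h_ k x)| <= 2 ^- k * (4 + (t - s) / 2).
  apply: (le_trans (I_norm _ _)) => //; first exact: igB.
  have p2 : 0 < 2 ^+ k :> R by rewrite exprn_gt0.
  have mB : measurable_fun setT (fun x => g x - h_ k x).
    by apply: measurable_funB; [exact: mg|exact: mh].
  (* The weight 2^k makes both terms of order 2^-k: one is 2^k times 8 8^-k, the other 2^-k (t -
     s). *)
  apply: (le_trans (L1_le_L2 (2 ^+ k) mB (ig_itvT gk1) p2 st)).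
  have : \int[mu]_(x in `[s, t]) (g x - h_ k x) ^+ 2 <= 8 * 8 ^- k.
    by apply: le_trans gk2; apply: I_subset => // x _; rewrite sqr_ge0.
  move=> /(ler_wpM2l (ltW p2)).
  have -> : 2 ^+ k * (8 * 8 ^- k) = 8 * 4 ^- k :> R.
    rewrite (_ : 8 ^+ k = 2 ^+ k * 4 ^+ k :> R); last by rewrite -exprMn; congr (_ ^+ _); ring.
    by field; rewrite !expf_neq0.
  have : 4 ^- k <= 2 ^- k :> R.
    rewrite lef_pV2 ?posrE ?exprn_gt0//; apply: lerXn2r; rewrite ?nnegrE//.
    by rewrite ler_nat.
  lra.
rewrite (_ : f t - f s - _ = (u s - f s) - (u t - f t) -
    \int[mu]_(x in `[s, t]) (g x - h_ k x)); last first.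
  by rewrite I_B// -(acE u1 st); ring.
apply: (le_trans (ler_normB _ _)); apply: (le_trans (lerD (ler_normB _ _) B1)).
have B2 := uf s sk; have B3 := uf t tk; have pk := pow2 k.
have tk0 : 0 <= 4 + (t - s) / 2 by lra.
have B4 := ler_wpM2r tk0 pk.
have : (2 + (4 + (t - s) / 2)) * k.+1%:R^-1 <= e.
  rewrite ler_pdivrMr// (mulrC e) -ler_pdivrMr// (le_trans (ltW ek))//.
  by rewrite ler_nat.
set T := 4 + (t - s) / 2 in B4 *; set z := 2 ^- k in B4 *; set y := k.+1%:R^-1 in B2 B3 B4 *.
rewrite (mulrC z) mulrDl; lra.
Qed.

(** If the inequality failed infinitely often, [closure_L2] with C below the norm of g would produce
    a second density of f of smaller norm, whereas densities agree almost everywhere. *)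
Lemma lsc_L2 {f g} {u_ h_ : nat -> R -> R} : ac f g -> ig setT (fun x => g x ^+ 2) ->
  (forall n, ac (u_ n) (h_ n)) -> (forall n, ig setT (fun x => h_ n x ^+ 2)) ->
  (forall (M : R) e, 0 < e -> \forall n \near \oo, forall x, `|x| <= M ->
     `|u_ n x - f x| <= e) ->
  forall e, 0 < e -> \forall n \near \oo,
    \int[mu]_x g x ^+ 2 - e <= \int[mu]_x h_ n x ^+ 2.
Proof.
move=> fg sg uh sh uf e e0; apply: contrapT => Hn.
have H N : exists2 m, (N <= m)%N & ~ (\int[mu]_x g x ^+ 2 - e <= \int[mu]_x h_ m x ^+ 2).
  apply: contrapT => h; apply: Hn; exists N => // m Nm.
  by apply: contrapT => hm; apply: h; exists m.
have [|g' [fg' sg' g'C]] := @closure_L2 f (\int[mu]_x g x ^+ 2 - e).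
  move=> n; have en : 0 < n.+1%:R^-1 :> R by rewrite invr_gt0.
  have [N _ HN] := uf n%:R _ en.
  have [m Nm /negP] := H N; rewrite -ltNge => hm.
  exists (u_ m), (h_ m); split => //; first exact: ltW.
  by apply: HN.
have E : \int[mu]_x g x ^+ 2 = \int[mu]_x g' x ^+ 2.
  rewrite /Rintegral; congr fine; apply: ae_eq_integral => //.
  - by apply/measurable_EFinP; exact: ig_meas sg.
  - by apply/measurable_EFinP; exact: ig_meas sg'.
  - by apply: aeS (ac_uniq_ae fg fg') => x -> _.
by rewrite E in g'C; lra.
Qed.

End WeakClosure.

(** * Smooth functions: iterated derivatives and the flat exponential *)

Section WeakDerivatives.
Context {R : realType}.
Local Notation mu := (@lebesgue_measure R).
Local Notation ig A f := (mu.-integrable A (EFin \o f)).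
Implicit Types (f g h df dg : R -> R) (a b c s t x y e : R) (A B : set (measurableTypeR R)).

Definition deriv f df := forall x : R, is_derive x (1 : R) f (df x).

Lemma deriv_D {f df g dg} : deriv f df -> deriv g dg ->
  deriv (fun x => f x + g x) (fun x => df x + dg x).
Proof. by move=> hf hg x; exact: (is_deriveD (hf x) (hg x)). Qed.

Lemma deriv_M {f df g dg} : deriv f df -> deriv g dg ->
  deriv (fun x => f x * g x) (fun x => df x * g x + f x * dg x).
Proof.
move=> hf hg x; apply: (is_derive_eq (is_deriveM (hf x) (hg x))).
by rewrite /= addrC; congr (_ + _); exact: mulrC.
Qed.

Lemma deriv_Z {f df} k : deriv f df -> deriv (fun x => k * f x) (fun x => k * df x).
Proof. by move=> hf x; exact: (is_deriveZ k (hf x)). Qed.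

Lemma deriv_affine {f df} k c : deriv f df ->
  deriv (fun x => f (k * x + c)) (fun x => k * df (k * x + c)).
Proof.
move=> hf x; have d : is_derive x (1 : R) (fun x => k * x + c) k.
  have := is_deriveD (is_deriveZ k (is_derive_id x (1 : R))) (is_derive_cst c x (1 : R)).
  by move/is_derive_eq; apply; rewrite addr0 /GRing.scale/= mulr1.
have := @is_derive1_comp R f (fun x => k * x + c) x _ _ (hf _) d.
by move/is_derive_eq; apply; rewrite mulrC.
Qed.

Lemma deriv_cont {f df} : deriv f df -> continuous f.
Proof.
move=> hf x; apply: differentiable_continuous; apply/derivable1_diffP.
by have [] := hf x.
Qed.

(** Differentiability of order n through existential witnesses: stability under sums, products and
    affine substitutions then goes by induction, without formulas for iterated derivatives. *)
Fixpoint times_deriv (n : nat) f : Prop :=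
  if n is m.+1 then exists2 df, deriv f df & times_deriv m df else True.

Lemma times_deriv_pred n f : times_deriv n.+1 f -> times_deriv n f.
Proof.
by elim: n f => // n IH f [df fd /IH h]; exists df.
Qed.

Lemma times_deriv_D n f g : times_deriv n f -> times_deriv n g ->
  times_deriv n (fun x => f x + g x).
Proof.
elim: n f g => // n IH f g [df fd nf] [dg gd ng].
by exists (fun x => df x + dg x); [exact: deriv_D|exact: IH].
Qed.

Lemma times_deriv_Z n k f : times_deriv n f -> times_deriv n (fun x => k * f x).
Proof.
elim: n f => // n IH f [df fd nf].
by exists (fun x => k * df x); [exact: deriv_Z|exact: IH].
Qed.

Lemma times_deriv_M n f g : times_deriv n f -> times_deriv n g ->
  times_deriv n (fun x => f x * g x).
Proof.
elim: n f g => // n IH f g nf' ng'.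
have [df fd nf] := nf'; have [dg gd ng] := ng'.
exists (fun x => df x * g x + f x * dg x); first exact: deriv_M.
by apply: times_deriv_D; apply: IH => //; exact: times_deriv_pred.
Qed.

Lemma times_deriv_affine n k c f : times_deriv n f ->
  times_deriv n (fun x => f (k * x + c)).
Proof.
elim: n f => // n IH f [df fd nf].
exists (fun x => k * df (k * x + c)); first exact: deriv_affine.
by apply: times_deriv_Z; exact: IH.
Qed.

Lemma derive1n_deriv n f : (forall n, times_deriv n f) ->
  forall x, derivable (derive1n n f) x 1.
Proof.
elim: n f => [|n IH] f H x.
  by have [df fd _] := H 1%N; have [] := fd x.
rewrite derive1Sn; apply: IH => m.
have [df fd nf] := H m.+1.
have -> : f^`()%classic = df by apply/funext => y; rewrite derive1E; have [] := fd y.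
by [].
Qed.

(** [exp_inv 0] is the classical function e^{-1/x}, flat at 0; the extra powers of 1/x make the
    family stable under differentiation up to linear combinations. *)
Definition exp_inv (n : nat) x : R := if 0 < x then x^-1 ^+ n * expR (- x^-1) else 0.

Lemma exp_inv_bound n x : 0 < x -> exp_inv n x <= (n.+2)`!%:R * x ^+ 2.
Proof.
move=> x0; rewrite /exp_inv x0; set w := x^-1.
have w0 : 0 < w by rewrite invr_gt0.
have F0 : 0 < (n.+2)`!%:R :> R by rewrite ltr0n fact_gt0.
have := expR_ge1Dxn n.+1 (ltW w0) => H.
have {}H : w ^+ n.+2 / (n.+2)`!%:R <= expR w by apply: le_trans H; rewrite lerDr.
rewrite expRN ler_pdivrMr ?expR_gt0//.
rewrite ler_pdivrMr// in H.
have -> : w ^+ n = w ^+ n.+2 * x ^+ 2.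
  by rewrite -addn2 exprD -mulrA -exprMn mulVf ?gt_eqF// expr1n mulr1.
rewrite [leRHS]mulrAC; apply: ler_wpM2r; [exact: sqr_ge0|by rewrite [leRHS]mulrC].
Qed.

Lemma exp_inv_ge0 n x : 0 <= exp_inv n x.
Proof.
rewrite /exp_inv; case: ifP => // x0.
by rewrite mulr_ge0 ?expR_ge0// exprn_ge0// invr_ge0 ltW.
Qed.

Lemma deriv_exp_inv n :
  deriv (exp_inv n) (fun x => exp_inv n.+2 x - n%:R * exp_inv n.+1 x).
Proof.
move=> x; have [x0|x0|<-] := ltgtP 0 x.
- have d1 : is_derive x (1 : R) (fun y : R => y^-1) (- x ^- 2).
    have := @is_deriveV R id x 1 1 _ (is_derive_id x (1 : R)).
    rewrite gt_eqF// => /(_ isT) /is_derive_eq; apply.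
    by rewrite /GRing.scale/= mulr1.
  pose F (w : R) := w ^+ n * expR (- w).
  have d2 (w : R) : is_derive w (1 : R) F (n%:R * w ^+ n.-1 * expR (- w) - w ^+ n * expR (- w)).
    have e1 : is_derive w (1 : R) (fun w : R => expR (- w)) (- expR (- w)).
      have := @is_derive1_comp R expR (fun w => - w) w _ _ (is_derive_expR _) (is_deriveNid w 1).
      by move/is_derive_eq; apply; rewrite mulrN1.
    have e2 : is_derive w (1 : R) (fun w : R => w ^+ n) (n%:R * w ^+ n.-1).
      have := is_deriveX n (is_derive_id w (1 : R)); rewrite exprfctE.
      by move/is_derive_eq; apply; rewrite /GRing.scale/= mulr1.
    apply: (is_derive_eq (is_deriveM e2 e1)).
    by rewrite /GRing.scale/=; ring.
  have := @is_derive1_comp R F (fun y => y^-1) x _ _ (d2 _) d1.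
  move=> d3.
  apply: (near_eq_is_derive (f := F \o (fun y : R => y^-1))).
    near=> y; rewrite /exp_inv/=.
    suff -> : 0 < y by [].
    by near: y; exact: lt_nbhsr.
  apply: (is_derive_eq d3); rewrite /exp_inv x0.
  case: n @F d2 d3 => [|n] F d2 d3; rewrite /= ?exprS; field; by rewrite gt_eqF.
- apply: (near_eq_is_derive (f := cst 0)).
    near=> y; rewrite /exp_inv/=.
    suff /lt_gtF -> : y < 0 by [].
    by near: y; exact: lt_nbhsl.
  by apply: (is_derive_eq (is_derive_cst _ _ _)); rewrite /exp_inv lt_gtF// mulr0 subr0.
(* At 0 the bound by (n + 2)! x^2 makes the difference quotient tend to 0. *)
- rewrite /exp_inv ltxx mulr0 subr0.
  have cv : (h^-1 *: (exp_inv n (h + 0) - exp_inv n 0)) @[h --> 0^'] --> (0 : R).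
    apply/cvgrPdist_le => e e0.
    have F0 : 0 < (n.+2)`!%:R :> R by rewrite ltr0n fact_gt0.
    near=> h; have h0 : h != 0 by near: h; exact: nbhs_dnbhs_neq.
    rewrite sub0r normrN addr0 /(exp_inv n 0) ltxx subr0 /GRing.scale/= normrM normfV.
    have he : `|h| <= e / (n.+2)`!%:R.
      near: h; apply: nbhs_dnbhs; apply/nbhs_ballP.
      exists (e / (n.+2)`!%:R); first by rewrite /= divr_gt0.
      by move=> z; rewrite /ball/= sub0r normrN => /ltW.
    rewrite mulrC ler_pdivrMr ?normr_gt0// ger0_norm ?exp_inv_ge0//.
    have [hp|hn] := ltP 0 h; last first.
      by rewrite /exp_inv ltNge hn/= mulr_ge0// ltW.
    apply: (le_trans (exp_inv_bound n h hp)).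
    rewrite (gtr0_norm hp) in he *.
    rewrite expr2 mulrA ler_wpM2r ?(ltW hp)// mulrC -ler_pdivlMr//.
  split; first by apply/cvg_ex; exists 0; under eq_fun do rewrite /GRing.scale/= mulr1.
  apply/cvg_lim => //; under eq_fun do rewrite [_%:A]mulr1.
  by [].
Unshelve. all: by end_near. Qed.

Lemma times_deriv_exp_inv m n : times_deriv m (exp_inv n).
Proof.
elim: m n => // m IH n.
exists (fun x => exp_inv n.+2 x - n%:R * exp_inv n.+1 x); first exact: deriv_exp_inv.
apply: times_deriv_D => //.
have -> : (fun x => - (n%:R * exp_inv n.+1 x)) = (fun x => - n%:R * exp_inv n.+1 x).
  by apply/funext => x; rewrite mulNr.
exact: times_deriv_Z.
Qed.

Lemma ac_deriv {f g} : ac f g -> continuous g -> deriv f g.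
Proof.
move=> fg cg x.
have xx : x < x + 1 by rewrite ltrDl.
have x1 : x - 1 < x by rewrite ltrBlDr ltrDl.
have i1 : ig `[x - 1, x + 1] g by exact: ig_cont.
have [d1 d2] := @continuous_FTC1_closed R g (x - 1) x (x + 1) xx i1 x1 (cg x).
have d3 : is_derive x (1 : R) (fun y => \int[mu]_(t in `[x - 1, y]) g t + f (x - 1)) (g x).
  have d4 : is_derive x (1 : R) (fun y => \int[mu]_(t in `[x - 1, y]) g t) (g x).
    by split; [exact: d1|rewrite -derive1E; exact: d2].
  have := is_deriveD d4 (is_derive_cst (f (x - 1)) x (1 : R)).
  by move/is_derive_eq; apply; rewrite addr0.
apply: near_eq_is_derive d3; near=> y.
have xy : x - 1 <= y by apply: ltW; near: y; exact: lt_nbhsr.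
by rewrite -(acE fg xy) addrNK.
Unshelve. all: by end_near. Qed.

End WeakDerivatives.

(** * Weak derivatives of continuous functions are densities, and conversely *)

Section WeakDerivativeAC.
Context {R : realType}.
Local Notation mu := (@lebesgue_measure R).
Local Notation ig A f := (mu.-integrable A (EFin \o f)).
Implicit Types (f g h df dg phi : R -> R) (a b c s t x y e : R) (A B : set (measurableTypeR R)).

Lemma I_supp {f} r : (forall x, r < `|x| -> f x = 0) ->
  \int[mu]_x f x = \int[mu]_(x in `[- r, r]) f x.
Proof.
move=> f0; rewrite [RHS]Rintegral_mkcond; apply: eq_Rintegral => x _.
rewrite patchE; case: ifPn => //; rewrite notin_setE/= in_itv/= -ler_norml.
by move=> /negP; rewrite -ltNge => /f0.
Qed.

Lemma test_deriv phi : test_function phi -> deriv phi (derive1 phi) /\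
  continuous (derive1 phi).
Proof.
move=> [sm _]; have d : deriv phi (derive1 phi).
  by move=> x; split; [exact: (sm 0%N x)|rewrite derive1E].
split => // x; apply: differentiable_continuous; apply/derivable1_diffP.
exact: (sm 1%N x).
Qed.

Lemma test_supp phi : test_function phi ->
  exists r, 0 <= r /\ (forall x, r < `|x| -> phi x = 0 /\ derive1 phi x = 0).
Proof.
move=> [_ [r Hr]]; exists (Num.max r 0); split; first by rewrite le_max lexx orbT.
move=> x; rewrite gt_max => /andP[rx _]; split; first exact: Hr.
rewrite derive1E (@near_eq_derive _ _ _ _ (cst 0)) ?derive_cst//.
near=> y; apply: Hr; near: y.
have : {for x, continuous (fun y : R => `|y|)} by apply: norm_continuous.
by move=> /cvgr_gt; apply.
Unshelve. all: by end_near. Qed.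

Lemma ac_weak {f g} : ac f g -> weak_derivative f g.
Proof.
move=> fg; split.
- apply/locint_ac; split; first exact: cont_meas (ac_cont fg).
  by move=> a b; apply: ig_cont; exact: ac_cont fg.
- exact: ac_locint fg.
move=> phi tphi; have [d cd] := test_deriv phi tphi.
have [r [r0 Hr]] := test_supp phi tphi.
rewrite (I_supp r) => [|x /Hr[_ ->]]; last by rewrite mulr0.
rewrite (@I_supp (fun x => g x * phi x) r) => [|x /Hr[-> _]]; last by rewrite mulr0.
have acp := ac_mul fg (ac_C1 d cd).
have fr y : r < `|y| -> f y * phi y = 0 by move=> /Hr[-> _]; rewrite mulr0.
have i1 s t : ig `[s, t] (fun x => g x * phi x).
  by apply: ig_mulC; [exact: ac_ig fg|exact: deriv_cont d].
have i2 s t : ig `[s, t] (fun x => derive1 phi x * f x).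
  by apply: ig_mulC; [exact: ig_cont|exact: ac_cont fg].
apply/eqP; rewrite -addr_eq0 addrC; apply/eqP.
rewrite [X in _ + X](_ : _ = \int[mu]_(x in `[- r, r]) (derive1 phi x * f x)); last first.
  by apply: I_ext => x _; rewrite mulrC.
(* The support condition speaks of r < |x| only, so the interval is enlarged to [-(r + 1), r + 1],
   where the boundary terms vanish. *)
have out (k : R -> R) (ki : forall s t, ig `[s, t] k) (k0 : forall x, r < `|x| -> k x = 0) :
    \int[mu]_(x in `[- r, r]) k x = \int[mu]_(x in `[- (r + 1), r + 1]) k x.
  rewrite -(I_supp r k0) (I_supp (r + 1))// => x xr; apply: k0.
  by apply: le_lt_trans xr; rewrite lerDl.
rewrite (out (fun x => g x * phi x))//; last by move=> x /Hr[-> _]; rewrite mulr0.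
rewrite (out (fun x => derive1 phi x * f x))//; last by move=> x /Hr[_ ->]; rewrite mul0r.
rewrite -I_D// -(acE acp); last by lra.
by rewrite !fr ?subrr// ?normrN ger0_norm; lra.
Qed.

Lemma locally_bounded_below {f a m} : continuous f -> m < f a ->
  exists2 d, 0 < d & forall x, a <= x -> x <= a + d -> m < f x.
Proof.
move=> cf ma; have /cvgrPdist_lt /(_ (f a - m)) := cf a.
rewrite subr_gt0 => /(_ ma) /nbhs_ballP[d /= d0 D].
exists (d / 2); first by lra.
move=> x ax xd; have : `|f a - f x| < f a - m.
  by apply: D; rewrite /ball/= ltr_norml; apply/andP; split; lra.
by rewrite ltr_norml => /andP[_]; lra.
Qed.

(** P is a smooth step from 0 to k > 0, so the difference of two rescaled translates is a test
    function whose derivative is known explicitly. *)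
Lemma bump_exists : exists chi P : R -> R, [/\ forall n, times_deriv n P, deriv P chi,
  forall x, 0 <= chi x, (forall x, 0 < x -> x < 1 -> 0 < chi x) /\
    (forall x, x <= 0 \/ 1 <= x -> chi x = 0) &
  exists2 k, 0 < k & (forall x, x <= 0 -> P x = 0) /\ (forall x, 1 <= x -> P x = k)].
Proof.
pose chi x := exp_inv 0 x * exp_inv 0 ((-1) * x + 1).
have chin n : times_deriv n chi.
  by apply: times_deriv_M; [|apply: times_deriv_affine]; exact: times_deriv_exp_inv.
have cchi : continuous chi by have [d dd _] := chin 1%N; exact: deriv_cont dd.
have chi0 x : 0 <= chi x by rewrite mulr_ge0// exp_inv_ge0.
have chi01 x : 0 < x -> x < 1 -> 0 < chi x.
  move=> x0 x1; rewrite /chi /exp_inv x0 (_ : 0 < -1 * x + 1); last lra.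
  by rewrite !expr0 !mul1r mulr_gt0// expR_gt0.
have chil x : x <= 0 -> chi x = 0.
  by move=> x0; rewrite /chi {1}/exp_inv ltNge x0 mul0r.
have chir x : 1 <= x -> chi x = 0.
  move=> x1; rewrite /chi {2}/exp_inv ltNge (_ : -1 * x + 1 <= 0) ?mulr0//; lra.
have [P0 acP0] : exists P, ac P chi by apply: ac_exists => a b; exact: ig_cont.
pose P x := P0 x + (- P0 0).
have aP : ac P chi by exact: ac_shift_cst.
have dP : deriv P chi by exact: ac_deriv.
exists chi, P; split => //.
- by case=> // n; exists chi.
- by split => // x [/chil|/chir].
have zero s t : s <= t -> (forall x, s <= x -> x <= t -> chi x = 0) -> P t = P s.
  move=> st H; apply/eqP; rewrite -subr_eq0 (acE aP st) (@I_ext _ _ chi (fun=> 0)).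
    by rewrite I_cst// mul0r.
  by move=> x /=; rewrite in_itv/= => /andP[? ?]; exact: H.
exists (P 1); last first.
  split=> x x0; last by apply: zero => // y y1 _; exact: chir.
  have -> : P x = P 0 by symmetry; apply: zero => // y _ y0; exact: chil.
  by rewrite /P subrr.
have P00 : P 0 = 0 by rewrite /P subrr.
have mid : 0 < chi 2^-1 by apply: chi01; rewrite ?invr_gt0// invf_lt1// ltr1n.
have [d d0 D] := locally_bounded_below (a := 2^-1) (m := chi 2^-1 / 2) cchi ltac:(lra).
pose d' := Num.min d 2^-1; have d'0 : 0 < d' by rewrite lt_min d0 invr_gt0/=.
have h2 : 2^-1 + d' <= 1.
  by rewrite -lerBrDl (_ : 1 - 2^-1 = 2^-1); [rewrite ge_min lexx orbT|field].
have incr s t : s <= t -> P s <= P t.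
  by move=> st; rewrite -subr_ge0 (acE aP st); apply: I_ge0.
have half0 : 0 <= 2^-1 :> R by rewrite invr_ge0.
apply: lt_le_trans (incr _ _ h2).
have -> : P (2^-1 + d') = P (2^-1 + d') - P 0 by rewrite P00 subr0.
apply: (@lt_le_trans _ _ (P (2^-1 + d') - P 2^-1)); last by rewrite lerB// incr.
rewrite (acE aP); last by rewrite lerDl ltW.
apply: (@lt_le_trans _ _ (\int[mu]_(x in `[2^-1, 2^-1 + d']) (chi 2^-1 / 2))).
  rewrite I_cst; last by rewrite lerDl ltW.
  rewrite (_ : 2^-1 + d' - 2^-1 = d'); last ring.
  by apply: mulr_gt0 => //; exact: divr_gt0.
apply: I_le => //.
- by apply: ig_cont => x; exact: cvg_cst.
- exact: ig_cont.
move=> x /=; rewrite in_itv/= => /andP[x1 x2]; apply: ltW; apply: D => //.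
by rewrite (le_trans x2)// lerD2l ge_min lexx.
Qed.

(* The fundamental lemma of the calculus of variations: a nonconstant D would
   have a nonzero pairing with the derivative of a test function that rises on
   [a, a + d] and falls back on [b, b + d]. *)
Lemma weak_zero_nlt {D : R -> R} {a b} : continuous D ->
  (forall phi, test_function phi -> \int[mu]_x (D x * derive1 phi x) = 0) ->
  a < b -> D a < D b -> False.
Proof.
move=> cD HD ab Dab; pose m := (D a + D b) / 2.
have [d1 d10 D1] := locally_bounded_below (f := fun x => - D x) (a := a) (m := - m)
   (fun x => cvgN (cD x)) ltac:(rewrite /m; lra).
have [d2 d20 D2] := locally_bounded_below (a := b) (m := m) cD ltac:(rewrite /m; lra).
pose d := Num.min (Num.min d1 d2) ((b - a) / 2).
have d0 : 0 < d by rewrite !lt_min d10 d20; lra.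
have dd1 : d <= d1 by rewrite !ge_min lexx.
have dd2 : d <= d2 by rewrite !ge_min lexx orbT.
have dba : d <= (b - a) / 2 by rewrite ge_min lexx orbT.
have [chi [P [smP dP chi0 [chi01 chiout] [k k0 [Pl Pr]]]]] := bump_exists.
pose phi x := P (d^-1 * x + (- (d^-1 * a))) + (-1) * P (d^-1 * x + (- (d^-1 * b))).
have arg c x : d^-1 * x + - (d^-1 * c) = (x - c) / d by rewrite -mulrBr mulrC.
have sphi : forall n, times_deriv n phi.
  move=> n; apply: times_deriv_D; first exact: times_deriv_affine.
  by apply: times_deriv_Z; exact: times_deriv_affine.
have dphi : deriv phi (fun x => d^-1 * chi ((x - a) / d) + -1 * (d^-1 * chi ((x - b) / d))).
  have := deriv_D (deriv_affine d^-1 (- (d^-1 * a)) dP)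
     (deriv_Z (-1) (deriv_affine d^-1 (- (d^-1 * b)) dP)).
  by move=> H x; have := H x; rewrite !arg.
have supp x : x <= a \/ b + d <= x -> phi x = 0.
  move=> [xa|bx]; rewrite /phi !arg.
    by rewrite !Pl ?mulr0 ?addr0// pmulr_lle0 ?invr_gt0//; lra.
  by rewrite !Pr ?mulN1r ?subrr// ler_pdivlMr// mul1r; lra.
have tphi : test_function phi.
  split; first by move=> n x; exact: derive1n_deriv.
  exists (Num.max `|a| `|b + d|) => x; rewrite gt_max => /andP[ax bx]; apply: supp.
  have [x0|x0] := leP 0 x.
    by right; rewrite (le_trans (ler_norm _))// -(ger0_norm x0) ltW.
  left; rewrite -(opprK a) -lerN2 opprK -(ltr0_norm x0) (le_trans _ (ltW ax))//.
  by rewrite -normrN ler_norm.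
have HDphi := HD phi tphi.
have [dp cdp] := test_deriv phi tphi; have [r [r0 Hr]] := test_supp phi tphi.
have dE x : derive1 phi x = d^-1 * (chi ((x - a) / d) - chi ((x - b) / d)).
  by rewrite derive1E; have [_ ->] := dphi x; rewrite mulN1r mulrBr.
have out c y : y <= c \/ c + d <= y -> chi ((y - c) / d) = 0.
  move=> h; apply: chiout; case: h => h; [left|right].
    by rewrite pmulr_lle0 ?invr_gt0//; lra.
  by rewrite ler_pdivlMr// mul1r; lra.
(* phi rises only on [a, a + d], where D < m, and falls only on [b, b + d], where D > m. *)
have Hpos x : 0 <= (m - D x) * derive1 phi x.
  rewrite dE mulrCA pmulr_rge0 ?invr_gt0//.
  have [xa|ax] := leP x a.
    by rewrite !out ?subrr ?mulr0//; left => //; lra.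
  have [xad|adx] := leP x (a + d).
    rewrite (out b); last by left; lra.
    rewrite subr0 mulr_ge0// subr_ge0 -lerN2 ltW//; apply: D1; lra.
  rewrite (out a); last by right; lra.
  have [xb|bx] := leP x b; first by rewrite out ?subrr ?mulr0//; left.
  have [xbd|bdx] := leP x (b + d); last by rewrite out ?subrr ?mulr0//; right; lra.
  rewrite sub0r mulrN -mulNr opprB mulr_ge0// subr_ge0 ltW//; apply: D2; lra.
have cI : continuous (fun x => (m - D x) * derive1 phi x).
  by move=> x; apply: cvgM; [apply: cvgB; [exact: cvg_cst|exact: cD]|exact: cdp].
pose y := a + d / 2.
have Iy : 0 < (m - D y) * derive1 phi y.
  rewrite dE (out b); last by left; rewrite /y; lra.
  rewrite subr0; apply: mulr_gt0.
    by rewrite subr_gt0 -ltrN2; apply: D1; rewrite /y; lra.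
  apply: mulr_gt0; first by rewrite invr_gt0.
  rewrite /y addrAC subrr add0r mulrAC divff ?mul1r ?gt_eqF//.
  by apply: chi01; rewrite ?invr_gt0// invf_lt1// ltr1n.
(* On [y, y + z] the nonnegative integrand exceeds v / 2 > 0, while its total integral is 0 because
   those of phi' and D phi' are. *)
pose v := (m - D y) * derive1 phi y.
have [z z0 Z] := locally_bounded_below (a := y) (m := v / 2) cI ltac:(rewrite -/v in Iy *; lra).
pose r' := Num.max r (`|y| + z).
have rr' : r <= r' by rewrite le_max lexx.
have H0 : \int[mu]_(x in `[- r', r']) ((m - D x) * derive1 phi x) = 0.
  have H1 : \int[mu]_(x in `[- r', r']) (D x * derive1 phi x) = 0.
    rewrite -I_supp// => x xr; have [_ ->] := Hr x (le_lt_trans rr' xr).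
    by rewrite mulr0.
  have r'0 : 0 <= r' by rewrite le_max r0.
  have i1 : ig `[- r', r'] (derive1 phi) by exact: ig_cont.
  have i2 : ig `[- r', r'] (fun x => D x * derive1 phi x).
    by apply: ig_cont => x; apply: cvgM; [exact: cD|exact: cdp].
  have H2 : \int[mu]_(x in `[- r', r']) (derive1 phi x) = 0.
    have acp := ac_C1 dp cdp.
    have i3 : ig `[- (r' + 1), r' + 1] (derive1 phi) by exact: ig_cont.
    rewrite -I_supp; last by move=> x xr; have [_ ->] := Hr x (le_lt_trans rr' xr).
    rewrite (I_supp (r' + 1)); last by move=> x xr; have [_ ->] := Hr x ltac:(lra).
    rewrite -(acE acp); last lra.
    have [-> _] := Hr (r' + 1) ltac:(rewrite ger0_norm; lra).
    have [-> _] := Hr (- (r' + 1)) ltac:(rewrite normrN ger0_norm; lra).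
    by rewrite subrr.
  rewrite (@I_ext _ _ _ (fun x => m * derive1 phi x - D x * derive1 phi x)).
    by rewrite I_B// ?I_Z// ?H1 ?H2 ?mulr0 ?subrr//; exact: igZ.
  by move=> x _; rewrite mulrBl.
have yz : `[y, y + z] `<=` `[- r', r'].
  move=> x /=; rewrite !in_itv/= => /andP[x1 x2]; rewrite -ler_norml le_max; apply/orP; right.
  rewrite -[x](addrNK y) (le_trans (ler_normD _ _))// addrC lerD2l.
  by rewrite ger0_norm; lra.
have : \int[mu]_(x in `[y, y + z]) (v / 2) <= 0.
  rewrite -H0; apply: (@le_trans _ _ (\int[mu]_(x in `[y, y + z]) ((m - D x) * derive1 phi x))).
    apply: I_le => //; [by apply: ig_cont => x; exact: cvg_cst|exact: ig_cont|].
    by move=> x /=; rewrite in_itv/= => /andP[x1 x2]; apply: ltW; exact: Z.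
  by apply: I_subset => //; exact: ig_cont.
rewrite I_cst; last lra.
by rewrite -/v in Iy; have := mulr_gt0 Iy z0; nra.
Qed.

Lemma weak_zero_cst {D : R -> R} : continuous D ->
  (forall phi, test_function phi -> \int[mu]_x (D x * derive1 phi x) = 0) ->
  forall a b, D a = D b.
Proof.
move=> cD HD.
suff H a b : a < b -> ~ (D a < D b) /\ ~ (D b < D a).
  move=> a b; have [ab|ba|->//] := ltgtP a b.
    by have [/negP + /negP] := H a b ab; rewrite -!leNgt => h1 h2; apply/eqP; rewrite eq_le h1 h2.
  by have [/negP + /negP] := H b a ba; rewrite -!leNgt => h1 h2; apply/eqP; rewrite eq_le h1 h2.
move=> ab; split; first exact: weak_zero_nlt.
move=> ba; apply: (@weak_zero_nlt (fun x => - D x) a b) => //.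
- by move=> x; apply: cvgN; exact: cD.
- move=> phi tp; under eq_Rintegral do rewrite mulNr -mulN1r.
    have [d cd] := test_deriv phi tp; have [r [r0 Hr]] := test_supp phi tp.
    have HD' := HD phi tp.
    rewrite (I_supp r) in HD'; last by move=> x /Hr[_ ->]; rewrite mulr0.
    rewrite (I_supp r); last by move=> x /Hr[_ ->]; rewrite !mulr0.
    rewrite I_Z// ?HD' ?mulr0//; apply: ig_cont => x.
    by apply: cvgM; [exact: cD|exact: cd].
- by rewrite ltrN2.
Qed.

(** The difference of f and a primitive G of g has weak derivative 0, so [weak_zero_cst] makes it
    constant. *)
Lemma weak_ac {f g} : continuous f -> weak_derivative f g -> ac f g.
Proof.
move=> cf [lf lg w]; have [mg gi] := locint_ac.1 lg.
have [G aG] := ac_exists gi.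
have [_ _ wG] := ac_weak aG.
pose D x := f x - G x.
have cD : continuous D by move=> x; apply: cvgB; [exact: cf|exact: (ac_cont aG)].
have HD phi : test_function phi -> \int[mu]_x (D x * derive1 phi x) = 0.
  move=> tp; have [d cd] := test_deriv phi tp; have [r [r0 Hr]] := test_supp phi tp.
  have := w phi tp; rewrite -(wG phi tp).
  rewrite (I_supp r) => [|x /Hr[_ ->]]; last by rewrite mulr0.
  rewrite (@I_supp (fun x => G x * derive1 phi x) r) => [|x /Hr[_ ->]]; last by rewrite mulr0.
  rewrite (@I_supp (fun x => D x * derive1 phi x) r) => [|x /Hr[_ ->]]; last by rewrite mulr0.
  move=> /eqP; rewrite -subr_eq0 -I_B//; last 2 first.
  - by apply: ig_cont => x; apply: cvgM; [exact: cf|exact: cd].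
  - by apply: ig_cont => x; apply: cvgM; [exact: (ac_cont aG)|exact: cd].
  by move=> /eqP <-; apply: I_ext => x _; rewrite mulrBl.
apply: (ac_ext (ac_shift_cst (D 0) aG)) => // x.
by rewrite (weak_zero_cst cD HD 0 x) /D addrC subrK.
Qed.

End WeakDerivativeAC.

(** * Complex-valued functions with square integrable derivative; the class of the momentum *)

Section ComplexFunctions.
Context {R : realType}.
Local Notation mu := (@lebesgue_measure R).
Local Notation ig A f := (mu.-integrable A (EFin \o f)).
Local Notation Re := (@complex.Re R).
Local Notation Im := (@complex.Im R).
Implicit Types (f g : R -> R) (a b c s t x y e : R) (z w : R[i]) (psi u v : R -> R[i]).

Lemma C_eq z w : Re z = Re w -> Im z = Im w -> z = w.
Proof. by case: z => a b; case: w => c d /= -> ->. Qed.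

Lemma Re_M z w : Re (z * w) = Re z * Re w - Im z * Im w.
Proof. by case: z; case: w. Qed.

Lemma Im_M z w : Im (z * w) = Re z * Im w + Im z * Re w.
Proof. by case: z; case: w. Qed.

Lemma Re_D z w : Re (z + w) = Re z + Re w. Proof. by case: z; case: w. Qed.
Lemma Im_D z w : Im (z + w) = Im z + Im w. Proof. by case: z; case: w. Qed.
Lemma Re_N z : Re (- z) = - Re z. Proof. by case: z. Qed.
Lemma Im_N z : Im (- z) = - Im z. Proof. by case: z. Qed.

Lemma Re_J z : Re (conjc z) = Re z. Proof. by case: z. Qed.
Lemma Im_J z : Im (conjc z) = - Im z. Proof. by case: z. Qed.
Lemma Re_expi t : Re (expi t) = cos t. Proof. by []. Qed.
Lemma Im_expi t : Im (expi t) = sin t. Proof. by []. Qed.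

Definition C_simp := (Re_M, Im_M, Re_D, Im_D, Re_N, Im_N, Re_J, Im_J, Re_expi, Im_expi).

(** |z|^2 as a polynomial in the real and imaginary parts, which suits [ring] and the product
    rule. *)
Definition nsq z : R := Re z ^+ 2 + Im z ^+ 2.

Lemma nsq_ge0 z : 0 <= nsq z.
Proof. by rewrite addr_ge0// sqr_ge0. Qed.

Lemma normc_sq z : Normc.normc z ^+ 2 = nsq z.
Proof. by case: z => a b; rewrite /= sqr_sqrtr// addr_ge0// sqr_ge0. Qed.

Lemma normcE z : Normc.normc z = Num.sqrt (nsq z).
Proof. by case: z. Qed.

Lemma nsqM z w : nsq (z * w) = nsq z * nsq w.
Proof. by rewrite /nsq !C_simp; ring. Qed.

Lemma nsqJ z : nsq (conjc z) = nsq z.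
Proof. by rewrite /nsq !C_simp sqrrN. Qed.

Lemma nsq_expi t : nsq (expi t) = 1.
Proof. by rewrite /nsq !C_simp cos2Dsin2. Qed.

Lemma expiD a b : expi (a + b) = expi a * expi b.
Proof. by apply: C_eq; rewrite !C_simp ?cosD ?sinD//; ring. Qed.

Lemma expiN a : expi (- a) = conjc (expi a).
Proof. by apply: C_eq; rewrite !C_simp ?cosN ?sinN. Qed.

Lemma expi0 : expi (0 : R) = 1.
Proof. by apply: C_eq; rewrite !C_simp ?cos0 ?sin0. Qed.

Lemma mulJ z : z * conjc z = Complex (nsq z) 0.
Proof. by apply: C_eq; rewrite !C_simp /nsq/=; ring. Qed.

Lemma expiK a : expi a * conjc (expi a) = 1.
Proof. by rewrite mulJ nsq_expi. Qed.

Lemma unitJ z : nsq z = 1 -> z * conjc z = 1.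
Proof. by rewrite mulJ => ->. Qed.

Lemma abs_Re_le z e : 0 <= e -> nsq z <= e ^+ 2 -> `|Re z| <= e.
Proof.
move=> e0 h; rewrite -ler_sqr ?nnegrE// real_normK ?num_real//.
by apply: le_trans h; rewrite lerDl sqr_ge0.
Qed.

Lemma abs_Im_le z e : 0 <= e -> nsq z <= e ^+ 2 -> `|Im z| <= e.
Proof.
move=> e0 h; rewrite -ler_sqr ?nnegrE// real_normK ?num_real//.
by apply: le_trans h; rewrite lerDr sqr_ge0.
Qed.

Definition ccvg {T : Type} (G : set_system T) (f : T -> R[i]) z :=
  ((fun i => Re (f i)) @ G --> Re z) /\ ((fun i => Im (f i)) @ G --> Im z).

Lemma ccvgM {T : Type} {G : set_system T} {FG : Filter G} {f g : T -> R[i]} {z w} :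
  ccvg G f z -> ccvg G g w -> ccvg G (fun i => f i * g i) (z * w).
Proof.
move=> [f1 f2] [g1 g2]; split; rewrite !C_simp.
  under eq_fun do rewrite Re_M.
  by apply: cvgB; exact: cvgM.
under eq_fun do rewrite Im_M.
by apply: cvgD; exact: cvgM.
Qed.

Lemma ccvgJ {T : Type} {G : set_system T} {FG : Filter G} {f : T -> R[i]} {z} :
  ccvg G f z -> ccvg G (fun i => conjc (f i)) (conjc z).
Proof.
move=> [f1 f2]; split; rewrite !C_simp.
  by under eq_fun do rewrite Re_J.
by under eq_fun do rewrite Im_J; exact: cvgN.
Qed.

Lemma ccvg_cst {T : Type} {G : set_system T} {FG : Filter G} z : ccvg G (fun=> z) z.
Proof. by split; exact: cvg_cst. Qed.

Lemma ccvg_uniq {T : Type} {G : set_system T} {FG : ProperFilter G} {f : T -> R[i]} {z w} :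
  ccvg G f z -> ccvg G f w -> z = w.
Proof.
move=> [f1 f2] [g1 g2]; apply: C_eq.
  by apply: (@cvg_unique R^o) f1 g1; exact: Rhausdorff.
by apply: (@cvg_unique R^o) f2 g2; exact: Rhausdorff.
Qed.

Lemma ccvg_nsq {T : Type} {G : set_system T} {FG : Filter G} {f : T -> R[i]} {z} :
  ccvg G f z -> (fun i => nsq (f i)) @ G --> nsq z.
Proof.
move=> [f1 f2]; rewrite /nsq; apply: cvgD; rewrite expr2;
by under eq_fun do rewrite expr2; exact: cvgM.
Qed.

Lemma ccvg_expi {T : Type} {G : set_system T} {FG : Filter G} {f : T -> R} {l : R} :
  (f @ G --> l) -> ccvg G (fun i => expi (f i)) (expi l).
Proof.
move=> fl; split; rewrite !C_simp.
  by apply: (cvg_comp _ _ fl); exact: continuous_cos.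
by apply: (cvg_comp _ _ fl); exact: continuous_sin.
Qed.

Lemma sq_intE f : square_integrable f <-> measurable_fun setT f /\ ig setT (fun x => f x ^+ 2).
Proof.
split=> [fL|[mf fi]].
  split; last exact: Lfun2_integrable_sqr.
  by have := sub_Lfun_mfun fL; rewrite inE.
rewrite /square_integrable inE; apply/andP; split; first by rewrite inE.
rewrite inE/= /finite_norm unlock.
apply: poweR_lty; have /integrableP[_] := fi; apply: le_lt_trans.
rewrite le_eqVlt; apply/orP; left; apply/eqP; apply: eq_integral => x _ /=.
by rewrite powR_mulrn// normrX.
Qed.

(** Here u is an arbitrary representative of the derivative, so that a construction can exhibit its
    own instead of going through the choice made by [wderiveC]. *)
Definition has_deriv psi u := [/\ ac (Re \o psi) (Re \o u), ac (Im \o psi) (Im \o u),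
  ig setT (fun x => Re (u x) ^+ 2) & ig setT (fun x => Im (u x) ^+ 2)].

Lemma sq_ae {f g1 g2} : ac f g1 -> ac f g2 -> ig setT (fun x => g1 x ^+ 2) ->
  ig setT (fun x => g2 x ^+ 2).
Proof.
move=> h1 h2 /integrableP[m1 i1]; have m2 := ac_meas h2.
have m2' : measurable_fun setT (fun x => g2 x ^+ 2) by exact: measurable_funX.
apply/integrableP; split; first exact/measurable_EFinP.
rewrite (_ : (\int[mu]_x _ = \int[mu]_x `|(EFin \o (fun x => (g1 x ^+ 2)%R)) x|)%E)//.
apply: ae_eq_integral => //.
- by apply: measurableT_comp => //; exact/measurable_EFinP.
- exact: measurableT_comp.
- by apply: aeS (ac_uniq_ae h2 h1) => x E _ /=; rewrite E.
Qed.

Lemma homogeneous_H1P f : homogeneous_H1 f <->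
  exists g, ac f g /\ ig setT (fun x => g x ^+ 2).
Proof.
split=> [[cf [g wg /sq_intE[mg sg]]]|[g [fg sg]]]; first by exists g; split => //; exact: weak_ac.
split; first exact: ac_cont fg.
exists g; first exact: ac_weak.
by apply/sq_intE; split => //; exact: ac_meas fg.
Qed.

Lemma wderiveP {f} : homogeneous_H1 f ->
  ac f (wderive f) /\ ig setT (fun x => wderive f x ^+ 2).
Proof.
move=> Hf; have [cf [g wg /sq_intE[mg sg]]] := Hf.
have w : weak_derivative f (wderive f).
  by apply: (xgetPex (fun=> 0) (P := [set g | weak_derivative f g])); exists g.
have h := weak_ac cf w; split => //.
exact: sq_ae (weak_ac cf wg) h sg.
Qed.

Lemma homogeneous_H1CP psi : homogeneous_H1C psi <-> exists u, has_deriv psi u.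
Proof.
split=> [[[c1 c2] [u [w1 w2] [/sq_intE[_ s1] /sq_intE[_ s2]]]]|[u [h1 h2 s1 s2]]].
  by exists u; split => //; exact: weak_ac.
split; first by split; [exact: ac_cont h1|exact: ac_cont h2].
exists u; first by split; exact: ac_weak.
by split; apply/sq_intE; split => //; [exact: ac_meas h1|exact: ac_meas h2].
Qed.

Lemma wderiveCP {psi} : homogeneous_H1C psi -> has_deriv psi (wderiveC psi).
Proof.
move=> H; have [[c1 c2] [u w [/sq_intE[_ s1] /sq_intE[_ s2]]]] := H.
have [v1 v2] : weak_derivativeC psi (wderiveC psi).
  by apply: (xgetPex (fun=> 0) (P := [set u | weak_derivativeC psi u])); exists u.
case: w => w1 w2; split; [exact: weak_ac|exact: weak_ac| |].
  exact: sq_ae (weak_ac c1 w1) (weak_ac c1 v1) s1.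
exact: sq_ae (weak_ac c2 w2) (weak_ac c2 v2) s2.
Qed.

Lemma has_deriv_cont {psi u} : has_deriv psi u ->
  continuous (fun x => Re (psi x)) /\ continuous (fun x => Im (psi x)).
Proof. by move=> [h1 h2 _ _]; split; [exact: (ac_cont h1)|exact: (ac_cont h2)]. Qed.

Lemma has_deriv_meas {psi u} : has_deriv psi u ->
  measurable_fun setT (fun x => Re (u x)) /\ measurable_fun setT (fun x => Im (u x)).
Proof. by move=> [h1 h2 _ _]; split; [exact: (ac_meas h1)|exact: (ac_meas h2)]. Qed.

Lemma has_deriv_nsq_ig {psi u} : has_deriv psi u -> ig setT (fun x => nsq (u x)).
Proof. by move=> [_ _ s1 s2]; exact: igD. Qed.

Lemma ac_nsq {psi u} : has_deriv psi u ->
  ac (fun x => nsq (psi x)) (fun x => 2 * (Re (psi x) * Re (u x) + Im (psi x) * Im (u x))).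
Proof.
move=> [h1 h2 _ _]; apply: (ac_ext (ac_D (ac_mul h1 h1) (ac_mul h2 h2))) => x.
  by rewrite /nsq /= !expr2.
by rewrite /=; ring.
Qed.

Lemma nsq_cont {psi u} : has_deriv psi u -> continuous (fun x => nsq (psi x)).
Proof. by move=> /ac_nsq/ac_cont. Qed.

(** This is <i u, psi>. Where psi = rho e^{i phi} it equals -rho^2 phi', so the phase of e^{iJ} psi
    moves at the rate (1 - rho^2) phi', a product of two square integrable functions, whereas phi'
    alone need not be integrable. *)
Definition jdens psi u x := Re (u x) * Im (psi x) - Re (psi x) * Im (u x).

Lemma jdens_ig {psi u a b} : has_deriv psi u -> ig `[a, b] (jdens psi u).
Proof.
move=> h; have [c1 c2] := has_deriv_cont h; case: (h) => h1 h2 _ _.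
apply: igB => //; first by apply: ig_mulC => //; exact: ac_ig h1.
apply: (ig_ext _ _ (ig_mulC (ac_ig h2) c1)) => // x _; exact: mulrC.
Qed.

Lemma jdens_ac {psi u} : has_deriv psi u -> exists J, ac J (jdens psi u).
Proof. by move=> h; apply: ac_exists => a b; exact: jdens_ig. Qed.

(* [expi (J x) * psi x] converges at both ends even though [psi] need not; [mom psi u z]
   says that z is e^{iP}. *)
Definition mom psi u z := exists J w1 w2, [/\ ac J (jdens psi u),
  ccvg -oo (fun x => expi (J x) * psi x) w1,
  ccvg +oo (fun x => expi (J x) * psi x) w2 & z = w2 * conjc w1].

Lemma ac_diff_cst {f1 f2 g} : ac f1 g -> ac f2 g -> forall x, f2 x = f1 x + (f2 0 - f1 0).
Proof.
move=> h1 h2 x; suff : f2 x - f1 x = f2 0 - f1 0 by move=> <-; ring.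
have [x0|x0] := leP x 0.
  have := acE h1 x0; rewrite -(acE h2 x0); lra.
have := acE h1 (ltW x0); rewrite -(acE h2 (ltW x0)); lra.
Qed.

(** Two primitives J differ by a constant, which multiplies both limits by the same unit number and
    leaves their quotient unchanged. *)
Lemma mom_uniq {psi u z1 z2} : mom psi u z1 -> mom psi u z2 -> z1 = z2.
Proof.
move=> [J [w1 [w2 [aJ c1 c2 ->]]]] [J' [w1' [w2' [aJ' c1' c2' ->]]]].
pose k := expi (J' 0 - J 0).
have E x : expi (J' x) * psi x = k * (expi (J x) * psi x).
  by rewrite (ac_diff_cst aJ aJ' x) expiD /k; ring.
have d1 : ccvg -oo (fun x => expi (J' x) * psi x) (k * w1).
  by under [X in ccvg _ X _]eq_fun do rewrite E; exact: ccvgM (ccvg_cst _) c1.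
have d2 : ccvg +oo (fun x => expi (J' x) * psi x) (k * w2).
  by under [X in ccvg _ X _]eq_fun do rewrite E; exact: ccvgM (ccvg_cst _) c2.
rewrite (ccvg_uniq c1' d1) (ccvg_uniq c2' d2) rmorphM/=.
have -> : k * w2 * (conjc k * conjc w1) = (k * conjc k) * (w2 * conjc w1) by ring.
by rewrite expiK mul1r.
Qed.

(** f^2 has the integrable derivative 2 f f', hence limits at both ends; these are 0 because f^2 is
    integrable. *)
Lemma sq_ac_vanish {f g} : ac f g -> ig setT (fun x => f x ^+ 2) ->
  ig setT (fun x => g x ^+ 2) ->
  (f x @[x --> -oo] --> (0 : R)) /\ (f x @[x --> +oo] --> (0 : R)).
Proof.
suff H (f0 g0 : R -> R) : ac f0 g0 -> ig setT (fun x => f0 x ^+ 2) ->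
    ig setT (fun x => g0 x ^+ 2) -> f0 x @[x --> +oo] --> (0 : R).
  move=> fg sf sg; split; last exact: H fg sf sg.
  apply: cvgNy_refl.
  have -> : (fun x => f (- x)) = (fun x => f (0 - x)).
    by apply/funext => x; rewrite sub0r.
  apply: (H _ _ (ac_refl 0 fg)).
    by have := mp_ig (mp_refl 0) measurableT sf; rewrite preimage_setT.
  have := mp_ig (mp_refl 0) measurableT sg; rewrite preimage_setT.
  by apply: ig_ext => // x _ /=; rewrite sqrrN.
clear f g; rename f0 into f; rename g0 into g; move=> fg sf sg.
have mf : measurable_fun setT f by exact: cont_meas (ac_cont fg).
have a2 : ac (fun x => f x * f x) (fun x => g x * f x + g x * f x) by exact: ac_mul.
have i2 : ig setT (fun x => g x * f x + g x * f x).
  by apply: igD => //; apply: sq_M => //; exact: ac_meas fg.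
have [l /cvgyP Hl] := ac_cvgy a2 i2.
have l0 : l <= 0.
  rewrite leNgt; apply/negP => lp.
  have [A HA] := Hl (l / 2) ltac:(lra).
  have [n nP] := nat_above (\int[mu]_x f x ^+ 2 / (l / 2)).
  have : \int[mu]_(x in `[A, A + n%:R]) (l / 2) <= \int[mu]_x f x ^+ 2.
    apply: (@le_trans _ _ (\int[mu]_(x in `[A, A + n%:R]) f x ^+ 2)).
      apply: I_le => //; [by apply: ig_cont => x; exact: cvg_cst|exact: ig_itvT|].
      move=> x /=; rewrite in_itv/= => /andP[Ax _]; have := HA x Ax.
      by rewrite ler_norml expr2 => /andP[? _]; lra.
    by apply: I_subset => // x _; rewrite sqr_ge0.
  rewrite I_cst; last by rewrite lerDl.
  rewrite (_ : A + n%:R - A = n%:R); last ring.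
  by move: nP; rewrite ltr_pdivrMr; [nra|lra].
apply/cvgyP => e e0; have [A HA] := Hl (e ^+ 2) ltac:(by rewrite exprn_gt0).
exists A => x Ax; rewrite subr0 -ler_sqr ?nnegrE ?(ltW e0)// real_normK ?num_real//.
by have := HA x Ax; rewrite ler_norml expr2 => /andP[_]; lra.
Qed.

End ComplexFunctions.

(** * From a decomposition e^{i phi} + w to the limits of e^{iJ} psi *)

Section PhaseDecomposition.
Context {R : realType}.
Local Notation mu := (@lebesgue_measure R).
Local Notation ig A f := (mu.-integrable A (EFin \o f)).
Local Notation Re := (@complex.Re R).
Local Notation Im := (@complex.Im R).
Implicit Types (f g phi : R -> R) (a b c s t x y e : R) (z : R[i]) (psi u v w : R -> R[i]).

Lemma ac_ae {f g g'} : ac f g -> measurable_fun setT g' ->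
  {ae mu, forall x, g x = g' x} -> ac f g'.
Proof.
move=> fg mg' E; have mg := ac_meas fg.
apply: acP => [a b|s t st].
  have /integrableP[_ i1] := ac_ig (a := a) (b := b) fg.
  apply/integrableP; split; first by apply/measurable_EFinP; exact: measurable_funTS.
  rewrite (_ : (\int[mu]_(x in `[a, b]) _ = \int[mu]_(x in `[a, b]) `|(EFin \o g) x|)%E)//.
  apply: ae_eq_integral => //.
  - by apply: measurableT_comp => //; apply/measurable_EFinP; exact: measurable_funTS.
  - by apply: measurableT_comp => //; apply/measurable_EFinP; exact: measurable_funTS.
  - by apply: aeS E => x E _ /=; rewrite E.
rewrite (acE fg st) /Rintegral; congr fine; apply: ae_eq_integral => //.
- by apply/measurable_EFinP; exact: measurable_funTS.
- by apply/measurable_EFinP; exact: measurable_funTS.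
- by apply: aeS E => x E _; rewrite E.
Qed.

Lemma jdens_meas {psi u} : has_deriv psi u -> measurable_fun setT (jdens psi u).
Proof. by move=> /jdens_ac[J /ac_meas]. Qed.

Lemma ac_cos {f g} : ac f g -> ac (fun x => cos (f x)) (fun x => - (g x * sin (f x))).
Proof.
move=> fg; have d : deriv (@cos R) (fun x => - sin x) by move=> x; exact: is_derive_cos.
have cs : continuous (fun x : R => - sin x).
  by move=> x; apply: cvgN; exact: continuous_sin.
by apply: (ac_ext (ac_chain d cs fg)) => // x; rewrite mulrN.
Qed.

Lemma ac_sin {f g} : ac f g -> ac (fun x => sin (f x)) (fun x => g x * cos (f x)).
Proof.
move=> fg; have d : deriv (@sin R) (@cos R) by move=> x; exact: is_derive_sin.
exact: (ac_chain d (@continuous_cos R) fg).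
Qed.

Lemma cvg0_bounded {T : Type} {G : set_system T} {FG : Filter G} {f1 f2 f3 : T -> R} :
  (f1 @ G --> 0) -> (f2 @ G --> 0) -> (forall i, `|f3 i| <= `|f1 i| + `|f2 i|) ->
  f3 @ G --> 0.
Proof.
move=> c1 c2 H; apply/cvgr0Pnorm_le => e e0.
have e20 : 0 < e / 2 by lra.
move/cvgr0Pnorm_le : c1 => /(_ _ e20) h1; move/cvgr0Pnorm_le : c2 => /(_ _ e20) h2.
by apply: filterS2 h1 h2 => i h1 h2; apply: (le_trans (H i)); lra.
Qed.

(** With B = Im(e^{i phi} conj w), the density <i psi', psi> is the momentum density m minus phi'
    plus B'. Hence e^{iJ} psi = e^{i Jm} e^{iB} (1 + e^{-i phi} w), where w and B vanish at infinity
    and Jm, a primitive of m, changes by the momentum. *)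
Lemma mom_of_decomposition {psi u phi w} : has_deriv psi u ->
  phase_decomposition psi phi w -> mom psi u (expi (momentum phi w)).
Proof.
move=> hu [Hphi [Hw [/sq_intE[ma sa] /sq_intE[mb sb]]] psiE].
set a := Re \o w in ma sa; set b := Im \o w in mb sb.
have [ap sp] := wderiveP Hphi; set g := wderive phi in ap sp.
have [av bv sa' sb'] := wderiveCP Hw; set v := wderiveC w in av bv sa' sb'.
pose a' := Re \o v; pose b' := Im \o v.
have mg := ac_meas ap; have ma' := ac_meas av; have mb' := ac_meas bv.
pose C x := cos (phi x); pose S x := sin (phi x).
have aC : ac C (fun x => - (g x * S x)) by exact: ac_cos.
have aS : ac S (fun x => g x * C x) by exact: ac_sin.
have mC : measurable_fun setT C by exact: cont_meas (ac_cont aC).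
have mS : measurable_fun setT S by exact: cont_meas (ac_cont aS).
pose m x := - 2 * (g x * (C x * a x + S x * b x)) + (a' x * b x - b' x * a x).
have C1 x : `|C x| <= 1 by exact: cos_max.
have S1 x : `|S x| <= 1 by exact: sin_max.
have bdM (k h : R -> R) : measurable_fun setT k -> (forall x, `|k x| <= 1) ->
    ig setT h -> ig setT (fun x => h x * k x).
  move=> mk k1 hi; apply: (@ig_le _ _ _ (fun x => `|h x|)) => //.
  - by apply: measurable_funM => //; exact: ig_meas hi.
  - exact: ig_norm.
  - by move=> x _; rewrite normrM ler_piMr.
have mE : momentum phi w = \int[mu]_x m x.
  rewrite /momentum; apply: eq_Rintegral => x _.
  by rewrite /real_inner !C_simp /m /a /b /a' /b' /C /S -/g -/v /=; ring.
have im : ig setT m.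
  apply: igD => //.
    apply: igZ => //.
    apply: (@ig_ext _ _ (fun x => g x * a x * C x + g x * b x * S x)) => //.
      by move=> x _; ring.
    by apply: igD => //; apply: bdM => //; exact: sq_M.
  by apply: igB => //; exact: sq_M.
have [Jm aJm] : exists J, ac J m by apply: ac_exists => s t; exact: ig_itvT.
pose B x := a x * S x - b x * C x.
have aB : ac B (fun x => a' x * S x + g x * C x * a x - (b' x * C x + - (g x * S x) * b x)).
  by apply: ac_B; exact: ac_mul.
pose J x := Jm x - phi x + B x.
(* The density computed from phi and w and the one computed from u need only agree almost
   everywhere, since two representatives of psi' may differ on a null set. *)
have aJ : ac J (jdens psi u).
  have := ac_D (ac_B aJm ap) aB; rewrite -/g => aJ'.
  apply: (ac_ae aJ' (jdens_meas hu)).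
  have [h1 h2 _ _] := hu.
  have e1 : ac (Re \o psi) (fun x => - (g x * S x) + a' x).
    apply: (ac_ext (ac_D aC av)) => // x; by rewrite /= psiE !C_simp.
  have e2 : ac (Im \o psi) (fun x => g x * C x + b' x).
    apply: (ac_ext (ac_D aS bv)) => // x; by rewrite /= psiE !C_simp.
  apply: aeS2 (ac_uniq_ae e1 h1) (ac_uniq_ae e2 h2) => x E1 E2.
  rewrite /jdens -[Re (u x)]/((Re \o u) x) -[Im (u x)]/((Im \o u) x) -E1 -E2.
  rewrite psiE !C_simp -[Re (w x)]/(a x) -[Im (w x)]/(b x) -/(C x) -/(S x) /m.
  have := cos2Dsin2 (phi x); rewrite -/(C x) -/(S x) => cs.
  apply/eqP; rewrite -subr_eq0 (_ : _ - _ = g x * (C x ^+ 2 + S x ^+ 2 - 1)); last ring.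
  by rewrite cs subrr mulr0.
have [a1 a2] := sq_ac_vanish av sa sa'.
have [b1 b2] := sq_ac_vanish bv sb sb'.
have vanish (G : set_system R) (FG : Filter G) : (a @ G --> 0) -> (b @ G --> 0) ->
    forall l, (Jm @ G --> l) -> ccvg G (fun x => expi (J x) * psi x) (expi l).
  move=> ca cb l cJ.
  have cB : B @ G --> 0.
    apply: (cvg0_bounded ca cb) => x; rewrite /B (le_trans (ler_normB _ _))// lerD//.
      by rewrite normrM ler_piMr.
    by rewrite normrM ler_piMr.
  pose q x := conjc (expi (phi x)) * w x.
  have cq : ccvg G q 0.
    split; apply: (cvg0_bounded ca cb) => x.
      have -> : Re (q x) = a x * C x + b x * S x by rewrite /q !C_simp /a /b /C /S/=; ring.
      by rewrite (le_trans (ler_normD _ _))// lerD// normrM ler_piMr.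
    have -> : Im (q x) = b x * C x - a x * S x by rewrite /q !C_simp /a /b /C /S/=; ring.
    by rewrite (le_trans (ler_normB _ _))// addrC lerD// normrM ler_piMr.
  have c1q : ccvg G (fun x => 1 + q x) 1.
    case: cq => q1 q2; split.
      rewrite -[X in _ --> X](addr0 (Re 1)); under eq_fun do rewrite Re_D.
      by apply: cvgD => //; exact: cvg_cst.
    rewrite -[X in _ --> X](addr0 (Im 1)); under eq_fun do rewrite Im_D.
    by apply: cvgD => //; exact: cvg_cst.
  have E x : expi (J x) * psi x = expi (Jm x) * expi (B x) * (1 + q x).
    rewrite psiE /J (expiD _ (B x)) expiD expiN /q.
    have -> : expi (phi x) + w x = expi (phi x) * (1 + conjc (expi (phi x)) * w x).
      by rewrite mulrDr mulr1 mulrA expiK mul1r.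
    have K := expiK (phi x).
    transitivity (expi (Jm x) * (expi (phi x) * conjc (expi (phi x))) * expi (B x) *
      (1 + conjc (expi (phi x)) * w x)); first by ring.
    by rewrite K; ring.
  under [X in ccvg _ X _]eq_fun do rewrite E.
  have -> : expi l = expi l * expi 0 * 1 by rewrite expi0 !mulr1.
  exact: ccvgM (ccvgM (ccvg_expi cJ) (ccvg_expi cB)) c1q.
have [l1 [l2 [c1 c2 lE]]] := ac_lims aJm im.
exists J, (expi l1), (expi l2); split => //.
- exact: vanish.
- exact: vanish.
- by rewrite mE -lE expiD expiN.
Qed.

End PhaseDecomposition.

(** * Local lifting of the phase and existence of decompositions *)

Section Lifting.
Context {R : realType}.
Local Notation mu := (@lebesgue_measure R).
Local Notation ig A f := (mu.-integrable A (EFin \o f)).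
Local Notation Re := (@complex.Re R).
Local Notation Im := (@complex.Im R).
Implicit Types (f g phi : R -> R) (a b c s t x y e : R) (z : R[i]) (psi u v w : R -> R[i]).

Lemma max_cst_cont {f} c : continuous f -> continuous (fun x => Num.max (f x) c).
Proof.
move=> cf x; have -> : (fun x => Num.max (f x) c) = (fun x => (f x + c + `|f x - c|) / 2).
  by apply/funext => y; exact: maxr_absE.
rewrite /continuous_at; apply: cvgM; last exact: cvg_cst.
apply: cvgD; first by apply: cvgD; [exact: cf|exact: cvg_cst].
by apply: cvg_norm; apply: cvgB; [exact: cf|exact: cvg_cst].
Qed.

Lemma acon_of_ac {f g} a b : ac f g -> acon a b f g.
Proof. by apply. Qed.

(* The cut-off at 1/4 only serves to make the inverse square root globally C^1. *)
Definition isqrt y : R := (Num.sqrt (Num.max y 4^-1))^-1.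

Definition disqrt y : R := - (2 * Num.max y 4^-1 * Num.sqrt (Num.max y 4^-1))^-1.

Lemma max4_gt0 y : 0 < Num.max y 4^-1.
Proof. by rewrite lt_max invr_gt0 ltr0n orbT. Qed.

Lemma isqrt_cont : continuous isqrt.
Proof.
move=> y; rewrite /continuous_at; apply: cvgV; first by rewrite gt_eqF// sqrtr_gt0 max4_gt0.
apply: (@cvg_comp _ _ _ (fun y => Num.max y 4^-1) Num.sqrt); last exact: sqrt_continuous.
by apply: (max_cst_cont 4^-1 (f := id)) => x; exact: cvg_id.
Qed.

Lemma disqrt_cont : continuous disqrt.
Proof.
have cm : continuous (fun y : R => Num.max y 4^-1).
  by apply: (max_cst_cont 4^-1 (f := id)) => x; exact: cvg_id.
move=> y; rewrite /continuous_at; apply: cvgN; apply: cvgV.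
  by rewrite gt_eqF// mulr_gt0 ?sqrtr_gt0 ?mulr_gt0 ?max4_gt0.
apply: cvgM; first by apply: cvgM; [exact: cvg_cst|exact: cm].
by apply: (@cvg_comp _ _ _ (fun y => Num.max y 4^-1) Num.sqrt); [exact: cm|exact: sqrt_continuous].
Qed.

Lemma isqrt_deriv y : 4^-1 < y -> is_derive y (1 : R) isqrt (disqrt y).
Proof.
move=> y4; have y0 : 0 < y by rewrite (lt_trans _ y4)// invr_gt0.
have s0 : Num.sqrt y != 0 by rewrite gt_eqF// sqrtr_gt0.
have d1 := is_deriveV s0 (is_derive1_sqrt y0).
have d2 : is_derive y (1 : R) (fun y => (Num.sqrt y)^-1) (disqrt y).
  apply: (is_derive_eq d1); rewrite /disqrt max_l ?ltW//.
  rewrite /GRing.scale/= sqr_sqrtr ?ltW// mulNr; congr (- _).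
  by field; rewrite s0 gt_eqF.
apply: near_eq_is_derive d2; near=> z; rewrite /isqrt max_l//.
by apply: ltW; near: z; exact: lt_nbhsr.
Unshelve. all: by end_near. Qed.

(** Where |psi|^2 >= 1/4 this is the phase derivative phi' of psi = rho e^{i phi}; the cut-off keeps
    it square integrable across zeros of psi. *)
Definition eta psi u x := - jdens psi u x / Num.max (nsq (psi x)) 4^-1.

Lemma jdens_sq psi u x : jdens psi u x ^+ 2 <= nsq (u x) * nsq (psi x).
Proof.
rewrite -subr_ge0 /jdens /nsq.
rewrite (_ : _ - _ = (Re (psi x) * Re (u x) + Im (psi x) * Im (u x)) ^+ 2); last ring.
exact: sqr_ge0.
Qed.

Lemma eta_meas {psi u} : has_deriv psi u -> measurable_fun setT (eta psi u).
Proof.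
move=> h; apply: measurable_funM.
  by apply: measurableT_comp => //; exact: jdens_meas.
apply: cont_meas => x; apply: cvgV; first by rewrite gt_eqF// max4_gt0.
exact: (max_cst_cont 4^-1 (nsq_cont h)).
Qed.

Lemma eta_sq {psi u} : has_deriv psi u -> ig setT (fun x => eta psi u x ^+ 2).
Proof.
move=> h; apply: (@ig_le _ _ _ (fun x => 4 * nsq (u x))) => //.
- by apply: measurable_funX; exact: eta_meas.
- by apply: igZ => //; exact: has_deriv_nsq_ig h.
move=> x _; rewrite ger0_norm ?sqr_ge0// /eta exprMn sqrrN exprVn.
set m := Num.max _ _; have m0 : 0 < m by exact: max4_gt0.
rewrite ler_pdivrMr ?exprn_gt0//; apply: (le_trans (jdens_sq psi u x)).
have u0 := nsq_ge0 (u x); have p0 := nsq_ge0 (psi x).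
have pm : nsq (psi x) <= m by rewrite /m le_max lexx.
have m4 : 4^-1 <= m by rewrite /m le_max lexx orbT.
have : nsq (psi x) <= 4 * m ^+ 2.
  apply: (le_trans pm); rewrite expr2 mulrA ler_peMl ?(ltW m0)//.
  by rewrite mulrC -ler_pdivrMr// div1r.
by move=> H; rewrite -mulrA mulrCA ler_wpM2l.
Qed.

Lemma eta_ac {psi u} : has_deriv psi u -> exists f, ac f (eta psi u).
Proof.
move=> h; apply: ac_exists => a b.
by apply: sq_ig; [exact: eta_meas|exact: eta_sq].
Qed.

Lemma acon_zero {a b f g} : acon a b f g -> (forall x, a <= x -> x <= b -> g x = 0) ->
  forall s t, a <= s -> s <= t -> t <= b -> f t = f s.
Proof.
move=> [gi fg] g0 s t as_ st tb; apply/eqP; rewrite -subr_eq0 fg//.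
rewrite (@I_ext _ _ _ (fun=> 0)) ?I_cst ?mul0r// => x /=.
by rewrite in_itv/= => /andP[sx xt]; apply: g0; [exact: le_trans sx|exact: le_trans tb].
Qed.

(** The derivative of psi/|psi| e^{-i phi} vanishes wherever |psi|^2 > 1/4. A phase is thus obtained
    by integration, with no choice of a logarithm. *)
Lemma lifting {psi u phi a b} : has_deriv psi u -> ac phi (eta psi u) ->
  (forall x, a <= x -> x <= b -> 4^-1 < nsq (psi x)) ->
  forall s t, a <= s -> s <= t -> t <= b ->
  Complex (isqrt (nsq (psi t))) 0 * psi t * conjc (expi (phi t)) =
  Complex (isqrt (nsq (psi s))) 0 * psi s * conjc (expi (phi s)).
Proof.
move=> h aphi big s t as_ st tb.
have [h1 h2 _ _] := h; have cr := nsq_cont h.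
have aC := acon_of_ac a b (ac_cos aphi); have aS := acon_of_ac a b (ac_sin aphi).
have cC := ac_cont (ac_cos aphi); have cS := ac_cont (ac_sin aphi).
have [c1 c2] := has_deriv_cont h.
have aH : acon a b (fun x => isqrt (nsq (psi x)))
    (fun x => 2 * (Re (psi x) * Re (u x) + Im (psi x) * Im (u x)) * disqrt (nsq (psi x))).
  apply: (acon_chain (dh := disqrt)) => //.
  - by move=> x; apply: (@continuous_comp _ _ _ (fun x => nsq (psi x)) disqrt); [exact: cr|exact: disqrt_cont].
  - move=> x ax xb; split => //; first exact: disqrt_cont.
    near=> y; apply: isqrt_deriv; near: y; apply: lt_nbhsr; exact: big.
  - exact: acon_of_ac (ac_nsq h).
have cH : continuous (fun x => isqrt (nsq (psi x))).
  by move=> x; apply: (@continuous_comp _ _ _ (fun x => nsq (psi x)) isqrt); [exact: cr|exact: isqrt_cont].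
have a1 := ac_mul h1 (ac_cos aphi); have a2 := ac_mul h2 (ac_sin aphi).
have a3 := ac_mul h2 (ac_cos aphi); have a4 := ac_mul h1 (ac_sin aphi).
have aRe := ac_D a1 a2; have aIm := ac_B a3 a4.
have ZR := acon_mul (ac_cont aRe) cH (acon_of_ac a b aRe) aH.
have ZI := acon_mul (ac_cont aIm) cH (acon_of_ac a b aIm) aH.
have alg x : a <= x -> x <= b -> [/\ 0 < nsq (psi x), Num.max (nsq (psi x)) 4^-1 = nsq (psi x)
   & Num.sqrt (nsq (psi x)) != 0].
  move=> ax xb; have b4 := big x ax xb.
  have n0 : 0 < nsq (psi x) by rewrite (lt_trans _ b4)// invr_gt0.
  by split => //; [rewrite max_l// ltW|rewrite gt_eqF// sqrtr_gt0].
apply: C_eq.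
- have := fun Z0 => acon_zero ZR Z0 s t as_ st tb; rewrite /= !C_simp/= => H.
  rewrite !mul0r !subr0 !addr0 !mulrN !opprK.
  have E (q : R) (x : R) : q * Re (psi x) * cos (phi x) + q * Im (psi x) * sin (phi x) =
    (Re (psi x) * cos (phi x) + Im (psi x) * sin (phi x)) * q by ring.
  rewrite !E; apply: H => x ax xb; have [n0 mE s0] := alg x ax xb.
  rewrite /isqrt /disqrt /eta mE.
  set q := Num.sqrt _ in s0 *.
  move: (n0); rewrite /jdens /nsq; set f1 := Re _; set f2 := Im _; set u1 := Re _; set u2 := Im _.
  by move=> N0; field; rewrite s0 /= gt_eqF.
- have := fun Z0 => acon_zero ZI Z0 s t as_ st tb; rewrite /= !C_simp/= => H.
  rewrite !mul0r !subr0 !addr0 !mulrN.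
  have E (q : R) (x : R) : - (q * Re (psi x) * sin (phi x)) + q * Im (psi x) * cos (phi x) =
    (Im (psi x) * cos (phi x) - Re (psi x) * sin (phi x)) * q by ring.
  rewrite !E; apply: H => x ax xb; have [n0 mE s0] := alg x ax xb.
  rewrite /isqrt /disqrt /eta mE.
  set q := Num.sqrt _ in s0 *.
  move: (n0); rewrite /jdens /nsq; set f1 := Re _; set f2 := Im _; set u1 := Re _; set u2 := Im _.
  by move=> N0; field; rewrite s0 /= gt_eqF.
Unshelve. all: by end_near. Qed.

Lemma arg_exists z : nsq z = 1 -> exists t, z = expi t.
Proof.
move=> z1; have r1 : -1 <= Re z <= 1.
  by rewrite -ler_norml; apply: abs_Re_le => //; rewrite z1 expr1n.
have ci : cos (acos (Re z)) = Re z by apply: acosK; rewrite in_itv/=.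
have si : sin (acos (Re z)) = `|Im z|.
  rewrite sin_acos// -z1 /nsq addrAC subrr add0r; exact: sqrtr_sqr.
have [i0|i0] := leP 0 (Im z).
  by exists (acos (Re z)); apply: C_eq; rewrite ?Re_expi ?Im_expi ?ci// si ger0_norm.
exists (- acos (Re z)); apply: C_eq; rewrite ?Re_expi ?Im_expi ?cosN ?ci// sinN si.
by rewrite ltr0_norm// opprK.
Qed.

Lemma isqrt_nsq {z} : 4^-1 <= nsq z -> nsq (Complex (isqrt (nsq z)) 0 * z) = 1 /\
  z = Complex (Num.sqrt (nsq z)) 0 * (Complex (isqrt (nsq z)) 0 * z).
Proof.
move=> z4; have n0 : 0 < nsq z by rewrite (lt_le_trans _ z4)// invr_gt0.
have s0 : Num.sqrt (nsq z) != 0 by rewrite gt_eqF// sqrtr_gt0.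
split.
  rewrite nsqM {1}/nsq/= expr0n/= addr0 /isqrt max_l// exprVn sqr_sqrtr ?ltW//.
  by rewrite mulVf// gt_eqF.
rewrite /isqrt max_l//; apply: C_eq; rewrite !C_simp/= !mul0r ?subr0 ?addr0.
  by rewrite mulrA divff// mul1r.
by rewrite mulrA divff// mul1r.
Qed.

(** Only the ends matter: on [-A, A] any phase with square integrable derivative will do, since
    there w is continuous on a bounded interval; outside, the phase has to be that of psi. *)
Lemma decomposition_exists {psi u} : has_deriv psi u ->
  (exists2 A, 0 < A & forall x, A <= `|x| -> 4^-1 < nsq (psi x)) ->
  ig setT (fun x => (nsq (psi x) - 1) ^+ 2) ->
  exists phi w, phase_decomposition psi phi w.
Proof.
move=> h [A A0 HA] sV.
have [phi0 aphi0] := eta_ac h.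
pose Un x := Complex (isqrt (nsq (psi x))) 0 * psi x * conjc (expi (phi0 x)).
have A4 : 4^-1 < nsq (psi A) by apply: HA; rewrite ger0_norm// ltW.
have NA4 : 4^-1 < nsq (psi (- A)) by apply: HA; rewrite normrN ger0_norm// ltW.
have n1 x : 4^-1 <= nsq (psi x) -> nsq (Un x) = 1.
  by move=> /isqrt_nsq[E _]; rewrite /Un nsqM E nsqJ nsq_expi mulr1.
have [al2 E2] := arg_exists _ (n1 A (ltW A4)).
have [al1 E1] := arg_exists _ (n1 (- A) (ltW NA4)).
have Ur x : A <= x -> Un x = expi al2.
  move=> Ax; rewrite -E2; apply: (@lifting psi u phi0 A x) => // y Ay _.
  by apply: HA; rewrite (le_trans Ay)// ler_norm.
have Ul x : x <= - A -> Un x = expi al1.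
  move=> xA; rewrite -E1; symmetry; apply: (@lifting psi u phi0 x (- A)) => // y _ yA.
  by apply: HA; rewrite -normrN (le_trans _ (ler_norm _))//; lra.
(* Left of -A and right of A the phase of psi is phi0 + al1 and phi0 + al2, with unrelated
   constants; a linear ramp over [-A, A] joins them. *)
pose cl x := Num.max (- A) (Num.min x A).
have acl : ac cl ((fun _ : R => 1 : R) \_ `[- A, A]) by apply: (ac_clamp _ ac_id); lra.
pose k := (al2 - al1) / (2 * A).
pose phi x := phi0 x + (k * cl x + (al1 + k * A)).
pose dphi x := eta psi u x + k * ((fun _ : R => 1 : R) \_ `[- A, A]) x.
have aphi : ac phi dphi by apply: ac_D => //; apply: ac_shift_cst; exact: ac_Z.
have mdphi := ac_meas aphi.
have sphi : ig setT (fun x => dphi x ^+ 2).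
  apply: sq_D => //; [exact: eta_meas|by apply: measurable_funM => //; exact: ac_meas acl|exact: eta_sq|].
  apply: sq_Z => //; apply: (@ig_ext _ _ ((fun _ : R => 1 : R) \_ `[- A, A])) => //.
    by move=> x _; rewrite !patchE; case: ifP; rewrite ?expr1n ?expr0n.
  have := (@integrable_mkcond _ _ R mu `[- A, A] (EFin \o (fun _ : R => 1 : R)) _).1.
  by rewrite -restrict_EFin; apply => //; apply: ig_cont => x; exact: cvg_cst.
have phir x : A <= x -> phi x = phi0 x + al2.
  move=> Ax; rewrite /phi /cl min_r// max_r; last lra.
  by rewrite /k; field; rewrite gt_eqF.
have phil x : x <= - A -> phi x = phi0 x + al1.
  move=> xA; rewrite /phi /cl min_l; last lra.
  by rewrite max_l// /k; field; rewrite gt_eqF.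
pose w x := psi x - expi (phi x).
pose v x := Complex (Re (u x) + dphi x * sin (phi x)) (Im (u x) - dphi x * cos (phi x)).
have [h1 h2 s1 s2] := h; have [mu1 mu2] := has_deriv_meas h.
have w1 : ac (Re \o w) (Re \o v).
  apply: (ac_ext (ac_B h1 (ac_cos aphi))) => x; first by rewrite /w /= !C_simp.
  by rewrite /= opprK.
have w2 : ac (Im \o w) (Im \o v).
  by apply: (ac_ext (ac_B h2 (ac_sin aphi))) => x; rewrite /w /= ?C_simp.
have bd (q : R -> R) : continuous q -> (forall x, `|q x| <= 1) -> ig setT (fun x => (dphi x * q x) ^+ 2).
  move=> cq q1; apply: (ig_le _ _ sphi) => //.
    by apply: measurable_funX; apply: measurable_funM => //; exact: cont_meas.
  move=> x _; rewrite ger0_norm ?sqr_ge0// exprMn ler_piMr ?sqr_ge0//.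
  by rewrite -[q x ^+ 2]ger0_norm ?sqr_ge0// normrX expr_le1.
have hw : has_deriv w v.
  split => //.
    apply: sq_D => //; last by apply: bd; [exact: ac_cont (ac_sin aphi)|move=> x; exact: sin_max].
    by apply: measurable_funM => //; exact: cont_meas (ac_cont (ac_sin aphi)).
  apply: sq_B => //; last by apply: bd; [exact: ac_cont (ac_cos aphi)|move=> x; exact: cos_max].
  by apply: measurable_funM => //; exact: cont_meas (ac_cont (ac_cos aphi)).
(* Outside [-A, A] the phase is exact, so |w| = |rho - 1| with rho = |psi|, and (rho - 1)^2 <=
   (rho^2 - 1)^2 since rho + 1 >= 1. *)
have psiE x al : Un x = expi al -> 4^-1 < nsq (psi x) -> phi x = phi0 x + al ->
    nsq (w x) <= (nsq (psi x) - 1) ^+ 2.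
  move=> UE p4 pE; have [_ E] := isqrt_nsq (ltW p4).
  have E' : psi x = Complex (Num.sqrt (nsq (psi x))) 0 * expi (phi x).
    rewrite {1}E pE expiD -UE /Un; set q := Complex (isqrt _) 0 * psi x.
    by rewrite [expi _ * _]mulrCA expiK mulr1.
  have -> : w x = (Complex (Num.sqrt (nsq (psi x)) - 1) 0) * expi (phi x).
    rewrite /w {1}E'; apply: C_eq; rewrite !C_simp/=; ring.
  rewrite nsqM nsq_expi mulr1 {1}/nsq/= expr0n/= addr0.
  have s0 := sqrtr_ge0 (nsq (psi x)); have := sqr_sqrtr (nsq_ge0 (psi x)).
  set r := Num.sqrt _ in s0 * => rE; rewrite -rE.
  rewrite -subr_ge0 (_ : _ - _ = (r - 1) ^+ 2 * (r * (r + 2))); last ring.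
  by rewrite mulr_ge0 ?sqr_ge0// mulr_ge0// addr_ge0.
have cw : continuous (fun x => nsq (w x)) by exact: nsq_cont hw.
have sw : ig setT (fun x => nsq (w x)).
  apply: (@ig_le _ _ _ (fun x => (nsq (psi x) - 1) ^+ 2 + ((fun x => nsq (w x)) \_ `[- A, A]) x)) => //.
  - exact: cont_meas.
  - apply: igD => //.
    have := (@integrable_mkcond _ _ R mu `[- A, A] (EFin \o (fun x => nsq (w x))) _).1.
    by rewrite -restrict_EFin; apply => //; exact: ig_cont.
  move=> x _; rewrite ger0_norm ?nsq_ge0// patchE.
  case: ifPn => [_|]; first by rewrite lerDr sqr_ge0.
  rewrite notin_setE/= in_itv/= addr0 => /negP; rewrite negb_and -!ltNge => /orP[xA|Ax].
    apply: (psiE x al1); [exact: Ul (ltW xA)| |exact: phil (ltW xA)].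
    by apply: HA; rewrite -normrN (le_trans _ (ler_norm _))//; lra.
  apply: (psiE x al2); [exact: Ur (ltW Ax)| |exact: phir (ltW Ax)].
  by apply: HA; rewrite (le_trans (ltW Ax))// ler_norm.
have [cw1 cw2] := has_deriv_cont hw.
have part (q : R -> R) : continuous q -> (forall x, q x ^+ 2 <= nsq (w x)) ->
    ig setT (fun x => q x ^+ 2).
  move=> cq qw; apply: (ig_le _ _ sw) => //; first by apply: measurable_funX; exact: cont_meas.
  by move=> x _; rewrite ger0_norm ?sqr_ge0.
exists phi, w; split.
- by apply/homogeneous_H1P; exists dphi.
- split; first by apply/homogeneous_H1CP; exists v.
  split; apply/sq_intE; split.
  + exact: cont_meas.
  + by apply: part => // x; rewrite /nsq lerDl sqr_ge0.
  + exact: cont_meas.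
  + by apply: part => // x; rewrite /nsq lerDr sqr_ge0.
- by move=> x; rewrite /w addrC subrK.
Qed.

End Lifting.

(** * Consequences of the assumptions for the potential *)

Section Potential.
Context {R : realType}.
Local Notation mu := (@lebesgue_measure R).
Local Notation ig A f := (mu.-integrable A (EFin \o f)).
Implicit Types (F V k f g : R -> R) (a b c s t x y e K : R).

(* What the proof uses of the potential.  The function k is the primitive of
   [sqrt V(s) / (2 sqrt s)] vanishing at 1, so that k(r^2) is H(r) for r >= 1; the
   cut-off at 1/4 makes it globally C^1. *)
Definition weight V s : R := Num.sqrt `|V s| / (2 * Num.sqrt (Num.max s 4^-1)).

Definition admissible V := [/\ continuous V, V 1 = 0,
  forall s, 0 <= s -> s != 1 -> 0 < V s,
  forall kap, 0 < kap -> kap < 1 -> exists2 d, 0 < d & forall s, `|s - 1| <= d ->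
    2^-1 * (1 - kap) * (s - 1) ^+ 2 <= V s &
  exists k, [/\ ac k (weight V), k 1 = 0 &
    forall c, exists K, forall s, 0 <= s -> k s <= c -> s <= K]].

Lemma weight_cont {V} : continuous V -> continuous (weight V).
Proof.
move=> cV s; rewrite /continuous_at; apply: cvgM.
  apply: (@cvg_comp _ _ _ (fun s => `|V s|) Num.sqrt); last exact: sqrt_continuous.
  by apply: cvg_norm; exact: cV.
apply: cvgV; first by rewrite gt_eqF// mulr_gt0// sqrtr_gt0 max4_gt0.
apply: cvgM; first exact: cvg_cst.
apply: (@cvg_comp _ _ _ (fun y => Num.max y 4^-1) Num.sqrt); last exact: sqrt_continuous.
by apply: (max_cst_cont 4^-1 (f := id)) => x; exact: cvg_id.
Qed.

Lemma admissible_ge0 {V s} : admissible V -> 0 <= s -> 0 <= V s.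
Proof.
move=> [_ V1 Vp _ _] s0; have [->|s1] := eqVneq s 1; first by rewrite V1.
exact/ltW/Vp.
Qed.

Lemma potential_away {V} K e : admissible V -> 0 < e -> 0 <= K ->
  exists2 m, 0 < m & forall s, 0 <= s -> s <= K -> e <= `|s - 1| -> m <= V s.
Proof.
move=> [cV V1 Vp _ _] e0 K0.
(* Unlike V, the function W is positive on all of [0, K], including 1, and it equals V where |s - 1|
   >= e; its attained minimum is the required bound. *)
pose W s := Num.max (e - `|s - 1|) (V s).
have cW : continuous W.
  have cd : continuous (fun s => e - `|s - 1|).
    move=> s; apply: cvgB; first exact: cvg_cst.
    by apply: cvg_norm; apply: cvgB; [exact: cvg_id|exact: cvg_cst].
  have -> : W = (fun x => Num.max ((e - `|x - 1|) - V x) 0 + V x).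
    apply/funext => s; rewrite /W; have [h|h] := leP (e - `|s - 1|) (V s).
      by rewrite max_r ?add0r// subr_le0.
    by rewrite max_l ?subrK// subr_ge0 ltW.
  move=> s; apply: cvgD; last exact: cV.
  apply: (@max_cst_cont _ (fun x => e - `|x - 1| - V x) 0) => x.
  by apply: cvgB; [exact: cd|exact: cV].
have [c] := EVT_min K0 (continuous_subspaceT cW).
rewrite in_itv/= => /andP[c0 cK] cmin.
exists (W c).
  rewrite /W lt_max; have [->|c1] := eqVneq c 1; first by rewrite subrr normr0 subr0 e0.
  by rewrite (Vp c c0 c1) orbT.
move=> s s0 sK es; have : W c <= W s by apply: cmin; rewrite in_itv/= s0.
rewrite {2}/W max_r//; rewrite (@le_trans _ _ 0)//; first by rewrite subr_le0.
have [s1|s1] := eqVneq s 1; first by rewrite s1 V1.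
exact/ltW/Vp.
Qed.

Lemma potential_quadratic {V} K : admissible V -> 0 <= K ->
  exists2 c, 0 < c & forall s, 0 <= s -> s <= K -> c * (s - 1) ^+ 2 <= V s.
Proof.
move=> adm K0; have [_ _ _ near _] := adm.
have [d d0 D] := near 2^-1 ltac:(lra) ltac:(lra).
have [m m0 M] := potential_away K d adm d0 K0.
have K1 : 0 < (K + 1) ^+ 2 by rewrite exprn_gt0//; lra.
(* Near 1 the constant is (1/2)(1 - 1/2) = 1/4; away from 1 the bound |s - 1| <= K + 1 is enough. *)
pose c := Num.min 4^-1 (m / (K + 1) ^+ 2).
have c4 : c <= 4^-1 by rewrite ge_min lexx.
have cm : c <= m / (K + 1) ^+ 2 by rewrite ge_min lexx orbT.
exists c; first by rewrite lt_min divr_gt0// andbT; lra.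
move=> s s0 sK; have [sd|sd] := leP (`|s - 1|) d.
  apply: le_trans (D s sd); rewrite ler_wpM2r ?sqr_ge0//; lra.
apply: le_trans (M s s0 sK (ltW sd)).
apply: (@le_trans _ _ (c * (K + 1) ^+ 2)); last by rewrite -ler_pdivlMr.
apply: ler_wpM2l; first by rewrite le_min divr_ge0 ?ltW//; lra.
rewrite -subr_ge0 (_ : _ - _ = (K + s) * (K + 2 - s)); last ring.
by apply: mulr_ge0; lra.
Qed.

Lemma potential_admissible {F} : assumption_A1 F -> assumption_B1 F ->
  exists2 V, admissible V & forall s, 0 <= s -> potential F s = V s.
Proof.
move=> [cF dF F1 F'1] [Fpos FH].
(* The constant extension to the negative axis makes V continuous on the whole line and changes
   nothing on [0, +oo[. *)
pose F0 x := F (Num.max x 0).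
have cF0 : continuous F0.
  have /subspace_continuousP cF' := cF.
  have cm : continuous (fun x : R => Num.max x 0).
    by apply: (max_cst_cont 0 (f := id)) => x; exact: cvg_id.
  move=> x; have m0 : 0 <= Num.max x 0 by rewrite le_max lexx orbT.
  apply/cvgrPdist_lt => e e0.
  have := cF' (Num.max x 0); rewrite /= in_itv/= andbT m0 => /(_ isT).
  move=> /cvgrPdist_lt /(_ e e0); rewrite near_withinE => /nbhs_ballP[d /= d0 D].
  have /cvgrPdist_lt /(_ d d0) := cm x; apply: filterS => y yd.
  by apply: D => //=; rewrite in_itv/= andbT le_max lexx orbT.
have [P0 aP0] := @ac_exists R F0 (fun a b => ig_cont cF0).
pose V s := P0 1 - P0 s.
have aV : ac V (fun s => - F0 s).
  by apply: (ac_ext (ac_shift_cst (P0 1) (ac_N aP0))) => // s; rewrite addrC.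
have VE s : 0 <= s -> potential F s = V s.
  move=> s0; rewrite /potential /oriented_integral; case: ifPn => s1.
    rewrite /V (acE aP0 s1); apply: I_ext => x /=; rewrite in_itv/= => /andP[sx _].
    by rewrite /F0 max_l// (le_trans s0).
  have s1' : 1 <= s by rewrite ltW// ltNge.
  rewrite /V -opprB (acE aP0 s1'); congr (- _); apply: I_ext => x /=.
  by rewrite in_itv/= => /andP[sx _]; rewrite /F0 max_l// (le_trans ler01).
have cV : continuous V := ac_cont aV.
have V1 : V 1 = 0 by rewrite /V subrr.
have Vp s : 0 <= s -> s != 1 -> 0 < V s by move=> s0 s1; rewrite -VE//; exact: Fpos.
exists V => //; split => //.
- move=> kap k0 k1.
  have [dF1 _] := nbhs_singleton dF.
  have dv : is_derive (1 : R) (1 : R) F (-1) by split => //; rewrite -derive1E.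
  have : (h^-1 *: (F (h + 1) - F 1)) @[h --> (0 : R)^'] --> (-1 : R).
    rewrite -F'1 derive1E; have := dF1; rewrite /derivable => /cvg_ex[l Hl].
    rewrite /derive.
    have E : (fun h : R => h^-1 *: (F (h *: (1 : R) + 1) - F 1)) =
             (fun h : R => h^-1 *: (F (h + 1) - F 1)).
      by apply/funext => h; rewrite /GRing.scale/= mulr1.
    rewrite E in Hl; rewrite E; have -> := cvg_lim _ Hl; last exact: Rhausdorff.
    exact: Hl.
  move=> /cvgrPdist_le /(_ kap k0) [d /= d0 D].
  (* d / 2 turns a non-strict bound on |s - 1| into the open ball of radius d, and 1/2 keeps x
     positive, where F0 is F. *)
  pose d' := Num.min (d / 2) 2^-1.
  have d'0 : 0 < d' by rewrite lt_min; lra.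
  exists d' => // s; rewrite le_min => /andP[sd sh].
  have slope h : h != 0 -> `|h| <= d / 2 -> F (h + 1) / h <= - (1 - kap).
    move=> h0 hd; have hb : ball_ [eta Num.norm] 0 d h by rewrite /= sub0r normrN; lra.
    have := D h hb h0; rewrite F1 subr0 /GRing.scale/= mulrC ler_norml => /andP[h1 h2].
    lra.
  have pw (x : R) : `|x - 1| <= d / 2 -> `|x - 1| <= 2^-1 ->
      (x <= 1 -> (1 - kap) * (1 - x) <= F0 x) /\ (1 <= x -> F0 x <= (1 - kap) * (1 - x)).
    move=> xd; rewrite ler_norml => /andP[x1 x2]; rewrite /F0 max_l; last lra.
    have [->|xn] := eqVneq x 1; first by rewrite F1 subrr mulr0.
    have hn : x - 1 != 0 by rewrite subr_eq0.
    have := slope (x - 1) hn xd; rewrite subrK => S.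
    split => [x_1|x_1].
      have xl : x - 1 < 0 by rewrite subr_lt0 lt_neqAle xn.
      by move: S; rewrite ler_ndivrMr//; lra.
    have xl : 0 < x - 1 by rewrite subr_gt0 lt_neqAle eq_sym xn.
    by move: S; rewrite ler_pdivrMr//; lra.
  (* G vanishes at 1, and by the slope bound its density is <= 0 to the left of 1 and >= 0 to the
     right. *)
  pose G s := V s - 2^-1 * (1 - kap) * ((s + -1) * (s + -1)).
  pose dG s := - F0 s - 2^-1 * (1 - kap) * (1 * (s + -1) + 1 * (s + -1)).
  have aG : ac G dG.
    apply: ac_B => //; apply: ac_Z.
    by apply: ac_mul; apply: ac_shift_cst; exact: ac_id.
  have G1 : G 1 = 0 by rewrite /G V1 subrr mul0r mulr0 subrr.
  suff : 0 <= G s by rewrite /G subr_ge0 expr2.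
  have [s1|/ltW s1] := leP s 1.
    have E : - G s = \int[mu]_(x in `[s, 1]) dG x by rewrite -(acE aG s1) G1 sub0r.
    have : 0 <= \int[mu]_(x in `[s, 1]) - dG x.
      apply: I_ge0 => x /=; rewrite in_itv/= => /andP[sx x1].
      have xs : `|x - 1| <= `|s - 1| by rewrite !ler0_norm ?subr_le0//; lra.
      have [/(_ x1) + _] := pw x (le_trans xs sd) (le_trans xs sh).
      by rewrite /dG; lra.
    by rewrite I_N//; [rewrite -E opprK|exact: ac_ig aG].
  have E : G s = \int[mu]_(x in `[1, s]) dG x by rewrite -(acE aG s1) G1 subr0.
  rewrite E; apply: I_ge0 => x /=; rewrite in_itv/= => /andP[x1 xs'].
  have xs : `|x - 1| <= `|s - 1| by rewrite !ger0_norm ?subr_ge0//; lra.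
  have [_ /(_ x1)] := pw x (le_trans xs sd) (le_trans xs sh).
  by rewrite /dG; lra.
- have cw := weight_cont cV.
  have [k0 ak0] := @ac_exists R (weight V) (fun a b => ig_cont cw).
  pose k s := k0 s + (- k0 1).
  have ak : ac k (weight V) by exact: ac_shift_cst.
  exists k; split => //; first by rewrite /k subrr.
  have asq : ac (fun x : R => x * x) (fun x => 1 * x + 1 * x) by exact: ac_mul ac_id ac_id.
  have akk := ac_chain (ac_deriv ak cw) cw asq.
  have kE s : 1 <= s -> k (s * s) = primitive_sqrt_potential F s.
    move=> s1; rewrite /primitive_sqrt_potential /oriented_integral s1.
    have : k (s * s) - k (1 * 1) = k (s * s) by rewrite mulr1 /k subrr subr0.
    move=> <-; rewrite (acE akk s1); apply: I_ext => x /=; rewrite in_itv/= => /andP[x1 _].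
    have x0 : 0 < x by lra.
    have x2 : 4^-1 <= x * x by nra.
    rewrite VE ?sqr_ge0// /weight max_l// -expr2 sqrtr_sqr (gtr0_norm x0).
    by set q := Num.sqrt _; field; rewrite gt_eqF.
  move=> c; have /cvgryPge /(_ (c + 1)) [M [_ HM]] := FH.
  pose S := Num.max (M + 1) 1.
  exists (S * S) => s s0 ks; rewrite leNgt; apply/negP => Ss.
  have S1 : 1 <= S by rewrite le_max lexx orbT.
  have Sq : S < Num.sqrt s.
    by rewrite -(ltr_pXn2r (n := 2)) ?nnegrE ?sqrtr_ge0 ?sqr_sqrtr//; lra.
  have := HM (Num.sqrt s) _; rewrite -kE; last by lra.
  rewrite -expr2 sqr_sqrtr// => H; have := H _.
  have MS : M + 1 <= S by rewrite le_max lexx.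
  by move=> /(_ ltac:(lra)); lra.
Qed.

End Potential.

(** * Functions of finite energy: bounds on the modulus, behaviour at infinity, momentum *)

Section FiniteEnergy.
Context {R : realType}.
Local Notation mu := (@lebesgue_measure R).
Local Notation ig A f := (mu.-integrable A (EFin \o f)).
Local Notation Re := (@complex.Re R).
Local Notation Im := (@complex.Im R).
Implicit Types (F V k f g phi : R -> R) (a b c s t x y e K E : R) (z : R[i]) (psi u v w : R -> R[i]).

Definition edens V psi u x := nsq (u x) + V (nsq (psi x)).

Definition fin_energy V psi u := has_deriv psi u /\ ig setT (fun x => V (nsq (psi x))).

Definition en V psi u := \int[mu]_x edens V psi u x.

Lemma edens_ig {V psi u} : fin_energy V psi u -> ig setT (edens V psi u).
Proof. by move=> [h hV]; apply: (igD measurableT (has_deriv_nsq_ig h) hV). Qed.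

Lemma edens_ge0 {V} psi u x : admissible V -> 0 <= edens V psi u x.
Proof. by move=> adm; rewrite addr_ge0 ?nsq_ge0// (admissible_ge0 adm)// nsq_ge0. Qed.

Lemma en_sub {V psi u} {A B : set (measurableTypeR R)} : admissible V -> fin_energy V psi u ->
  measurable A -> measurable B -> A `<=` B ->
  \int[mu]_(x in A) edens V psi u x <= \int[mu]_(x in B) edens V psi u x.
Proof.
move=> adm h mA mB AB; apply: I_subset => //; first exact: igS (edens_ig h).
by move=> x _; exact: edens_ge0.
Qed.

Lemma en_ge0 {V psi u} : admissible V -> 0 <= en V psi u.
Proof. by move=> adm; apply: I_ge0 => x _; exact: edens_ge0. Qed.

Lemma energy_spaceP {F V psi} : (forall s, 0 <= s -> potential F s = V s) ->
  energy_space F psi <-> exists u, fin_energy V psi u.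
Proof.
move=> FV; have E : (fun x => (potential F (Normc.normc (psi x) ^+ 2))%:E) =
    EFin \o (fun x => V (nsq (psi x))).
  by apply/funext => x /=; rewrite normc_sq FV// nsq_ge0.
rewrite /energy_space E; split=> [[/homogeneous_H1CP[u hu] iV]|[u [hu iV]]].
  by exists u.
by split => //; apply/homogeneous_H1CP; exists u.
Qed.

Lemma energyE {F V psi u} : (forall s, 0 <= s -> potential F s = V s) ->
  fin_energy V psi u -> energy F psi = (en V psi u)%:E.
Proof.
move=> FV h; have [hu iV] := h.
have hw : has_deriv psi (wderiveC psi).
  by apply: wderiveCP; apply/homogeneous_H1CP; exists u.
rewrite /energy /en -(I_fin measurableT (edens_ig h)).
have [mw1 mw2] := has_deriv_meas hw; have [mu1 mu2] := has_deriv_meas hu.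
have mV := ig_meas measurableT iV.
transitivity (\int[mu]_x (edens V psi (wderiveC psi) x)%:E)%E.
  by apply: eq_integral => x _; rewrite !normc_sq FV ?nsq_ge0.
have [h1 h2 _ _] := hu; have [w1 w2 _ _] := hw.
apply: ae_eq_integral => //.
- apply/measurable_EFinP; apply: measurable_funD => //.
  by apply: measurable_funD; apply: measurable_funX.
- apply/measurable_EFinP; apply: measurable_funD => //.
  by apply: measurable_funD; apply: measurable_funX.
- apply: aeS2 (ac_uniq_ae w1 h1) (ac_uniq_ae w2 h2) => x E1 E2 _.
  by move: E1 E2; rewrite /edens /nsq /= => -> ->.
Qed.

Lemma itv1_ig {V psi u a b} : fin_energy V psi u -> ig `[a, b] (edens V psi u).
Proof. by move=> h; apply: ig_itvT; exact: edens_ig. Qed.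

(** The Modica-Mortola estimate: with r = |psi|^2, the derivative of k(r) is at most sqrt(V(r)) |u|,
    hence at most half the energy density. It controls the modulus even if V is small at infinity,
    where only the divergence of H helps. *)
Lemma k_variation {V psi u k} : admissible V -> fin_energy V psi u -> ac k (weight V) ->
  forall x y, `|k (nsq (psi x)) - k (nsq (psi y))| <= en V psi u / 2.
Proof.
move=> adm h ak x y; have [cV _ _ _ _] := adm; have [hu iV] := h.
wlog xy : x y / x <= y => [W|].
  by have [/W//|/ltW/W] := leP x y; rewrite distrC.
have cw := weight_cont cV.
have A := ac_chain (ac_deriv ak cw) cw (ac_nsq hu).
rewrite distrC (acE A xy); apply: (le_trans (I_norm _ _)) => //; first exact: ac_ig A.
apply: (@le_trans _ _ (\int[mu]_(t in `[x, y]) (2^-1 * edens V psi u t))); last first.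
  rewrite I_Z//; last exact: itv1_ig.
  by rewrite mulrC; apply: ler_wpM2r; [rewrite invr_ge0|apply: en_sub].
apply: I_le => //; first by apply: ig_norm => //; exact: ac_ig A.
  by apply: igZ => //; exact: itv1_ig.
move=> t _; set r := nsq (psi t).
have r0 : 0 <= r by exact: nsq_ge0.
set q := Re (psi t) * Re (u t) + Im (psi t) * Im (u t).
have q2 : q ^+ 2 <= r * nsq (u t).
  rewrite -subr_ge0 /q /r /nsq.
  rewrite (_ : _ - _ = (Re (psi t) * Im (u t) - Im (psi t) * Re (u t)) ^+ 2); last ring.
  exact: sqr_ge0.
have V0 : 0 <= V r by exact: admissible_ge0.
have m0 := max4_gt0 r; set m := Num.max r 4^-1 in m0.
have rm : r <= m by rewrite /m le_max lexx.
rewrite /weight (ger0_norm V0) -/m.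
have s0 : 0 < Num.sqrt m by rewrite sqrtr_gt0.
set P := 2 * q * _; have P2 : P ^+ 2 <= V r * nsq (u t).
  have -> : P ^+ 2 = V r * (q ^+ 2 / m).
    rewrite /P exprMn exprMn expr_div_n exprMn (sqr_sqrtr V0) (sqr_sqrtr (ltW m0)).
    by field; rewrite gt_eqF.
  apply: ler_wpM2l => //; rewrite ler_pdivrMr//; apply: (le_trans q2).
  by rewrite mulrC ler_wpM2l// nsq_ge0.
have n0 := nsq_ge0 (u t); rewrite /edens -/r.
rewrite -ler_sqr ?nnegrE//; last by apply: mulr_ge0; [rewrite invr_ge0|rewrite addr_ge0].
rewrite real_normK ?num_real//; apply: (le_trans P2).
rewrite -subr_ge0 (_ : _ - _ = 4^-1 * (nsq (u t) - V r) ^+ 2); last by field.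
by apply: mulr_ge0; [rewrite invr_ge0|exact: sqr_ge0].
Qed.

(** A first bound, depending on |psi(0)|. It serves to prove that |psi| tends to 1; after that
    [uniform_bound] can start from infinity and depends on the energy alone. *)
Lemma bounded_nsq {V psi u} : admissible V -> fin_energy V psi u ->
  exists2 K, 0 <= K & forall x, nsq (psi x) <= K.
Proof.
move=> adm h; have [_ _ _ _ [k [ak k1 kK]]] := adm.
have [K HK] := kK (k (nsq (psi 0)) + en V psi u / 2).
exists K; first by apply: (le_trans (nsq_ge0 (psi 0))); apply: HK; rewrite ?nsq_ge0// lerDl divr_ge0// en_ge0.
move=> x; apply: HK; first exact: nsq_ge0.
by have := k_variation adm h ak x 0; rewrite ler_norml => /andP[_]; lra.
Qed.

Lemma nsq_variation {V psi u K t x y} : admissible V -> fin_energy V psi u ->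
  (forall s, nsq (psi s) <= K) -> 0 < t -> x <= y ->
  `|nsq (psi y) - nsq (psi x)| <= t * K * (y - x) +
     t^-1 * \int[mu]_(s in `[x, y]) edens V psi u s.
Proof.
move=> adm h HK t0 xy; have [hu iV] := h; have A := ac_nsq hu.
have i1 : ig `[x, y] (fun=> t * K) by apply: ig_cont => s; exact: cvg_cst.
have i2 := itv1_ig (a := x) (b := y) h.
rewrite (acE A xy); apply: (le_trans (I_norm _ _)) => //; first exact: ac_ig A.
rewrite -(I_cst x y (t * K) xy) -I_Z// -I_D//; last exact: igZ.
apply: I_le => //; [by apply: ig_norm => //; exact: ac_ig A|by apply: igD => //; exact: igZ|].
move=> s _; have := HK s; rewrite /edens; set f1 := Re (psi s); set f2 := Im (psi s).
have V0 : 0 <= V (nsq (psi s)) by apply: (admissible_ge0 adm); exact: nsq_ge0.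
rewrite {1}/nsq -/f1 -/f2 => Ks.
apply: (@le_trans _ _ (t * (f1 ^+ 2 + f2 ^+ 2) + t^-1 * nsq (u s))); last first.
  apply: lerD; first by apply: ler_wpM2l => //; exact: ltW.
  by apply: ler_wpM2l; [rewrite invr_ge0 ltW|rewrite lerDl].
rewrite /nsq; set g1 := Re (u s); set g2 := Im (u s).
have ti : 0 < t^-1 by rewrite invr_gt0.
rewrite ler_norml; apply/andP; split; rewrite -subr_ge0.
  rewrite (_ : _ - _ = t^-1 * ((t * f1 + g1) ^+ 2 + (t * f2 + g2) ^+ 2)).
    by apply: mulr_ge0; [exact: ltW|rewrite addr_ge0 ?sqr_ge0].
  by field; rewrite gt_eqF.
rewrite (_ : _ - _ = t^-1 * ((t * f1 - g1) ^+ 2 + (t * f2 - g2) ^+ 2)).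
  by apply: mulr_ge0; [exact: ltW|rewrite addr_ge0 ?sqr_ge0].
by field; rewrite gt_eqF.
Qed.

(** If |psi|^2 is off 1 by e at x, then either it moves by e/2 within [x, x + 1], which costs
    kinetic energy, or it stays e/2 away from 1 there and pays through the potential. The threshold
    is the same for all psi bounded by K. *)
Lemma energy_barrier {V} K e : admissible V -> 0 <= K -> 0 < e ->
  exists2 h, 0 < h & forall psi u x, fin_energy V psi u -> (forall s, nsq (psi s) <= K) ->
    \int[mu]_(s in `[x, x + 1]) edens V psi u s < h -> `|nsq (psi x) - 1| < e.
Proof.
move=> adm K0 e0; have [m m0 M] := potential_away K (e / 2) adm ltac:(lra) K0.
(* With this t both terms of [nsq_variation] on an interval of length at most 1 are at most e/4 as
   long as the energy there is below t e/4. *)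
pose t := e / (4 * (K + 1)).
have t0 : 0 < t by rewrite divr_gt0//; lra.
have tK : t * K <= e / 4.
  rewrite /t -mulrA ler_pM2l// mulrC ler_pdivrMr; last lra.
  lra.
pose h := Num.min (t * (e / 4)) m.
have h0 : 0 < h by rewrite lt_min m0 andbT mulr_gt0//; lra.
exists h => // psi u x fe HK Eh; rewrite ltNge; apply/negP => big.
have xx : x <= x + 1 by rewrite lerDl.
suff : m <= \int[mu]_(s in `[x, x + 1]) edens V psi u s.
  by move: Eh; rewrite lt_min => /andP[_]; lra.
have <- : \int[mu]_(s in `[x, x + 1]) m = m by rewrite I_cst// addrAC subrr add0r mulr1.
apply: I_le => //; [by apply: ig_cont => s; exact: cvg_cst|exact: itv1_ig|].
move=> y /=; rewrite in_itv/= => /andP[xy yx].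
have v := nsq_variation adm fe HK t0 xy.
have E1 : \int[mu]_(s in `[x, y]) edens V psi u s <= t * (e / 4).
  apply: (@le_trans _ _ (\int[mu]_(s in `[x, x + 1]) edens V psi u s)).
    by apply: en_sub => // s /=; rewrite !in_itv/= => /andP[-> sy]; exact: le_trans sy yx.
  by move: Eh; rewrite lt_min => /andP[/ltW].
have v1 : t * K * (y - x) <= e / 4.
  have tK0 : 0 <= t * K by apply: mulr_ge0 => //; exact: ltW.
  by apply: le_trans tK; apply: ler_piMr => //; lra.
have v2 : t^-1 * \int[mu]_(s in `[x, y]) edens V psi u s <= e / 4.
  by rewrite mulrC ler_pdivrMr// mulrC.
have big' : e / 2 <= `|nsq (psi y) - 1|.
  have := ler_normB (nsq (psi y) - 1) (nsq (psi y) - nsq (psi x)).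
  rewrite (_ : _ - _ - (_ - _) = nsq (psi x) - 1); last ring.
  lra.
apply: (le_trans (M (nsq (psi y)) (nsq_ge0 _) (HK y) big')).
by rewrite /edens lerDr nsq_ge0.
Qed.

Lemma nsq_ends {V psi u e} : admissible V -> fin_energy V psi u -> 0 < e ->
  exists2 A, 0 < A & forall x, A <= `|x| -> `|nsq (psi x) - 1| < e.
Proof.
move=> adm fe e0; have [K K0 HK] := bounded_nsq adm fe.
have [h h0 H] := energy_barrier K e adm K0 e0.
have [A A0 HA] := ig_tail (edens_ig fe) h0.
have nE (X : set (measurableTypeR R)) : \int[mu]_(x in X) `|edens V psi u x| =
    \int[mu]_(x in X) edens V psi u x.
  by apply: I_ext => x _; rewrite ger0_norm// edens_ge0.
exists (A + 1); first by lra.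
move=> x Ax; apply: (H psi u) => //.
have [x0|x0] := leP 0 x.
  rewrite ger0_norm// in Ax.
  have := HA (- A) x (lexx _) ltac:(lra); rewrite !nE.
  have : \int[mu]_(s in `[- A, x]) edens V psi u s + \int[mu]_(s in `[x, x + 1]) edens V psi u s
      <= \int[mu]_s edens V psi u s.
    rewrite -I_cat; [exact: en_sub|lra|lra|exact: itv1_ig].
  lra.
rewrite ltr0_norm// in Ax.
have := HA (x + 1) A ltac:(lra) (lexx _); rewrite !nE.
have : \int[mu]_(s in `[x, x + 1]) edens V psi u s + \int[mu]_(s in `[x + 1, A]) edens V psi u s
    <= \int[mu]_s edens V psi u s.
  rewrite -I_cat; [exact: en_sub|lra|lra|exact: itv1_ig].
lra.
Qed.

Lemma nsq_cvg {V psi u} : admissible V -> fin_energy V psi u ->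
  (nsq (psi x) @[x --> -oo] --> (1 : R)) /\ (nsq (psi x) @[x --> +oo] --> (1 : R)).
Proof.
move=> adm fe; split.
  apply/cvgNyP => e e0; have [A A0 HA] := nsq_ends adm fe e0.
  exists (- A) => x xA; apply: ltW; apply: HA.
  by rewrite -normrN (le_trans _ (ler_norm _))//; lra.
apply/cvgyP => e e0; have [A A0 HA] := nsq_ends adm fe e0.
by exists A => x xA; apply: ltW; apply: HA; rewrite (le_trans xA)// ler_norm.
Qed.

Lemma uniform_bound {V} E : admissible V -> exists2 K, 1 <= K & forall psi u,
  fin_energy V psi u -> en V psi u <= E -> forall x, nsq (psi x) <= K.
Proof.
move=> adm; have [_ _ _ _ [k [ak k1 kK]]] := adm.
have [K HK] := kK (1 + E / 2).
exists (Num.max K 1); first by rewrite le_max lexx orbT.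
move=> psi u fe eE x; rewrite le_max; apply/orP; left.
apply: HK; first exact: nsq_ge0.
have [_ c] := nsq_cvg adm fe.
have ck : k (nsq (psi x)) @[x --> +oo] --> k 1 by apply: (cvg_comp _ _ c); exact: (ac_cont ak).
have /cvgyP/(_ 1 ltr01)[A HA] := ck.
have := HA A (lexx _); rewrite k1 subr0 ler_norml => /andP[_ H1].
have := k_variation adm fe ak x A; rewrite ler_norml => /andP[_]; lra.
Qed.

Lemma sqr_ig {V psi u} : admissible V -> fin_energy V psi u ->
  ig setT (fun x => (nsq (psi x) - 1) ^+ 2).
Proof.
move=> adm fe; have [K K0 HK] := bounded_nsq adm fe.
have [c c0 Hc] := potential_quadratic K adm K0; have [hu iV] := fe.
apply: (ig_le _ _ (igZ c^-1 _ iV)) => //.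
  apply: measurable_funX; apply: measurable_funB => //.
  by apply: cont_meas; exact: nsq_cont hu.
move=> x _; rewrite ger0_norm ?sqr_ge0// mulrC ler_pdivlMr// mulrC.
by apply: Hc; [exact: nsq_ge0|exact: HK].
Qed.

Lemma fin_energy_decomposition {V psi u} : admissible V -> fin_energy V psi u ->
  exists phi w, phase_decomposition psi phi w.
Proof.
move=> adm fe; have [hu _] := fe; apply: (decomposition_exists hu); last exact: sqr_ig fe.
have [A A0 HA] := nsq_ends (e := 2^-1) adm fe ltac:(lra).
exists A => // x Ax; have := HA x Ax; rewrite ltr_norml => /andP[]; lra.
Qed.

Lemma mom_exists {V psi u} : admissible V -> fin_energy V psi u ->
  exists q, mom psi u (expi q).
Proof.
move=> adm fe; have [phi [w d]] := fin_energy_decomposition adm fe.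
by exists (momentum phi w); apply: mom_of_decomposition => //; case: fe.
Qed.

Lemma nsq_end {V psi u} {G : set_system R} {FG : ProperFilter G} {J : R -> R} {z} :
  (nsq (psi x) @[x --> G] --> (1 : R)) -> ccvg G (fun x => expi (J x) * psi x) z -> nsq z = 1.
Proof.
move=> c /ccvg_nsq; under eq_fun do rewrite nsqM nsq_expi mul1r.
by move=> c'; apply: (@cvg_unique R^o) c' c; exact: Rhausdorff.
Qed.

Lemma mom_unit {V psi u z} : admissible V -> fin_energy V psi u -> mom psi u z -> nsq z = 1.
Proof.
move=> adm fe [J [w1 [w2 [aJ c1 c2 ->]]]]; have [d1 d2] := nsq_cvg adm fe.
by rewrite nsqM nsqJ (nsq_end (V := V) (u := u) d1 c1) (nsq_end (V := V) (u := u) d2 c2) mulr1.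
Qed.

Lemma expi_period (m : nat) x : expi (x + 2 * pi * m%:R) = expi x.
Proof.
elim: m => [|m IH]; first by rewrite mulr0 addr0.
have p y : expi (y + 2 * pi) = expi y.
  by rewrite mulr_natl; apply: C_eq; rewrite !C_simp ?cosD2pi ?sinD2pi.
by rewrite -(natr1 m) mulrDr mulr1 addrA p IH.
Qed.

Lemma expi_eq1 t : expi t = 1 -> exists n : int, t = 2 * pi * n%:~R.
Proof.
move=> t1; have c1 : cos t = 1 by rewrite -Re_expi t1.
have p0 : 0 < 2 * pi :> R by rewrite mulr_gt0// pi_gt0.
pose n := Num.floor (t / (2 * pi)); exists n.
have /andP[n1 n2] : n%:~R <= t / (2 * pi) < (n + 1)%:~R by exact: floor_itv.
pose r := t - 2 * pi * n%:~R.
have r0 : 0 <= r by rewrite subr_ge0 mulrC -ler_pdivlMr.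
have r1 : r < 2 * pi.
  by move: n2; rewrite ltr_pdivrMr// intrD mulrDl mul1r /r; lra.
have per (m : nat) (x : R) : cos (x + 2 * pi * m%:R) = cos x.
  by rewrite -Re_expi expi_period.
have cr : cos r = 1.
  rewrite -c1 /r; case: (n) => m.
    by rewrite -(per m (t - _)) subrK.
  by rewrite NegzE mulrNz mulrN opprK per.
suff : r = 0 by rewrite /r => /eqP; rewrite subr_eq0 => /eqP.
have pp := pi_gt0 R.
have [rp|rp] := leP r pi.
  by apply: cos_inj; rewrite ?in_itv/= ?r0 ?rp ?lexx ?(ltW pp)// cr cos0.
have : cos (2 * pi - r) = cos 0 by rewrite cosB mulr_natl cos2pi sin2pi cr cos0 mul0r addr0 mulr1.
move=> /cos_inj; rewrite !in_itv/= lexx (ltW pp) => H.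
have h1 : 0 <= 2 * pi - r <= pi by apply/andP; split; lra.
have := H h1 isT; lra.
Qed.

Lemma class2piE (p : R) : class2pi p = [set q | expi q = expi p].
Proof.
apply/seteqP; split=> [_ [n _ <-]|q /= qp].
  case: n => m /=; first by rewrite expi_period.
  by rewrite NegzE mulrNz mulrN -(expi_period m.+1 (p - _)) subrK.
have [n nE] : exists n : int, q - p = 2 * pi * n%:~R.
  by apply: expi_eq1; rewrite expiD expiN qp expiK.
by exists n => //; rewrite -nE addrC subrK.
Qed.

(** Independence of the decomposition is contained here: every decomposition yields a value of
    [mom], and that value is unique. *)
Lemma untwistedE {V psi u z} : admissible V -> fin_energy V psi u -> mom psi u z ->
  untwisted_momentum psi = [set q | expi q = z].
Proof.
move=> adm fe mz; have [hu _] := fe; apply/seteqP; split=> [q [phi [w [d]]]|q /= qz].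
  rewrite class2piE /= => ->; exact: mom_uniq (mom_of_decomposition hu d) mz.
have [phi [w d]] := fin_energy_decomposition adm fe.
exists phi, w; split => //; rewrite class2piE /= qz.
exact: mom_uniq mz (mom_of_decomposition hu d).
Qed.

End FiniteEnergy.

(** * Small oscillations, reflections and gluing *)

Section Operations.
Context {R : realType}.
Local Notation mu := (@lebesgue_measure R).
Local Notation ig A f := (mu.-integrable A (EFin \o f)).
Local Notation Re := (@complex.Re R).
Local Notation Im := (@complex.Im R).
Implicit Types (F V f g phi J : R -> R) (a b c d s t x y e k p q E : R) (z l : R[i]) (psi u v w : R -> R[i]).

(** acos (cos t) is the distance from t to 2 pi Z, the form in which |P| appears in all energy
    bounds. *)
Lemma acos_cos_le t : acos (cos t) <= `|t|.
Proof.
have [h|h] := leP `|t| pi; first by rewrite -(cos_norm t) cosK// in_itv/= normr_ge0.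
by rewrite (le_trans _ (ltW h))// acos_lepi// cos_geN1 cos_le1.
Qed.

Lemma conjM (z1 z2 : R[i]) : conjc (z1 * z2) = conjc z1 * conjc z2.
Proof. exact: rmorphM. Qed.

(** [mom] with J and the two limits kept visible: gluing requires the two primitives to agree at the
    junction. *)
Definition ends psi u J z1 z2 := [/\ ac J (jdens psi u),
  ccvg -oo (fun x => expi (J x) * psi x) z1 &
  ccvg +oo (fun x => expi (J x) * psi x) z2].

Lemma ends_mom {psi u J z1 z2} : ends psi u J z1 z2 -> mom psi u (z2 * conjc z1).
Proof. by move=> [? ? ?]; exists J, z1, z2. Qed.

Lemma mom_ends {psi u z} : mom psi u z ->
  exists J z1 z2, ends psi u J z1 z2 /\ z = z2 * conjc z1.
Proof. by move=> [J [z1 [z2 [? ? ? ->]]]]; exists J, z1, z2. Qed.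

Lemma ends_shift {psi u J z1 z2} k : ends psi u J z1 z2 ->
  ends psi u (fun x => J x + k) (expi k * z1) (expi k * z2).
Proof.
move=> [aJ c1 c2]; have E x : expi (J x + k) * psi x = expi k * (expi (J x) * psi x).
  by rewrite expiD; ring.
split; first exact: ac_shift_cst.
  under [X in ccvg _ X _]eq_fun do rewrite E; exact: ccvgM (ccvg_cst _) c1.
under [X in ccvg _ X _]eq_fun do rewrite E; exact: ccvgM (ccvg_cst _) c2.
Qed.

Lemma ends_unit {V psi u J z1 z2} : admissible V -> fin_energy V psi u ->
  ends psi u J z1 z2 -> nsq z1 = 1 /\ nsq z2 = 1.
Proof.
move=> adm fe [aJ c1 c2]; have [d1 d2] := nsq_cvg adm fe.
by rewrite (nsq_end (V := V) (u := u) d1 c1) (nsq_end (V := V) (u := u) d2 c2).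
Qed.

(* For psi = rho e^{i phi}, the phase of e^{iJ} psi has derivative
   (1 - rho^2) phi', and AM-GM bounds kap times it by the energy density, which is
   at least rho^2 phi'^2 + (1 - del) (1 - rho^2)^2 / 2. *)
Lemma small_oscillation {V} kap : admissible V -> 0 < kap -> kap ^+ 2 < 2 ->
  exists2 e, 0 < e & forall psi u z, fin_energy V psi u -> mom psi u z ->
    (forall x, `|nsq (psi x) - 1| <= e) -> kap * acos (Re z) <= en V psi u.
Proof.
move=> adm k0 k2; have [cV V1 Vp near _] := adm.
(* kap^2 = 2 - 4 del <= 2 (1 - del)^2: one factor 1 - del pays for V falling below (s - 1)^2 / 2,
   the other for |psi|^2 falling below 1. *)
pose del := (2 - kap ^+ 2) / 4.
have del0 : 0 < del by rewrite divr_gt0// subr_gt0.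
have del1 : del <= 2^-1 by rewrite /del; have := sqr_ge0 kap; lra.
have kdel : kap ^+ 2 <= 2 * (1 - del) * (1 - del).
  have -> : kap ^+ 2 = 2 - 4 * del by rewrite /del; field.
  by have := sqr_ge0 del; rewrite expr2; nra.
have [d0 d00 D] := near del del0 ltac:(lra).
pose e := Num.min (Num.min d0 del) 2^-1.
have e0 : 0 < e by rewrite !lt_min d00 del0/= invr_gt0.
exists e => // psi u z fe mz He.
have [hu iV] := fe; have [J [z1 [z2 [[aJ c1 c2] ->]]]] := mom_ends mz.
have rb x : 1 - del <= nsq (psi x) /\ `|nsq (psi x) - 1| <= d0.
  have := He x; rewrite !le_min => /andP[/andP[h1 h2] _]; split => //.
  by move: h2; rewrite ler_norml => /andP[]; lra.
have r4 x : 4^-1 < nsq (psi x) by have [] := rb x; lra.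
have [phi aphi] := eta_ac hu.
pose U x := Complex (isqrt (nsq (psi x))) 0 * psi x * conjc (expi (phi x)).
have Uc x : U x = U 0.
  have [x0|/ltW x0] := leP x 0; last by apply: (@lifting _ psi u phi 0 x).
  by symmetry; apply: (@lifting _ psi u phi x 0).
pose Q x := J x + phi x.
have aQ : ac Q (fun x => jdens psi u x + eta psi u x) by exact: ac_D.
have qE x : jdens psi u x + eta psi u x = eta psi u x * (1 - nsq (psi x)).
  have n0 : 0 < nsq (psi x) by have := r4 x; have : 0 < 4^-1 :> R by []; lra.
  rewrite /eta max_l; last exact: ltW.
  by field; rewrite gt_eqF.
have pw x : `|jdens psi u x + eta psi u x| <= kap^-1 * edens V psi u x.
  rewrite qE ler_pdivlMl// -[X in X * _](ger0_norm (ltW k0)) -normrM.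
  have n4 := r4 x; have n0 : 0 < nsq (psi x) by have : 0 < 4^-1 :> R by []; lra.
  have [r1 rd] := rb x; have := D _ rd.
  set r := nsq (psi x) in n4 n0 r1 rd *; set et := eta psi u x => Vr.
  have eu : r * et ^+ 2 <= nsq (u x).
    rewrite /et /eta -/r max_l ?(ltW n4)// exprMn sqrrN exprVn.
    rewrite (_ : r * _ = jdens psi u x ^+ 2 / r); last by field; rewrite gt_eqF.
    by rewrite ler_pdivrMr//; exact: jdens_sq.
  (* A quadratic form in et and b, nonnegative because its discriminant kap^2 - 2 r (1 - del) is not
     positive; it is applied with b = r - 1 and b = 1 - r. *)
  have key : forall b, kap * (et * b) <= r * et ^+ 2 + 2^-1 * (1 - del) * b ^+ 2.
    move=> b; rewrite -subr_ge0.
    rewrite (_ : _ - _ = (4 * r)^-1 * ((2 * r * et - kap * b) ^+ 2 +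
       (2 * r * (1 - del) - kap ^+ 2) * b ^+ 2)); last by field; rewrite gt_eqF.
    apply: mulr_ge0; first by rewrite invr_ge0 mulr_ge0// ltW.
    rewrite addr_ge0 ?sqr_ge0// mulr_ge0 ?sqr_ge0// subr_ge0 (le_trans kdel)//.
    by apply: ler_wpM2r; lra.
  rewrite /edens -/r ler_norml; apply/andP; split.
    have := key (r - 1); rewrite (_ : et * (1 - r) = - (et * (r - 1))); last ring.
    by rewrite mulrN; lra.
  by have := key (1 - r); rewrite (_ : (1 - r) ^+ 2 = (r - 1) ^+ 2); [lra|ring].
have iQ : ig setT (fun x => jdens psi u x + eta psi u x).
  apply: (ig_le _ _ (igZ kap^-1 measurableT (edens_ig fe))) => //.
  exact: ac_meas aQ.
have [q1 [q2 [cq1 cq2 qI]]] := ac_lims aQ iQ.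
have XE x : expi (J x) * psi x = Complex (Num.sqrt (nsq (psi x))) 0 * U 0 * expi (Q x).
  have [_ E] := isqrt_nsq (ltW (r4 x)).
  rewrite {1}E -(Uc x) /U /Q expiD.
  set q := Complex (isqrt _) 0 * _; set s := Complex (Num.sqrt _) 0.
  have -> : s * (q * conjc (expi (phi x))) * (expi (J x) * expi (phi x)) =
     expi (J x) * (s * q) * (expi (phi x) * conjc (expi (phi x))) by ring.
  by rewrite expiK mulr1.
have lim (G : set_system R) (FG : ProperFilter G) (q : R) (z' : R[i]) :
    (nsq (psi x) @[x --> G] --> (1 : R)) -> (Q @ G --> q) ->
    ccvg G (fun x => expi (J x) * psi x) z' -> z' = U 0 * expi q.
  move=> cn cQ cz.
  have cs : ccvg G (fun x => Complex (Num.sqrt (nsq (psi x))) 0) 1.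
    split; last exact: cvg_cst.
    rewrite /= -[X in _ --> X]sqrtr1.
    by apply: (cvg_comp _ _ cn); exact: sqrt_continuous.
  apply: (ccvg_uniq cz); under [X in ccvg _ X _]eq_fun do rewrite XE.
  rewrite -[U 0 * _]mul1r mulrA; apply: ccvgM; last exact: ccvg_expi.
  by apply: ccvgM => //; exact: ccvg_cst.
have [n1 n2] := nsq_cvg adm fe.
rewrite (lim _ _ _ _ n1 cq1 c1) (lim _ _ _ _ n2 cq2 c2).
have U1 : U 0 * conjc (U 0) = 1.
  by rewrite mulJ /U !nsqM (_ : nsq _ * nsq (psi 0) = nsq (Complex (isqrt (nsq (psi 0))) 0 * psi 0));
    [rewrite (isqrt_nsq (ltW (r4 0))).1 nsqJ nsq_expi mulr1|rewrite nsqM].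
have -> : U 0 * expi q2 * conjc (U 0 * expi q1) = (U 0 * conjc (U 0)) * (expi q2 * conjc (expi q1)).
  by rewrite conjM; ring.
rewrite U1 mul1r -expiN -expiD Re_expi qI.
rewrite -ler_pdivlMl//; apply: (le_trans (acos_cos_le _)).
apply: (le_trans (I_norm _ iQ)) => //; rewrite -I_Z//; last exact: edens_ig.
by apply: I_le => //; [exact: ig_norm|apply: igZ => //; exact: edens_ig].
Qed.

(** Reflection alone reverses the sign of <i psi', psi>; together with conjugation the density is
    merely reflected, and the momentum is kept. The unit number l serves to match the values at the
    centre. *)
Definition creflect l c psi x : R[i] := l * conjc (psi (c - x)).
Definition dcreflect l c u x : R[i] := - (l * conjc (u (c - x))).

Lemma has_deriv_reflect {psi u} l c : has_deriv psi u ->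
  has_deriv (creflect l c psi) (dcreflect l c u).
Proof.
move=> h; have [h1 h2 s1 s2] := h; have [m1 m2] := has_deriv_meas h.
have r1 := ac_refl c h1; have r2 := ac_refl c h2.
have pre (q : R -> R) : ig setT q -> ig setT (fun x => q (c - x)).
  by move=> qi; have := mp_ig (mp_refl c) measurableT qi; rewrite preimage_setT.
have mm (q : R -> R) : measurable_fun setT q -> measurable_fun setT (fun x => q (c - x)).
  by move=> mq; apply: (measurableT_comp mq); case: (mp_refl c).
have t1 := pre _ s1; have t2 := pre _ s2; have n1 := mm _ m1; have n2 := mm _ m2.
split.
- apply: (ac_ext (ac_D (ac_Z (Re l) r1) (ac_Z (Im l) r2))) => x.
    by rewrite /creflect/= !C_simp; ring.
  by rewrite /dcreflect/= !C_simp; ring.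
- apply: (ac_ext (ac_B (ac_Z (Im l) r1) (ac_Z (Re l) r2))) => x.
    by rewrite /creflect/= !C_simp; ring.
  by rewrite /dcreflect/= !C_simp; ring.
- apply: (@ig_ext _ _ (fun x => (Re l * Re (u (c - x)) + Im l * Im (u (c - x))) ^+ 2)) => //.
    by move=> x _; rewrite /dcreflect !C_simp; ring.
  by apply: sq_D => //; [exact: measurable_funM|exact: measurable_funM|exact: sq_Z|exact: sq_Z].
- apply: (@ig_ext _ _ (fun x => (Im l * Re (u (c - x)) - Re l * Im (u (c - x))) ^+ 2)) => //.
    by move=> x _; rewrite /dcreflect !C_simp; ring.
  by apply: sq_B => //; [exact: measurable_funM|exact: measurable_funM|exact: sq_Z|exact: sq_Z].
Qed.

Lemma edens_reflect V psi u l c x : nsq l = 1 ->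
  edens V (creflect l c psi) (dcreflect l c u) x = edens V psi u (c - x).
Proof.
move=> l1; rewrite /edens /creflect /dcreflect nsqM l1 mul1r nsqJ.
have nsqN z : nsq (- z) = nsq z by rewrite /nsq !C_simp !sqrrN.
by rewrite nsqN nsqM l1 mul1r nsqJ.
Qed.

Lemma fin_energy_reflect {V psi u} l c : nsq l = 1 -> fin_energy V psi u ->
  fin_energy V (creflect l c psi) (dcreflect l c u).
Proof.
move=> l1 [h hV]; split; first exact: has_deriv_reflect.
have := mp_ig (mp_refl c) measurableT hV; rewrite preimage_setT.
by apply: ig_ext => // x _; rewrite /creflect nsqM l1 mul1r nsqJ.
Qed.

Lemma ends_reflect {psi u J z1 z2} l c : nsq l = 1 -> ends psi u J z1 z2 ->
  ends (creflect l c psi) (dcreflect l c u) (fun x => - J (c - x))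
    (l * conjc z2) (l * conjc z1).
Proof.
move=> l1 [aJ c1 c2]; have aJ' := ac_N (ac_refl c aJ).
have E x : expi (- J (c - x)) * creflect l c psi x = l * conjc (expi (J (c - x)) * psi (c - x)).
  rewrite /creflect conjM expiN; ring.
have l1' : Re l ^+ 2 + Im l ^+ 2 = 1 by exact: l1.
split.
- apply: (ac_ext aJ') => // x; rewrite opprK /jdens /creflect /dcreflect !C_simp.
  rewrite -[LHS]mul1r -l1'; ring.
- under [X in ccvg _ X _]eq_fun do rewrite E; apply: ccvgM; first exact: ccvg_cst.
  apply: ccvgJ; case: c2 => /cvgyP c2 /cvgyP c2'; split; apply/cvgNyP => e e0.
    have [A HA] := c2 e e0; exists (c - A) => x xA; apply: HA; lra.
  have [A HA] := c2' e e0; exists (c - A) => x xA; apply: HA; lra.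
- under [X in ccvg _ X _]eq_fun do rewrite E; apply: ccvgM; first exact: ccvg_cst.
  apply: ccvgJ; case: c1 => /cvgNyP c1 /cvgNyP c1'; split; apply/cvgyP => e e0.
    have [A HA] := c1 e e0; exists (c - A) => x xA; apply: HA; lra.
  have [A HA] := c1' e e0; exists (c - A) => x xA; apply: HA; lra.
Qed.

Definition cglue c psi1 psi2 x : R[i] := if x <= c then psi1 x else psi2 x.

Lemma has_deriv_glue {psi1 u1 psi2 u2} c : has_deriv psi1 u1 -> has_deriv psi2 u2 ->
  psi1 c = psi2 c -> has_deriv (cglue c psi1 psi2) (cglue c u1 u2).
Proof.
move=> [h1 h2 s1 s2] [k1 k2 t1 t2] E.
have gl (q1 q2 : R -> R) : measurable_fun setT q1 -> measurable_fun setT q2 ->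
    ig setT (fun x => q1 x ^+ 2) -> ig setT (fun x => q2 x ^+ 2) ->
    ig setT (fun x => (if x <= c then q1 x else q2 x) ^+ 2).
  move=> m1 m2 i1 i2; apply: (ig_le _ _ (igD measurableT i1 i2)) => //.
    apply: measurable_funX; apply: measurable_fun_ifT => //.
    exact: measurable_fun_ler.
  move=> x _; rewrite ger0_norm ?sqr_ge0//.
  by case: ifP => _; rewrite ?lerDl ?lerDr sqr_ge0.
split.
- have e1 : Re (psi1 c) = Re (psi2 c) by rewrite E.
  apply: (ac_ext (ac_glue c h1 k1 e1)) => x /=.
    by rewrite /cglue; case: (x <= c).
  by rewrite /cglue; case: (x <= c).
- have e2 : Im (psi1 c) = Im (psi2 c) by rewrite E.
  apply: (ac_ext (ac_glue c h2 k2 e2)) => x /=.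
    by rewrite /cglue; case: (x <= c).
  by rewrite /cglue; case: (x <= c).
- apply: (ig_ext _ _ (gl _ _ (ac_meas h1) (ac_meas k1) s1 t1)) => // x _.
  by rewrite /cglue; case: (x <= c).
- apply: (ig_ext _ _ (gl _ _ (ac_meas h2) (ac_meas k2) s2 t2)) => // x _.
  by rewrite /cglue; case: (x <= c).
Qed.

Lemma fin_energy_glue {V psi1 u1 psi2 u2} c : admissible V -> fin_energy V psi1 u1 ->
  fin_energy V psi2 u2 -> psi1 c = psi2 c -> fin_energy V (cglue c psi1 psi2) (cglue c u1 u2).
Proof.
move=> adm [h1 i1] [h2 i2] E; have h := has_deriv_glue c h1 h2 E; split => //.
have [cV _ _ _ _] := adm.
apply: (ig_le _ _ (igD measurableT i1 i2)) => //.
  by apply: cont_meas => x; apply: (@continuous_comp _ _ _ (fun x => nsq (cglue c psi1 psi2 x)) V);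
    [exact: (nsq_cont h)|exact: cV].
have v0 z : 0 <= V (nsq z) by apply: (admissible_ge0 adm); exact: nsq_ge0.
by move=> x _; rewrite ger0_norm// /cglue; case: ifP => _; rewrite ?lerDl ?lerDr.
Qed.

Definition enL V psi u c := \int[mu]_(x in `]-oo, c]) edens V psi u x.
Definition enR V psi u c := \int[mu]_(x in `[c, +oo[) edens V psi u x.

Lemma enLR {V psi u} c : fin_energy V psi u -> en V psi u = enL V psi u c + enR V psi u c.
Proof.
move=> fe; have i := edens_ig fe.
have E : setT = ([set` `]-oo, c]] : set (measurableTypeR R)) `|` [set` `]c, +oo[].
  apply/seteqP; split => // x _ /=; rewrite !in_itv/= andbT.
  by case: (leP x c) => _; [left|right].
rewrite /en {1}E I_setU//.
- rewrite /enR -Rintegral_itv_obnd_cbnd//; exact: igS i.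
- by rewrite -E.
- apply/disj_setPS => x [] /=; rewrite !in_itv/= andbT => xc cx.
  by move: (le_lt_trans xc cx); rewrite ltxx.
Qed.

Lemma en_glue {V psi1 u1 psi2 u2} c : admissible V -> fin_energy V psi1 u1 ->
  fin_energy V psi2 u2 -> psi1 c = psi2 c ->
  en V (cglue c psi1 psi2) (cglue c u1 u2) = enL V psi1 u1 c + enR V psi2 u2 c.
Proof.
move=> adm f1 f2 E; rewrite (enLR c (fin_energy_glue c adm f1 f2 E)); congr (_ + _).
  apply: I_ext => x /=; rewrite in_itv/= => xc.
  by rewrite /edens /cglue xc.
rewrite /enR -[LHS]Rintegral_itv_obnd_cbnd; last first.
  by apply: (igS _ _ _ (edens_ig (fin_energy_glue c adm f1 f2 E))).
rewrite -[RHS]Rintegral_itv_obnd_cbnd; last by apply: (igS _ _ _ (edens_ig f2)).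
apply: I_ext => x /=; rewrite in_itv/= andbT => cx.
by rewrite /edens /cglue leNgt cx.
Qed.

Lemma en_reflect {V psi u} l c : nsq l = 1 -> fin_energy V psi u ->
  enL V (creflect l (2 * c) psi) (dcreflect l (2 * c) u) c = enR V psi u c /\
  enR V (creflect l (2 * c) psi) (dcreflect l (2 * c) u) c = enL V psi u c.
Proof.
move=> l1 fe; have m := ig_meas measurableT (edens_ig fe).
split; rewrite /enL /enR.
  rewrite -(mp_integral (mp_refl (2 * c)) (A := [set` `[c, +oo[])) //; last exact: measurable_funTS.
  rewrite (_ : _ @^-1` _ = [set` `]-oo, c]]); last first.
    by apply/seteqP; split => x /=; rewrite !in_itv/= ?andbT; lra.
  by apply: I_ext => x _; rewrite edens_reflect.
rewrite -(mp_integral (mp_refl (2 * c)) (A := [set` `]-oo, c]])) //; last exact: measurable_funTS.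
rewrite (_ : _ @^-1` _ = [set` `[c, +oo[]); last first.
  by apply/seteqP; split => x /=; rewrite !in_itv/= ?andbT; lra.
by apply: I_ext => x _; rewrite edens_reflect.
Qed.

Lemma ends_glue {psi1 u1 psi2 u2 J1 J2 z1 z2 z1' z2'} c :
  ends psi1 u1 J1 z1 z1' -> ends psi2 u2 J2 z2' z2 -> J1 c = J2 c -> psi1 c = psi2 c ->
  ends (cglue c psi1 psi2) (cglue c u1 u2) (fun x => if x <= c then J1 x else J2 x) z1 z2.
Proof.
move=> [a1 c1 _] [a2 _ c2] EJ Ep; split.
- apply: (ac_ext (ac_glue c a1 a2 EJ)) => // x; rewrite /jdens /cglue; by case: (x <= c).
- case: c1 => /cvgNyP c1 /cvgNyP c1'; split; apply/cvgNyP => e e0.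
    have [A HA] := c1 e e0; exists (Num.min A c) => x; rewrite le_min => /andP[xA xc].
    by rewrite /cglue xc; exact: HA.
  have [A HA] := c1' e e0; exists (Num.min A c) => x; rewrite le_min => /andP[xA xc].
  by rewrite /cglue xc; exact: HA.
- case: c2 => /cvgyP c2 /cvgyP c2'; split; apply/cvgyP => e e0.
    have [A HA] := c2 e e0; exists (Num.max A (c + 1)) => x; rewrite ge_max => /andP[xA xc].
    rewrite /cglue; have -> : (x <= c) = false by apply/negbTE; rewrite -ltNge; lra.
    exact: HA.
  have [A HA] := c2' e e0; exists (Num.max A (c + 1)) => x; rewrite ge_max => /andP[xA xc].
  rewrite /cglue; have -> : (x <= c) = false by apply/negbTE; rewrite -ltNge; lra.
    exact: HA.
Qed.

Lemma IVT_line {f p q} : continuous f -> (f x @[x --> -oo] --> p) ->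
  (f x @[x --> +oo] --> q) -> 0 < p -> q < 0 -> exists c, f c = 0.
Proof.
move=> cf /cvgNyP cp /cvgyP cq p0 q0.
have [A HA] := cp (p / 2) ltac:(lra); have [B HB] := cq (- q / 2) ltac:(lra).
pose a := Num.min A B; have aA : a <= A by rewrite ge_min lexx.
have aB : a <= B by rewrite ge_min lexx orbT.
have fa : 0 < f a by have := HA a aA; rewrite ler_norml => /andP[]; lra.
have fb : f B < 0 by have := HB B (lexx _); rewrite ler_norml => /andP[]; lra.
have [|c _ fc] := @IVT R f a B 0 aB (continuous_subspaceT cf); last by exists c.
by rewrite ge_min le_max (ltW fa) (ltW fb) orbT.
Qed.

(* Reflecting either half of psi at c gives two functions.  Their phases are
   swept continuously from 0 to 2q as c varies; instead of lifting them, the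
   right c is found as the point where [w1 conj(X(c))] crosses a line through 0. *)
Lemma reflection_split {V psi u q d} : admissible V -> fin_energy V psi u ->
  mom psi u (expi q) -> 0 < q - d -> q - d < 2 * pi -> 0 < q + d -> q + d < 2 * pi ->
  exists psi1 u1 psi2 u2, [/\ fin_energy V psi1 u1 /\ fin_energy V psi2 u2,
    mom psi1 u1 (expi (q - d)), mom psi2 u2 (expi (q + d)) &
    en V psi1 u1 + en V psi2 u2 = 2 * en V psi u].
Proof.
move=> adm fe mz qd1 qd2 qd3 qd4.
have [J0 [w1 [w2 [e0 zE]]]] := mom_ends mz; have [aJ c1 c2] := e0.
have [nw1 nw2] := ends_unit adm fe e0; have [hu _] := fe.
(* A reflected copy doubles the phase measured from w1, so momentum q - d asks for the phase (q -
   d)/2 modulo pi at the junction, that is h(c) = 0. Only a line through 0 is involved, so psi(c) =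
   0 is harmless. *)
pose th := expi ((q - d) / 2) : R[i].
pose h x := Im (th * w1 * conjc (expi (J0 x) * psi x)).
have ch : continuous h.
  have [p1 p2] := has_deriv_cont hu.
  have k1 := ac_cont (ac_cos aJ); have k2 := ac_cont (ac_sin aJ).
  move=> x; have cX : ccvg (nbhs x) (fun y => expi (J0 y) * psi y) (expi (J0 x) * psi x).
    by apply: ccvgM; split; [exact: k1|exact: k2|exact: p1|exact: p2].
  exact: (ccvgM (ccvg_cst (th * w1)) (ccvgJ cX)).2.
have l1 : h x @[x --> -oo] --> sin ((q - d) / 2).
  have := (ccvgM (ccvg_cst (th * w1)) (ccvgJ c1)).2.
  have -> : th * w1 * conjc w1 = th by rewrite -mulrA (unitJ _ nw1) mulr1.
  by rewrite Im_expi; apply.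
have l2 : h x @[x --> +oo] --> - sin ((q + d) / 2).
  have := (ccvgM (ccvg_cst (th * w1)) (ccvgJ c2)).2.
  have -> : th * w1 * conjc w2 = expi (- ((q + d) / 2)).
    have -> : th * w1 * conjc w2 = th * conjc (w2 * conjc w1) by rewrite conjM conjcK; ring.
    by rewrite -zE -expiN -expiD; congr expi; field.
  by rewrite Im_expi sinN; apply.
(* The opposite signs at the two ends come from (q - d)/2 and (q + d)/2 lying in ]0, pi[. *)
have [c hc] : exists c, h c = 0.
  apply: (IVT_line ch l1 l2); first by apply: sin_gt0_pi; lra.
  by rewrite oppr_lt0; apply: sin_gt0_pi; lra.
(* Reflection about c replaces J(c) by -J(c); the normalisation J(c) = 0 makes the primitives
   match. *)
pose k := - J0 c; have ek := ends_shift k e0.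
pose om := expi k * w1; pose xi := expi k * w2.
(* The first glued function has momentum l conj(om)^2, which must be e^{i(q - d)}. The reality of K
   below then gives l conj(psi c) = psi c, so the values match as well. *)
pose l := expi (q - d) * (om * om).
have nom : nsq om = 1 by rewrite nsqM nsq_expi nw1 mulr1.
have nl : nsq l = 1 by rewrite /l nsqM (nsqM om) nsq_expi nom !mulr1.
have omJ := unitJ _ nom.
pose K := th * om * conjc (psi c).
have KE : K = th * w1 * conjc (expi (J0 c) * psi c).
  by rewrite /K /om /k expiN conjM; ring.
have Kr : conjc K = K.
  apply: C_eq; first by rewrite Re_J.
  by rewrite Im_J KE; rewrite /h in hc; rewrite hc oppr0.
have th2 : th * th = expi (q - d) by rewrite -expiD; congr expi; field.
have lp : l * conjc (psi c) = psi c.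
  have -> : l * conjc (psi c) = th * om * K by rewrite /l -th2 /K; ring.
  have -> : K = conjc th * conjc om * psi c by rewrite -Kr /K 2!conjM conjcK.
  have -> : th * om * (conjc th * conjc om * psi c) = (th * conjc th) * (om * conjc om) * psi c by ring.
  by rewrite omJ expiK !mul1r.
pose psiT := creflect l (2 * c) psi; pose uT := dcreflect l (2 * c) u.
have feT : fin_energy V psiT uT by exact: fin_energy_reflect.
have psiTc : psiT c = psi c.
  by rewrite /psiT /creflect (_ : 2 * c - c = c) ?lp//; ring.
have eT := ends_reflect l (2 * c) nl ek; rewrite -/psiT -/uT -/om -/xi in eT.
have Jc : J0 c + k = 0 by rewrite /k subrr.
have JcT : - (J0 (2 * c - c) + k) = 0.
  by rewrite (_ : 2 * c - c = c) ?Jc ?oppr0//; ring.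
exists (cglue c psi psiT), (cglue c u uT), (cglue c psiT psi), (cglue c uT u).
have [eL eR] := en_reflect l c nl fe.
split.
- by split; apply: fin_energy_glue.
- have := ends_mom (ends_glue c ek eT _ _); rewrite Jc JcT psiTc => /(_ erefl erefl).
  have -> : l * conjc om * conjc (expi k * w1) = expi (q - d).
    rewrite -/om /l.
    have -> : expi (q - d) * (om * om) * conjc om * conjc om =
      expi (q - d) * (om * conjc om) * (om * conjc om) by ring.
    by rewrite omJ !mulr1.
  by [].
- have := ends_mom (ends_glue c eT ek _ _); rewrite Jc JcT psiTc => /(_ erefl erefl).
  have -> : expi k * w2 * conjc (l * conjc (expi k * w2)) = expi (q + d).
    rewrite -/xi /l (conjM (expi (q - d) * (om * om))) (conjM (expi (q - d))) (conjM om) conjcK.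
    have -> : xi * (conjc (expi (q - d)) * (conjc om * conjc om) * xi) =
      conjc (expi (q - d)) * ((xi * conjc om) * (xi * conjc om)) by ring.
    have -> : xi * conjc om = expi q.
      rewrite zE /xi /om conjM.
      have -> : expi k * w2 * (conjc (expi k) * conjc w1) = (expi k * conjc (expi k)) * (w2 * conjc w1) by ring.
      by rewrite expiK mul1r.
    by rewrite -expiN -!expiD; congr expi; ring.
  by [].
rewrite !en_glue// eL eR (enLR c fe); ring.
Qed.

End Operations.

(** * Symmetries of the energy, angles on the circle, and caps *)

Section Minimization.
Context {R : realType}.
Local Notation mu := (@lebesgue_measure R).
Local Notation ig A f := (mu.-integrable A (EFin \o f)).
Local Notation Re := (@complex.Re R).
Local Notation Im := (@complex.Im R).
Implicit Types (F V f g phi J : R -> R) (a b c d s t x y k m p q r e E : R) (z l : R[i]) (psi u v w : R -> R[i]).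

Definition cconj psi x : R[i] := conjc (psi x).

Lemma has_deriv_conj {psi u} : has_deriv psi u -> has_deriv (cconj psi) (cconj u).
Proof.
move=> [h1 h2 s1 s2]; split.
- by apply: (ac_ext h1) => x; rewrite /= /cconj Re_J.
- by apply: (ac_ext (ac_N h2)) => x; rewrite /= /cconj Im_J.
- by apply: (ig_ext _ _ s1) => // x _; rewrite /cconj Re_J.
- by apply: (ig_ext _ _ s2) => // x _; rewrite /cconj Im_J sqrrN.
Qed.

Lemma fin_energy_conj {V psi u} : fin_energy V psi u -> fin_energy V (cconj psi) (cconj u).
Proof.
move=> [h i]; split; first exact: has_deriv_conj.
by apply: (ig_ext _ _ i) => // x _; rewrite /cconj nsqJ.
Qed.

Lemma en_conj V psi u : en V (cconj psi) (cconj u) = en V psi u.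
Proof. by apply: I_ext => x _; rewrite /edens /cconj !nsqJ. Qed.

Lemma mom_conj {psi u z} : mom psi u z -> mom (cconj psi) (cconj u) (conjc z).
Proof.
move=> [J [w1 [w2 [aJ c1 c2 ->]]]]; exists (fun x => - J x), (conjc w1), (conjc w2).
have E x : expi (- J x) * cconj psi x = conjc (expi (J x) * psi x).
  by rewrite expiN conjM.
split; last by rewrite conjM.
- apply: (ac_ext (ac_N aJ)) => // x; rewrite /jdens /cconj !C_simp; ring.
- by under [X in ccvg _ X _]eq_fun do rewrite E; exact: ccvgJ.
- by under [X in ccvg _ X _]eq_fun do rewrite E; exact: ccvgJ.
Qed.

Definition ctrans c psi x : R[i] := psi (x + c).

Lemma has_deriv_trans {psi u} c : has_deriv psi u -> has_deriv (ctrans c psi) (ctrans c u).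
Proof.
have pre (q : R -> R) : ig setT q -> ig setT (fun x => q (x + c)).
  by move=> qi; have := mp_ig (mp_shift c) measurableT qi; rewrite preimage_setT.
move=> [h1 h2 s1 s2]; split; [exact: (ac_shift c h1)|exact: (ac_shift c h2)| |].
  exact: (pre _ s1).
exact: (pre _ s2).
Qed.

Lemma fin_energy_trans {V psi u} c : fin_energy V psi u ->
  fin_energy V (ctrans c psi) (ctrans c u).
Proof.
move=> [h i]; split; first exact: has_deriv_trans.
by have := mp_ig (mp_shift c) measurableT i; rewrite preimage_setT.
Qed.

Lemma en_trans {V psi u} c : fin_energy V psi u ->
  en V (ctrans c psi) (ctrans c u) = en V psi u.
Proof.
move=> fe; have m := ig_meas measurableT (edens_ig fe).
by rewrite /en -[RHS](mp_integral (mp_shift c)).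
Qed.

Lemma mom_trans {psi u z} c : mom psi u z -> mom (ctrans c psi) (ctrans c u) z.
Proof.
move=> [J [w1 [w2 [aJ [/cvgNyP c1 /cvgNyP c1'] [/cvgyP c2 /cvgyP c2'] ->]]]].
exists (fun x => J (x + c)), w1, w2; split => //; first exact: (ac_shift c aJ).
- split; apply/cvgNyP => e e0.
    by have [A HA] := c1 e e0; exists (A - c) => x xA; apply: HA; lra.
  by have [A HA] := c1' e e0; exists (A - c) => x xA; apply: HA; lra.
- split; apply/cvgyP => e e0.
    by have [A HA] := c2 e e0; exists (A - c) => x xA; apply: HA; lra.
  by have [A HA] := c2' e e0; exists (A - c) => x xA; apply: HA; lra.
Qed.

Lemma acos_le {s t} : -1 <= s -> s <= t -> t <= 1 -> acos t <= acos s.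
Proof.
move=> s1 st t1; rewrite leNgt; apply/negP => h.
have i1 : -1 <= s <= 1 by rewrite s1 (le_trans st).
have i2 : -1 <= t <= 1 by rewrite t1 (le_trans s1).
have : cos (acos t) < cos (acos s).
  by rewrite ltr_cos ?in_itv/= ?acos_ge0 ?acos_lepi.
by rewrite !acosK ?in_itv//= ltNge st.
Qed.

Lemma unit_Re {z} : nsq z = 1 -> -1 <= Re z <= 1.
Proof. by move=> z1; rewrite -ler_norml; apply: abs_Re_le; rewrite ?z1 ?expr1n. Qed.

Lemma unit_expi {z} : nsq z = 1 -> z = expi (acos (Re z)) \/ conjc z = expi (acos (Re z)).
Proof.
move=> z1; have r := unit_Re z1.
have c : cos (acos (Re z)) = Re z by rewrite acosK// in_itv.
have : (Im z - sin (acos (Re z))) * (Im z + sin (acos (Re z))) = 0.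
  have := cos2Dsin2 (acos (Re z)); rewrite c => h; move: z1; rewrite /nsq -h => /addrI h'.
  by rewrite -subr_sqr h' subrr.
move=> /eqP; rewrite mulf_eq0 subr_eq0 addr_eq0 => /orP[/eqP h|/eqP h]; [left|right].
  by apply: C_eq; rewrite ?Re_expi ?Im_expi ?c.
by apply: C_eq; rewrite ?Re_J ?Im_J ?Re_expi ?Im_expi ?c ?h ?opprK.
Qed.

(** The triangle inequality on the circle. It is trivial when a + b > pi; otherwise cosines are
    compared, using that Im z1 Im z2 is at most sin a sin b. *)
Lemma acos_subadd {z1 z2 : R[i]} : nsq z1 = 1 -> nsq z2 = 1 ->
  acos (Re (z1 * z2)) <= acos (Re z1) + acos (Re z2).
Proof.
move=> h1 h2; have h : nsq (z1 * z2) = 1 by rewrite nsqM h1 h2 mulr1.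
have r1 := unit_Re h1; have r2 := unit_Re h2; have r := unit_Re h.
have a1 := acos_ge0 r1; have a2 := acos_ge0 r2.
set a := acos (Re z1) in a1 *; set b := acos (Re z2) in a2 *.
have [abp|/ltW abp] := leP (a + b) pi; last exact: le_trans (acos_lepi r) abp.
have s1 : 0 <= sin a by rewrite sin_ge0_pi// a1 acos_lepi.
have s2 : 0 <= sin b by rewrite sin_ge0_pi// a2 acos_lepi.
have E1 : Im z1 = sin a \/ Im z1 = - sin a.
  have [->|E] := unit_expi h1; first by left; rewrite Im_expi.
  by right; rewrite -Im_expi -E Im_J opprK.
have E2 : Im z2 = sin b \/ Im z2 = - sin b.
  have [->|E] := unit_expi h2; first by left; rewrite Im_expi.
  by right; rewrite -Im_expi -E Im_J opprK.
have c1 : cos a = Re z1 by rewrite acosK// in_itv.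
have c2 : cos b = Re z2 by rewrite acosK// in_itv.
have : cos (a + b) <= Re (z1 * z2).
  rewrite cosD c1 c2 C_simp lerD2l lerN2.
  have s12 : 0 <= sin a * sin b by exact: mulr_ge0.
  by case: E1 => ->; case: E2 => ->; nra.
move=> le; rewrite -[leRHS]cosK; last by rewrite in_itv/= addr_ge0.
by apply: acos_le => //; [exact: cos_geN1|case/andP: r].
Qed.

Lemma ig_patch {a b f} : ig `[a, b] f -> ig setT (f \_ `[a, b]).
Proof.
have := (@integrable_mkcond _ _ R mu `[a, b] (EFin \o f) _).1.
by rewrite -restrict_EFin; apply.
Qed.

(** The cap is the real profile 1 + (r - 1) T, with T a tent of width 2 centred at c, times the
    constant l. Its phase being constant, <i psi', psi> = 0 and it carries no momentum. *)
Lemma cap_exists {V} e : admissible V -> 0 < e -> exists2 d : R, 0 < d & forall r l c,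
  nsq l = 1 -> `|r - 1| <= d -> exists psi u, [/\ fin_energy V psi u, en V psi u <= e,
    psi c = Complex r 0 * l & ends psi u (fun=> 0) l l].
Proof.
move=> adm e0; have [cV V1 _ _ _] := adm.
have /cvgrPdist_le /(_ (e / 4) ltac:(lra)) := cV 1; rewrite V1.
move=> /nbhs_ballP[d0 /= d00 D0].
(* d <= d0/4 keeps the squared profile within d0 of 1, so V <= e/4; d <= 1 and d <= e/4 give (r -
   1)^2 <= e/4. The support has length 2, whence energy at most 2 (e/2). *)
pose d := Num.min (Num.min 1 (d0 / 4)) (e / 4).
have d1 : d <= 1 by rewrite /d !ge_min lexx.
have dd : d <= d0 / 4 by rewrite /d !ge_min lexx orbT.
have de : d <= e / 4 by rewrite /d !ge_min lexx orbT.
exists d; first by rewrite /d !lt_min; lra.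
move=> r l c l1 rd.
(* A difference of two clamped identities, one for each flank of the tent. *)
pose T x := Num.max (c - 1) (Num.min x c) - Num.max c (Num.min x (c + 1)) + 1.
pose dT x := (((fun _ : R => 1 : R) \_ `[c - 1, c]) x - ((fun _ : R => 1 : R) \_ `[c, c + 1]) x).
have aT : ac T dT.
  have c1 : c - 1 <= c by lra.
  have c2 : c <= c + 1 by lra.
  exact: (ac_shift_cst 1 (ac_B (ac_clamp c1 ac_id) (ac_clamp c2 ac_id))).
have TE x : if x <= c then T x = Num.max (c - 1) x - c + 1 else T x = c - Num.min x (c + 1) + 1.
  case: (leP x c) => h; rewrite /T.
    by rewrite (min_l h) (@min_l _ _ x (c + 1)) ?(max_l h)//; lra.
  rewrite (min_r (ltW h)) (@max_r _ _ (c - 1) c); last lra.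
  by rewrite max_r// le_min (ltW h)/=; lra.
have T0 x : 0 <= T x <= 1.
  move: (TE x); case: (leP x c) => h1.
    by case: (leP (c - 1) x) => h2 ->; apply/andP; split; lra.
  by case: (leP x (c + 1)) => h2 ->; apply/andP; split; lra.
have Tc : T c = 1.
  by move: (TE c); rewrite lexx => ->; rewrite max_r; lra.
have Tout x : ~~ (c - 1 <= x <= c + 1) -> T x = 0.
  rewrite negb_and -!ltNge => h; move: h (TE x); case: (leP x c) => h1 => [/orP h|/orP h].
    by rewrite max_l => [->|]; [ring|case: h; lra].
  by rewrite min_r => [->|]; [ring|case: h; lra].
have dT1 x : `|dT x| <= 1.
  by rewrite /dT !patchE; do 2 case: ifP => _; rewrite ?subrr ?subr0 ?sub0r ?normrN ?normr0 ?normr1.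
have dTout x : ~~ (c - 1 <= x <= c + 1) -> dT x = 0.
  move=> h; rewrite /dT !patchE !ifF ?subrr//; apply/negbTE; apply: contra h;
    rewrite inE /= in_itv/= => /andP[]; lra.
clearbody T dT.
pose rr x := 1 + (r - 1) * T x.
pose psi x := Complex (rr x) 0 * l; pose u x := Complex ((r - 1) * dT x) 0 * l.
have np x : nsq (psi x) = rr x ^+ 2.
  by rewrite /psi nsqM l1 mulr1 /nsq/= expr0n addr0.
have nu x : nsq (u x) = (r - 1) ^+ 2 * dT x ^+ 2.
  by rewrite /u nsqM l1 mulr1 /nsq/= expr0n addr0 exprMn.
have rT x : `|(r - 1) * T x| <= d.
  have /andP[t0 t1] := T0 x; rewrite normrM (ger0_norm t0).
  by apply: le_trans rd; rewrite ler_piMr.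
have Vr x : V (nsq (psi x)) <= e / 4.
  have := D0 (nsq (psi x)); rewrite /ball/= np => H.
  have h := rT x; have : `|1 - rr x ^+ 2| < d0.
    rewrite (_ : 1 - _ = - (((r - 1) * T x) * (2 + (r - 1) * T x))); last by rewrite /rr; ring.
    rewrite normrN normrM; apply: (@le_lt_trans _ _ (d * 3)); last by lra.
    apply: ler_pM => //; apply: (le_trans (ler_normD _ _)).
    by rewrite ger0_norm//; lra.
  by move=> /H; rewrite sub0r normrN => /(le_trans (ler_norm _)).
have dd0 : 0 <= d by exact: le_trans rd.
have ur x : nsq (u x) <= e / 4.
  rewrite nu; apply: (@le_trans _ _ (d * 1)); last by rewrite mulr1.
  apply: ler_pM; rewrite ?sqr_ge0//.
    rewrite -real_normK ?num_real// expr2 -[leRHS]mulr1.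
    by apply: ler_pM => //; exact: le_trans rd d1.
  by rewrite -real_normK ?num_real// expr_le1.
pose B : set (measurableTypeR R) := [set` `[c - 1, c + 1]].
have out x : x \notin B -> nsq (u x) = 0 /\ V (nsq (psi x)) = 0.
  rewrite notin_setE /B/= in_itv/= => /negP h.
  by rewrite nu np /rr Tout// dTout// expr0n/= !mulr0 addr0 expr1n V1.
have aR : ac (fun x => rr x) (fun x => (r - 1) * dT x).
  by apply: (ac_ext (ac_shift_cst 1 (ac_Z (r - 1) aT))) => // x; rewrite addrC.
have mdT : measurable_fun setT dT := ac_meas aT.
have sdT k : ig setT (fun x => (k * dT x) ^+ 2).
  apply: (ig_le _ _ (ig_patch (a := c - 1) (b := c + 1) (f := fun=> k ^+ 2) _)) => //.
  - by apply: measurable_funX; exact: measurable_funM.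
  - by apply: ig_cont => x; exact: cvg_cst.
  move=> x _; rewrite patchE ger0_norm ?sqr_ge0// exprMn; case: ifPn => h.
    rewrite ler_piMr ?sqr_ge0// -real_normK ?num_real// expr_le1//.
  rewrite dTout ?expr0n ?mulr0//; apply: contra h => h; by rewrite inE/= in_itv.
have hd : has_deriv psi u.
  split.
  - by apply: (ac_ext (ac_Z (Re l) aR)) => x; rewrite /= /psi /u !C_simp/=; ring.
  - by apply: (ac_ext (ac_Z (Im l) aR)) => x; rewrite /= /psi /u !C_simp/=; ring.
  - apply: (ig_ext _ _ (sdT ((r - 1) * Re l))) => // x _.
    by rewrite /u !C_simp/=; ring.
  - apply: (ig_ext _ _ (sdT ((r - 1) * Im l))) => // x _.
    by rewrite /u !C_simp/=; ring.
have mV : continuous (fun x => V (nsq (psi x))).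
  by move=> x; apply: (@continuous_comp _ _ _ (fun x => nsq (psi x)) V);
    [exact: (nsq_cont hd)|exact: cV].
have fe : fin_energy V psi u.
  split => //; apply: (ig_ext _ _ (ig_patch (a := c - 1) (b := c + 1) (ig_cont mV))) => // x _.
  by rewrite patchE; case: ifPn => // /out[].
exists psi, u; split => //.
- rewrite /en (_ : \int[mu]_x _ = \int[mu]_(x in B) edens V psi u x); last first.
    rewrite [RHS]Rintegral_mkcond; apply: eq_Rintegral => x _; rewrite patchE; case: ifPn => // /out[].
    by rewrite /edens => -> ->; rewrite addr0.
  apply: (@le_trans _ _ (\int[mu]_(x in B) (e / 2))).
    rewrite /B; apply: I_le => //; [exact: itv1_ig|by apply: ig_cont => x; exact: cvg_cst|].
    by move=> x _; have := Vr x; have := ur x; rewrite /edens; lra.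
  rewrite I_cst; lra.
- by rewrite /psi /rr Tc mulr1 addrC subrK.
split.
- apply: (ac_ext (ac_cst 0)) => // x; rewrite /jdens /psi /u !C_simp/=; ring.
- have E x : x <= c - 2 -> expi 0 * psi x = l.
    move=> h; rewrite /psi /rr Tout ?mulr0 ?addr0 ?expi0 ?mul1r//.
    by rewrite negb_and -!ltNge; apply/orP; left; lra.
  by split; apply/cvgNyP => e' e'0; exists (c - 2) => x /E ->; rewrite subrr normr0 ltW.
- have E x : c + 2 <= x -> expi 0 * psi x = l.
    move=> h; rewrite /psi /rr Tout ?mulr0 ?addr0 ?expi0 ?mul1r//.
    by rewrite negb_and -!ltNge; apply/orP; right; lra.
  by split; apply/cvgyP => e' e'0; exists (c + 2) => x /E ->; rewrite subrr normr0 ltW.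
Qed.

End Minimization.

(** * Lower bounds of the energy in terms of the momentum *)

Section LowerBound.
Context {R : realType}.
Local Notation mu := (@lebesgue_measure R).
Local Notation ig A f := (mu.-integrable A (EFin \o f)).
Local Notation Re := (@complex.Re R).
Local Notation Im := (@complex.Im R).
Implicit Types (V f g J : R -> R) (a b c d s t x y k m p q r e E : R) (z l : R[i]) (psi u v w : R -> R[i]).

(* The infimum over [q1, q2] of energy minus affine function is at least half of
   itself: [reflection_split] writes it as a mean of two values, of which one sits
   at an end point. *)
Lemma affine_bound {V} (al be q1 q2 : R) : admissible V -> 0 < q1 -> q2 < 2 * pi ->
  (forall psi u, fin_energy V psi u -> mom psi u (expi q1) -> al * q1 + be <= en V psi u) ->
  (forall psi u, fin_energy V psi u -> mom psi u (expi q2) -> al * q2 + be <= en V psi u) ->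
  forall q psi u, q1 <= q -> q <= q2 -> fin_energy V psi u -> mom psi u (expi q) ->
  al * q + be <= en V psi u.
Proof.
move=> adm q10 q2pi H1 H2 q psi u qq1 qq2 fe mz.
pose S := [set e | exists q psi u, [/\ q1 <= q <= q2, fin_energy V psi u,
  mom psi u (expi q) & e = en V psi u - (al * q + be)]].
have S0 : S (en V psi u - (al * q + be)) by exists q, psi, u; rewrite qq1 qq2.
have lb : has_lbound S.
  exists (- (`|al| * (2 * pi) + `|be|)) => _ [q' [psi' [u' [/andP[h1 h2] _ _ ->]]]].
  have e0 := en_ge0 (V := V) (psi := psi') (u := u') adm.
  have : al * q' <= `|al| * (2 * pi).
    apply: (le_trans (ler_norm _)); rewrite normrM ler_wpM2l// ger0_norm; lra.
  have := ler_norm be; lra.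
have hi : has_inf S by split => //; exists (en V psi u - (al * q + be)).
suff : 0 <= inf S by have := ge_inf lb S0; lra.
rewrite leNgt; apply/negP => neg.
(* This element lies below inf S / 2. Yet it is half the sum of two elements of S, of which one is
   nonnegative, being at an end point, and the other is at least inf S. *)
have [_ [q' [psi' [u' [/andP[h1 h2] fe' mz' ->]]]] lt] := inf_adherent (eps := - inf S / 2) ltac:(lra) hi.
pose d := Num.min (q' - q1) (q2 - q').
have d0 : 0 <= d by rewrite le_min !subr_ge0 h1.
have d1 : d <= q' - q1 by rewrite ge_min lexx.
have d2 : d <= q2 - q' by rewrite ge_min lexx orbT.
have [psi1 [v1 [psi2 [v2 [[f1 f2] m1 m2 EE]]]]] :=
  reflection_split (d := d) adm fe' mz' ltac:(lra) ltac:(lra) ltac:(lra) ltac:(lra).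
have i1 : inf S <= en V psi1 v1 - (al * (q' - d) + be).
  by apply: (ge_inf lb); exists (q' - d), psi1, v1; split => //; apply/andP; split; lra.
have i2 : inf S <= en V psi2 v2 - (al * (q' + d) + be).
  by apply: (ge_inf lb); exists (q' + d), psi2, v2; split => //; apply/andP; split; lra.
have [dE|dE] : d = q' - q1 \/ d = q2 - q'.
  by rewrite /d; case: (leP (q' - q1) (q2 - q')) => _; [left|right].
- have E1 : q' - d = q1 by rewrite dE; ring.
  by rewrite E1 in m1; have := H1 _ _ f1 m1; rewrite -{1}E1; lra.
- have E2 : q' + d = q2 by rewrite dE; ring.
  by rewrite E2 in m2; have := H2 _ _ f2 m2; rewrite -{1}E2; lra.
Qed.

(** A small total energy is small on every unit interval, so [energy_barrier] keeps the modulus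
    close to 1 everywhere and [small_oscillation] applies. *)
Lemma energy_gap {V} kap : admissible V -> 0 < kap -> kap ^+ 2 < 2 ->
  exists2 h : R, 0 < h & forall psi u z, fin_energy V psi u -> mom psi u z ->
    en V psi u < h -> kap * acos (Re z) <= en V psi u.
Proof.
move=> adm k0 k2; have [e e0 H] := small_oscillation kap adm k0 k2.
have [K K1 HK] := uniform_bound 1 adm.
have [h h0 Hh] := energy_barrier K e adm ltac:(lra) e0.
exists (Num.min h 1); first by rewrite lt_min h0 ltr01.
move=> psi u z fe mz; rewrite lt_min => /andP[eh e1].
apply: H => // x; apply: ltW; apply: (Hh psi u) => //; first exact: (HK psi u fe (ltW e1)).
by apply: le_lt_trans eh; exact: en_sub.
Qed.

(** If m <= 0, momentum p would be reached with arbitrarily small energy, whereas [energy_gap] with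
    kap = 1 forces energy at least p once it is below h. *)
Lemma minimum_gt0 {V p m} : admissible V -> 0 < p -> p <= pi ->
  (forall h, 0 < h -> exists psi u, [/\ fin_energy V psi u, mom psi u (expi p) & en V psi u < m + h]) ->
  0 < m.
Proof.
move=> adm p0 ppi H; have [h h0 Hh] := energy_gap 1 adm ltr01 ltac:(lra).
rewrite ltNge; apply/negP => m0.
pose h' := Num.min h p; have h'0 : 0 < h' by rewrite lt_min h0.
have [psi [u [fe mz lt]]] := H h' h'0.
have lt' : en V psi u < h' by lra.
move: (lt'); rewrite /h' lt_min => /andP[lth ltp].
have := Hh psi u _ fe mz lth; rewrite Re_expi cosK ?in_itv/= ?(ltW p0)//; lra.
Qed.

(** Three ranges of the momentum q: slope kap up to t0, a chord from t0 to p, and the constant m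
    from p to 2 pi - p. Conjugation turns q into -q and so reduces a general z to q = acos (Re z),
    which lies in [0, pi]. *)
Lemma energy_lower_bound {V p m} : admissible V -> 0 < p -> p <= pi -> 0 < m ->
  m < Num.sqrt 2 * p ->
  (forall psi u, fin_energy V psi u -> mom psi u (expi p) -> m <= en V psi u) ->
  forall psi u z, fin_energy V psi u -> mom psi u z ->
    m / p * Num.min p (acos (Re z)) <= en V psi u /\
    (0 < acos (Re z) -> acos (Re z) < p -> m / p * acos (Re z) < en V psi u).
Proof.
move=> adm p0 ppi m0 ms Hm.
have s2 : m / p < Num.sqrt 2 by rewrite ltr_pdivrMr.
have sq2 : Num.sqrt 2 ^+ 2 = 2 :> R by rewrite sqr_sqrtr.
have mp0 : 0 < m / p by rewrite divr_gt0.
pose kap := (m / p + Num.sqrt 2) / 2.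
have k1 : m / p < kap by rewrite /kap; lra.
have k0 : 0 < kap by lra.
have k2 : kap ^+ 2 < 2 by rewrite -sq2 ltr_pXn2r ?nnegrE ?sqrtr_ge0 ?ltW// /kap; lra.
have [h h0 Hh] := energy_gap kap adm k0 k2.
(* Up to t0 the value kap q is at most h, so the slope kap holds whether or not the energy is below
   h. *)
pose t0 := Num.min (h / kap) p.
have t00 : 0 < t0 by rewrite lt_min p0 divr_gt0.
have t0p : t0 <= p by rewrite ge_min lexx orbT.
have t0h : kap * t0 <= h by rewrite mulrC -ler_pdivlMr// ge_min lexx.
have pp := pi_gt0 R.
have small q psi u : 0 < q -> q <= t0 -> fin_energy V psi u -> mom psi u (expi q) ->
    kap * q <= en V psi u.
  move=> q0 qt fe mz; have qpi : q <= pi by lra.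
  have [eh|he] := ltP (en V psi u) h.
    by have := Hh _ _ _ fe mz eh; rewrite Re_expi cosK// in_itv/= (ltW q0).
  by apply: le_trans he; apply: le_trans t0h; rewrite ler_pM2l.
(* Tilting the chord by eta keeps it below kap t0 at t0 and makes it strictly
   larger than (m / p) q inside. *)
pose eta := (kap - m / p) * t0 / p.
have eta0 : 0 < eta by rewrite divr_gt0// mulr_gt0// subr_gt0.
have etap : eta * p = (kap - m / p) * t0 by rewrite /eta mulfVK// gt_eqF.
have mpp : m / p * p = m by rewrite mulfVK// gt_eqF.
have below q psi u : 0 < q -> q < p -> fin_energy V psi u -> mom psi u (expi q) ->
    m / p * q < en V psi u.
  move=> q0 qp fe mz; have [qt|tq] := leP q t0.
    by apply: lt_le_trans (small q psi u q0 qt fe mz); rewrite ltr_pM2r.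
  have := @affine_bound V (m / p - eta) (eta * p) t0 p adm t00 ltac:(lra) _ _ q psi u (ltW tq) (ltW qp) fe mz.
  have -> : (m / p - eta) * q + eta * p = m / p * q + eta * (p - q) by ring.
  move=> H; have : m / p * q + eta * (p - q) <= en V psi u.
    apply: H => psi' u' fe' mz'.
      have := small t0 psi' u' t00 (lexx _) fe' mz'.
      have : 0 <= eta * t0 by rewrite mulr_ge0 ?ltW.
      rewrite mulrBl etap mulrBl; lra.
    by have := Hm _ _ fe' mz'; rewrite mulrBl mpp; lra.
  have : 0 < eta * (p - q) by rewrite mulr_gt0// subr_gt0.
  lra.
(* The end point 2 pi - p is -p modulo 2 pi, and conjugation brings it back to p; the affine
   function is the constant m. *)
have above q psi u : p <= q -> q <= pi -> fin_energy V psi u -> mom psi u (expi q) ->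
    m <= en V psi u.
  move=> pq qpi fe mz.
  have := @affine_bound V 0 m p (2 * pi - p) adm p0 ltac:(lra) _ _ q psi u pq ltac:(lra) fe mz.
  move=> H; rewrite -[m]add0r -(mul0r q).
  apply: H => psi' u' fe' mz'; rewrite mul0r add0r; first exact: Hm.
  rewrite -en_conj; apply: (Hm _ _ (fin_energy_conj fe')).
  have := mom_conj mz'; rewrite -expiN opprB.
  by rewrite -(expi_period 1 (p - _)) mulr1 subrK.
move=> psi u z fe mz; have z1 := mom_unit adm fe mz.
have [psi' [u' [fe' mz' <-]]] : exists psi' u', [/\ fin_energy V psi' u',
    mom psi' u' (expi (acos (Re z))) & en V psi' u' = en V psi u].
  have [<-|<-] := unit_expi z1; first by exists psi, u.
  by exists (cconj psi), (cconj u); rewrite en_conj; split => //;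
    [exact: fin_energy_conj|exact: mom_conj].
have a0 := acos_ge0 (unit_Re z1); have api := acos_lepi (unit_Re z1).
split; last by move=> h1 h2; exact: below.
have [ap|pa] := ltP (acos (Re z)) p.
  move: a0; rewrite le_eqVlt => /orP[/eqP <-|a0].
    by rewrite mulr0; exact: en_ge0.
  by apply/ltW/below.
by rewrite mpp; exact: above fe' mz'.
Qed.

Lemma min_subadditive {p x y t} : 0 <= p -> 0 <= x -> 0 <= y -> t <= x + y ->
  Num.min p t <= Num.min p x + Num.min p y.
Proof.
by move=> p0 x0 y0; case: (leP p t) => ?; case: (leP p x) => ?; case: (leP p y) => ?; lra.
Qed.

Lemma min_shift {p x y e} : 0 <= e -> x - e <= y -> Num.min p x - e <= Num.min p y.
Proof. by move=> e0; case: (leP p x) => ?; case: (leP p y) => ?; lra. Qed.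

(* Each outer part is continued by a cap of constant phase; the momenta of the two
   functions obtained and the phase change over [a, b] add up to the momentum of
   psi. *)
Lemma cut_lower_bound {V p m} e : admissible V -> 0 < p -> 0 < m -> 0 < e ->
  (forall psi u z, fin_energy V psi u -> mom psi u z ->
    m / p * Num.min p (acos (Re z)) <= en V psi u) ->
  exists2 d, 0 < d & forall psi u J (w1 w2 : R[i]) a b, fin_energy V psi u -> ends psi u J w1 w2 ->
    a <= b -> `|Num.sqrt (nsq (psi a)) - 1| <= d -> `|Num.sqrt (nsq (psi b)) - 1| <= d ->
    0 < nsq (psi a) -> 0 < nsq (psi b) ->
    let r := Re (w2 * conjc w1 * conjc (expi (J b) * psi b * conjc (expi (J a) * psi a))) /
      (Num.sqrt (nsq (psi a)) * Num.sqrt (nsq (psi b))) in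
    -1 <= r <= 1 /\
    \int[mu]_(x in `[a, b]) edens V psi u x + m / p * Num.min p (acos r) <= en V psi u + e.
Proof.
move=> adm p0 m0 e0 HK; have [d d0 cap] := cap_exists (V := V) (e / 2) adm ltac:(lra).
exists d => // psi u J w1 w2 a b fe ew ab da db na nb r.
(* A cut at c gives one function that follows psi up to c and one that follows it from c on; their
   momenta are the phase changes of e^{iJ} psi between c and the corresponding end. Each cap costs
   at most e/2. *)
have half c : 0 < nsq (psi c) -> `|Num.sqrt (nsq (psi c)) - 1| <= d ->
   let l := Complex (Num.sqrt (nsq (psi c)))^-1 0 * psi c in
   [/\ nsq l = 1, m / p * Num.min p (acos (Re (expi (J c) * l * conjc w1))) <= enL V psi u c + e / 2 &
       m / p * Num.min p (acos (Re (w2 * conjc (expi (J c) * l)))) <= enR V psi u c + e / 2].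
  move=> nc dc l; set rc := Num.sqrt _ in dc l *.
  have r0 : 0 < rc by rewrite sqrtr_gt0.
  have l1 : nsq l = 1.
    rewrite /l nsqM {1}/nsq/= expr0n addr0 exprVn sqr_sqrtr ?mulVf ?gt_eqF//.
    exact: nsq_ge0.
  have lE : Complex rc 0 * l = psi c.
    rewrite /l mulrA (_ : Complex rc 0 * _ = 1) ?mul1r//.
    by apply: C_eq; rewrite !C_simp/= ?mulr0 ?mul0r ?subr0 ?addr0 ?mulfV ?gt_eqF.
  have [phi [v [fc ec phic ends_c]]] := cap rc l c l1 dc.
  have E : psi c = phi c by rewrite phic lE.
  have ew' := ends_shift (- J c) ew; have J0 : J c + - J c = 0 by rewrite subrr.
  have enLc : enL V phi v c <= en V phi v by apply: en_sub.
  have enRc : enR V phi v c <= en V phi v by apply: en_sub.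
  split => //.
  - have g := ends_mom (ends_glue c ew' ends_c J0 E).
    have := HK _ _ _ (fin_energy_glue c adm fe fc E) g; rewrite en_glue//.
    have -> : l * conjc (expi (- J c) * w1) = expi (J c) * l * conjc w1.
      by rewrite conjM -expiN opprK; ring.
    lra.
  - have g := ends_mom (ends_glue c ends_c ew' (esym J0) (esym E)).
    have := HK _ _ _ (fin_energy_glue c adm fc fe (esym E)) g; rewrite en_glue//.
    have -> : expi (- J c) * w2 * conjc l = w2 * conjc (expi (J c) * l).
      by rewrite conjM -expiN; ring.
    lra.
have [la1 HL _] := half a na da; have [lb1 _ HR] := half b nb db.
set la := _ * psi a in la1 HL; set lb := _ * psi b in lb1 HR.
have [nw1 nw2] := ends_unit adm fe ew.
set z1 := _ * conjc w1 in HL; set z2 := w2 * _ in HR.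
have nz1 : nsq z1 = 1 by rewrite /z1 nsqM (nsqM _ la) nsqJ nsq_expi la1 nw1 !mulr1.
have nz2 : nsq z2 = 1 by rewrite /z2 nsqM nsqJ (nsqM _ lb) nsq_expi lb1 nw2 !mulr1.
(* The two outer momenta add up to the momentum of psi minus the phase change over [a, b]; dividing
   by the moduli at a and b makes the latter a unit number. *)
have E : r = Re (z2 * z1).
  rewrite /r /z1 /z2 /la /lb invfM !conjM !conjcK.
  rewrite (_ : conjc (Complex _ 0) = Complex (Num.sqrt (nsq (psi b)))^-1 0); last by rewrite /= oppr0.
  by rewrite !C_simp/=; ring.
rewrite E; split; first by apply: unit_Re; rewrite nsqM nz1 nz2 mulr1.
rewrite (enLR a fe).
have -> : enR V psi u a = \int[mu]_(x in `[a, b]) edens V psi u x + enR V psi u b.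
  have iE : ig `[a, +oo[ (edens V psi u) by apply: igS (edens_ig fe).
  have EU : [set` `[a, +oo[] = ([set` `[a, b]] : set (measurableTypeR R)) `|` [set` `]b, +oo[].
    apply/seteqP; split => x /=; rewrite !in_itv/= !andbT.
      by move=> ->; case: (leP x b) => _; [left|right].
    by move=> [/andP[]//|]; lra.
  rewrite /enR EU I_setU//.
  - by rewrite Rintegral_itv_obnd_cbnd//; apply: igS (edens_ig fe).
  - by rewrite -EU.
  - apply/disj_setPS => x [] /=; rewrite !in_itv/= andbT => /andP[_ xb] bx.
    by move: (le_lt_trans xb bx); rewrite ltxx.
have := acos_subadd nz2 nz1.
have [a1 a2] := (acos_ge0 (unit_Re nz1), acos_ge0 (unit_Re nz2)).
set al1 := acos (Re z1) in HL a1 *; set al2 := acos (Re z2) in HR a2 *.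
set al := acos _ => sub.
have := min_subadditive (ltW p0) a2 a1 sub.
rewrite -(ler_pM2l (x := m / p)) ?divr_gt0// mulrDr; lra.
Qed.

End LowerBound.

(** * Ascoli's theorem on the line *)

Section Compactness.
Context {R : realType}.
Local Notation mu := (@lebesgue_measure R).
Local Notation ig A f := (mu.-integrable A (EFin \o f)).
Implicit Types (f g h : R -> R) (a b c d e t x y B E M : R).

(** Along an ultrafilter every bounded sequence converges, so a limit function is obtained at all
    points at once, without a diagonal argument; a genuine subsequence is extracted only in
    [ascoli]. *)
Lemma ultra_limit {G : set_system nat} {UG : UltraFilter G} (v : nat -> R) B :
  (forall n, `|v n| <= B) -> exists l : R, forall e, 0 < e -> G [set n | `|v n - l| <= e].
Proof.
move=> vB; have PF : ProperFilter (v n @[n --> G]) by exact: fmap_proper_filter.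
have [|l [_ cl]] := @segment_compact R (- B) B _ PF.
  apply: (@filterS _ G _ setT) => [n _ /=|]; last exact: filterT.
  by rewrite in_itv/= -ler_norml.
exists l => e e0; have [//|h] := in_ultra_setVsetC [set n | `|v n - l| <= e] UG.
have /cl : (v n @[n --> G]) [set y | ~ (`|y - l| <= e)] by exact: h.
move=> /(_ (ball l e) (nbhsx_ballx _ _ e0)) [y [/= yl]]; rewrite /ball/= distrC => /ltW.
by move/yl.
Qed.

Lemma ultra_forall {G : set_system nat} {FG : ProperFilter G} (P : nat -> set nat) N :
  (forall i, G (P i)) -> G [set n | forall i, (i < N)%N -> P i n].
Proof.
move=> GP; elim: N => [|N IH]; first by apply: (@filterS _ G _ setT) => //; exact: filterT.
apply: filterS2 IH (GP N) => n h1 h2 i; rewrite ltnS leq_eqVlt => /orP[/eqP ->//|].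
exact: h1.
Qed.

Definition equicontinuous (f_ : nat -> R -> R) := forall e, 0 < e -> exists2 d : R, 0 < d &
  forall (n : nat) x y, `|x - y| <= d -> `|f_ n x - f_ n y| <= e.

Lemma ultra_locally_uniform {G : set_system nat} {UG : UltraFilter G} (f_ : nat -> R -> R) B :
  (forall n x, `|f_ n x| <= B) -> equicontinuous f_ ->
  exists f, forall M e, 0 < e -> G [set n | forall x, `|x| <= M -> `|f_ n x - f x| <= e].
Proof.
move=> fB eq; have [f Hf] := choice (fun x => ultra_limit (f_ ^~ x) B (fB ^~ x)).
exists f => M e e0.
have [d d0 D] := eq (e / 4) ltac:(lra).
have Df x y : `|x - y| <= d -> `|f x - f y| <= e / 2.
  move=> xy; have e8 : 0 < e / 8 by lra.
  have [n [h1 h2]] := filter_ex (filterI (Hf x _ e8) (Hf y _ e8)).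
  move: h1 h2 (D n x y xy) => /=; rewrite !ler_norml => /andP[? ?] /andP[? ?] /andP[? ?].
  by apply/andP; split; lra.
(* N grid points of mesh d starting at -M cover [-M, M]. Convergence at these finitely many points
   and equicontinuity give e/4 + e/4 + e/2. *)
have [N HN] := nat_above ((2 * `|M| + 1) / d).
apply: filterS (ultra_forall (fun i => [set n | `|f_ n (- M + i%:R * d) - f (- M + i%:R * d)| <= e / 4]) N _); last first.
  by move=> i; apply: Hf; lra.
move=> n /= H x; rewrite ler_norml => /andP[x1 x2].
have xM : 0 <= (x + M) / d by apply: divr_ge0; [lra|exact: ltW].
pose i := Num.truncn ((x + M) / d).
have /andP[i1 i2] : i%:R <= (x + M) / d < i.+1%:R by rewrite truncn_itv.
have iN : (i < N)%N.
  rewrite -(ltr_nat R); apply: le_lt_trans HN; apply: (le_trans i1).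
  by rewrite ler_pM2r ?invr_gt0//; have := ler_norm M; lra.
have := H i iN; set y := - M + _ => Hy.
have xy : `|x - y| <= d.
  rewrite ler_pdivlMr// in i1; move: i2; rewrite ltr_pdivrMr// -natr1 mulrDl mul1r => i2.
  by rewrite /y ler_norml; apply/andP; split; lra.
move: Hy (D n x y xy) (Df x y xy); rewrite !ler_norml => /andP[? ?] /andP[? ?] /andP[? ?].
by apply/andP; split; lra.
Qed.

Lemma extraction (P : nat -> nat -> Prop) :
  (forall k N, exists2 n, (N <= n)%N & P k n) ->
  exists2 s : nat -> nat, {homo s : i j / (i < j)%N} & forall k, P k (s k).
Proof.
move=> H; have [h Hh] := choice (fun kN : nat * nat => 
  (let: ex_intro2 n h1 h2 := H kN.1 kN.2 in ex_intro _ n (conj h1 h2)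
   : exists n, (kN.2 <= n)%N /\ P kN.1 n)).
pose s := fix s k := if k is k'.+1 then h (k, (s k').+1) else h (0%N, 0%N).
exists s => [|[|k]]; [|by case: (Hh (0%N, 0%N))|by case: (Hh (k.+1, (s k).+1))].
apply: homo_ltn; first exact: ltn_trans.
by move=> k; case: (Hh (k.+1, (s k).+1)).
Qed.

Lemma ascoli (f_ g_ : nat -> R -> R) B :
  (forall n x, `|f_ n x| <= B) -> (forall n x, `|g_ n x| <= B) ->
  equicontinuous f_ -> equicontinuous g_ ->
  exists s f g, {homo s : i j / (i < j)%N} /\
    forall (k : nat) x, `|x| <= k%:R ->
      `|f_ (s k) x - f x| <= k.+1%:R^-1 /\ `|g_ (s k) x - g x| <= k.+1%:R^-1.
Proof.
(* G is finer than the filter of tails, so each of its members contains arbitrarily large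
   indices. *)
move=> fB gB ef eg; have [G [UG sub]] := ultraFilterLemma (F := \oo) _.
have [f Hf] := ultra_locally_uniform f_ B fB ef.
have [g Hg] := ultra_locally_uniform g_ B gB eg.
have [k N|s hs Hs] := @extraction (fun k n => forall x, `|x| <= k%:R ->
   `|f_ n x - f x| <= k.+1%:R^-1 /\ `|g_ n x - g x| <= k.+1%:R^-1); last by exists s, f, g.
have k0 : 0 < k.+1%:R^-1 :> R by rewrite invr_gt0.
have GN : G [set n | (N <= n)%N] by apply: sub; exact: nbhs_infty_ge.
have [n [[h1 h2] h3]] := filter_ex (filterI (filterI (Hf k%:R _ k0) (Hg k%:R _ k0)) GN).
by exists n => // x xk; split; [exact: h1|exact: h2].
Qed.

Lemma ac_equicontinuous (f_ h_ : nat -> R -> R) E :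
  (forall n, ac (f_ n) (h_ n)) -> (forall n, ig setT (fun x => h_ n x ^+ 2)) ->
  (forall n, \int[mu]_x h_ n x ^+ 2 <= E) -> equicontinuous f_.
Proof.
move=> af i2 IE e e0.
have E0 : 0 <= E by apply: le_trans (IE 0%N); apply: I_ge0 => x _; exact: sqr_ge0.
(* With weight t and |x - y| <= t e both terms of [L1_le_L2] are at most e: t E <= e and (1/t) t e =
   e. *)
pose t := e / (E + 1); have t0 : 0 < t by rewrite divr_gt0//; lra.
have tE : t * E <= e by rewrite /t mulrAC ler_pdivrMr; [rewrite ler_pM2l//; lra|lra].
exists (t * e); first by rewrite mulr_gt0.
suff H n x y : x <= y -> `|x - y| <= t * e -> `|f_ n x - f_ n y| <= e.
  move=> n x y xy; have [h|/ltW h] := leP x y; first exact: H.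
  by rewrite distrC; apply: H; rewrite // distrC.
move=> xy; rewrite (distrC (f_ n x)) (distrC x) ger0_norm ?subr_ge0// => d.
rewrite (acE (af n) xy); apply: (le_trans (I_norm _ _)) => //; first exact: ac_ig (af n).
have i2' : ig `[x, y] (fun x => h_ n x ^+ 2) by exact: ig_itvT.
apply: (le_trans (L1_le_L2 t _ i2' t0 xy)); first exact: ac_meas (af n).
have : t * \int[mu]_(s in `[x, y]) h_ n s ^+ 2 <= e.
  apply: le_trans tE; rewrite ler_pM2l//; apply: le_trans (IE n).
  by apply: I_subset => // s _; exact: sqr_ge0.
have : t^-1 * (y - x) <= e by rewrite mulrC ler_pdivrMr// mulrC.
lra.
Qed.

End Compactness.

(** * Locally uniform limits of functions of bounded energy *)

Section Limits.
Context {R : realType}.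
Local Notation mu := (@lebesgue_measure R).
Local Notation ig A f := (mu.-integrable A (EFin \o f)).
Local Notation Re := (@complex.Re R).
Local Notation Im := (@complex.Im R).
Implicit Types (V f g h : R -> R) (a b c d e t x y A E K M : R) (psi u : R -> R[i])
  (psis us : nat -> R -> R[i]) (N k n : nat).

Lemma homo_geid {s : nat -> nat} : {homo s : i j / (i < j)%N} -> forall k, (k <= s k)%N.
Proof. by move=> hs; elim=> // k IH; apply: leq_ltn_trans IH (hs _ _ (ltnSn k)). Qed.

Lemma not_near {P : nat -> Prop} : ~ (\forall n \near \oo, P n) ->
  exists2 s : nat -> nat, {homo s : i j / (i < j)%N} & forall k, ~ P (s k).
Proof.
move=> nP; apply: (@extraction (fun _ n => ~ P n)) => _ N.
apply: contrapT => h; apply: nP; exists N => // n /= Nn; apply: contrapT => nPn.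
by apply: h; exists n.
Qed.

Lemma cvg_subseq {v : nat -> R} {l : R} {s : nat -> nat} : {homo s : i j / (i < j)%N} ->
  v n @[n --> \oo] --> l -> v (s n) @[n --> \oo] --> l.
Proof.
move=> hs /cvgnP c; apply/cvgnP => e e0; have [N HN] := c e e0; exists N => n Nn.
by apply: HN; exact: leq_trans (homo_geid hs n).
Qed.

(** Fatou's lemma as an eventual inequality: a failure would persist along a subsequence, to which
    [fatou_real] applies. *)
Lemma fatou_near {D : set (measurableTypeR R)} {F_ : nat -> R -> R} {f} : measurable D ->
  (forall n, ig D (F_ n)) -> (forall n x, D x -> 0 <= F_ n x) ->
  measurable_fun D f -> (forall x, D x -> 0 <= f x) ->
  (forall x, D x -> F_ n x @[n --> \oo] --> f x) ->
  forall e, 0 < e -> \forall n \near \oo, \int[mu]_(x in D) f x - e <= \int[mu]_(x in D) F_ n x.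
Proof.
move=> mD iF F0 mf f0 c e e0; apply: contrapT => /not_near[s hs Hs].
have [||_ h] := @fatou_real R D (fun n => F_ (s n)) f (\int[mu]_(x in D) f x - e) mD
  (fun n => iF (s n)) (fun n => F0 (s n)) mf f0.
- by apply: aeW => x Dx; exact: (cvg_subseq hs (c x Dx)).
- by move=> n; apply/ltW; rewrite ltNge; apply/negP; exact: Hs.
lra.
Qed.

Definition locunif psis psi := forall M e, 0 < e -> \forall n \near \oo, forall x, `|x| <= M ->
  `|Re (psis n x) - Re (psi x)| <= e /\ `|Im (psis n x) - Im (psi x)| <= e.

Lemma locunif_ccvg {psis psi x} : locunif psis psi -> ccvg \oo (fun n => psis n x) (psi x).
Proof.
move=> h; split; apply/cvgnP => e e0; have [N _ HN] := h `|x| e e0; exists N => n Nn;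
  by have [] := HN n Nn x (lexx _).
Qed.

Lemma locunif_V {V psis psi x} : continuous V -> locunif psis psi ->
  V (nsq (psis n x)) @[n --> \oo] --> V (nsq (psi x)).
Proof.
move=> cV h; apply: (cvg_comp _ _ (ccvg_nsq (locunif_ccvg h))); exact: cV.
Qed.

Lemma sq_le_en {V psi u} : admissible V -> fin_energy V psi u ->
  \int[mu]_x Re (u x) ^+ 2 <= en V psi u /\ \int[mu]_x Im (u x) ^+ 2 <= en V psi u.
Proof.
move=> adm fe; have [[_ _ s1 s2] _] := fe; have i := edens_ig fe.
have v0 x : 0 <= V (nsq (psi x)) by apply: (admissible_ge0 adm); exact: nsq_ge0.
split; apply: I_le => // x _; rewrite /edens /nsq;
  have := sqr_ge0 (Re (u x)); have := sqr_ge0 (Im (u x)); have := v0 x; rewrite /nsq; lra.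
Qed.

Lemma limit_fin_energy {V psis us psi E} : admissible V ->
  (forall n, fin_energy V (psis n) (us n)) -> (forall n, en V (psis n) (us n) <= E) ->
  locunif psis psi -> exists u, fin_energy V psi u.
Proof.
move=> adm fe eE lu; have [cV _ _ _ _] := adm.
have pick (n : nat) : exists k, forall x, `|x| <= n%:R ->
    `|Re (psis k x) - Re (psi x)| <= n.+1%:R^-1 /\ `|Im (psis k x) - Im (psi x)| <= n.+1%:R^-1.
  have [|N _ HN] := lu n%:R n.+1%:R^-1; first by rewrite invr_gt0.
  by exists N; apply: HN => /=.
have [g1 [a1 i1 _]] : exists g, [/\ ac (Re \o psi) g, ig setT (fun x => g x ^+ 2) &
    \int[mu]_x g x ^+ 2 <= E].
  apply: closure_L2 => n; have [k Hk] := pick n; have [[h1 _ s1 _] _] := fe k.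
  exists (Re \o psis k), (Re \o us k); split => // [|x /Hk[]//].
  by apply: le_trans (eE k); have [] := sq_le_en adm (fe k).
have [g2 [a2 i2 _]] : exists g, [/\ ac (Im \o psi) g, ig setT (fun x => g x ^+ 2) &
    \int[mu]_x g x ^+ 2 <= E].
  apply: closure_L2 => n; have [k Hk] := pick n; have [[_ h2 _ s2] _] := fe k.
  exists (Im \o psis k), (Im \o us k); split => // [|x /Hk[]//].
  by apply: le_trans (eE k); have [] := sq_le_en adm (fe k).
exists (fun x => Complex (g1 x) (g2 x)).
have hd : has_deriv psi (fun x => Complex (g1 x) (g2 x)) by split.
split => //.
have v0 (q : R -> R[i]) x : 0 <= V (nsq (q x)) by apply: (admissible_ge0 adm); exact: nsq_ge0.
have [|||iV _] := @fatou_real R setT (fun n x => V (nsq (psis n x))) (fun x => V (nsq (psi x))) E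
  measurableT (fun n => (fe n).2) (fun n x _ => v0 _ x) _ (fun x _ => v0 _ x) _.
- by apply: cont_meas => x; apply: (@continuous_comp _ _ _ (fun x => nsq (psi x)) V);
    [exact: (nsq_cont hd)|exact: cV].
- by apply: aeW => x _; exact: (locunif_V cV lu).
- move=> n; apply: le_trans (eE n); apply: I_le => //; [exact: (fe n).2|exact: edens_ig|].
  by move=> x _; rewrite /edens lerDr nsq_ge0.
exact: iV.
Qed.

Lemma potential_lsc {V psis us psi u} {D : set (measurableTypeR R)} : admissible V ->
  (forall n, fin_energy V (psis n) (us n)) -> fin_energy V psi u -> locunif psis psi ->
  measurable D -> forall {e}, 0 < e -> \forall n \near \oo,
    \int[mu]_(x in D) V (nsq (psi x)) - e <= \int[mu]_(x in D) V (nsq (psis n x)).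
Proof.
move=> adm fe fp lu mD; have [cV _ _ _ _] := adm.
have v0 (q : R -> R[i]) x : 0 <= V (nsq (q x)) by apply: (admissible_ge0 adm); exact: nsq_ge0.
apply: fatou_near => //.
- by move=> n; apply: igS (fe n).2.
- apply: measurable_funTS; exact: ig_meas fp.2.
- by move=> x _; exact: (locunif_V cV lu).
Qed.

(** Clamping the argument to [-A, A] restricts the densities and preserves locally uniform
    convergence, so lower semicontinuity on the whole line applies. *)
Lemma lsc_L2_itv {f g} {f_ g_ : nat -> R -> R} A : 0 <= A -> ac f g -> ig setT (fun x => g x ^+ 2) ->
  (forall n, ac (f_ n) (g_ n)) -> (forall n, ig setT (fun x => g_ n x ^+ 2)) ->
  (forall M e, 0 < e -> \forall n \near \oo, forall x, `|x| <= M -> `|f_ n x - f x| <= e) ->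
  forall e, 0 < e -> \forall n \near \oo,
    \int[mu]_(x in `[- A, A]) g x ^+ 2 - e <= \int[mu]_(x in `[- A, A]) g_ n x ^+ 2.
Proof.
move=> A0 af ig2 afn ign lu e e0; have AA : - A <= A by lra.
have sqp (q : R -> R) x : (q \_ `[- A, A]) x ^+ 2 = ((fun x => q x ^+ 2) \_ `[- A, A]) x.
  by rewrite !patchE; case: ifP => // _; rewrite expr0n.
have pI (q : R -> R) : \int[mu]_x (q \_ `[- A, A]) x ^+ 2 = \int[mu]_(x in `[- A, A]) q x ^+ 2.
  by rewrite [RHS]Rintegral_mkcond; apply: eq_Rintegral => x _; rewrite sqp.
have ip (q : R -> R) : ig setT (fun x => q x ^+ 2) -> ig setT (fun x => (q \_ `[- A, A]) x ^+ 2).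
  move=> i; apply: (ig_ext _ _ (ig_patch (a := - A) (b := A) (igS measurableT _ _ i))) => //.
have := lsc_L2 (ac_clamp AA af) (ip _ ig2) (fun n => ac_clamp AA (afn n)) (fun n => ip _ (ign n)).
move=> H; have : \forall n \near \oo, \int[mu]_x (g \_ `[- A, A]) x ^+ 2 - e <=
    \int[mu]_x ((g_ n) \_ `[- A, A]) x ^+ 2.
  apply: H => // M e' e'0; have := lu A e' e'0; apply: filterS => n Hn x _; apply: Hn.
  rewrite ler_norml; apply/andP; split; first by rewrite le_max lexx.
  by rewrite ge_max AA ge_min lexx orbT.
by apply: filterS => n; rewrite !pI.
Qed.

Lemma edens_lsc_itv {V psis us psi u A} : admissible V ->
  (forall n, fin_energy V (psis n) (us n)) -> fin_energy V psi u -> locunif psis psi ->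
  0 <= A -> forall e, 0 < e -> \forall n \near \oo,
    \int[mu]_(x in `[- A, A]) edens V psi u x - e <= \int[mu]_(x in `[- A, A]) edens V (psis n) (us n) x.
Proof.
move=> adm fe fp lu A0 e e0.
have split3 (q v : R -> R[i]) : fin_energy V q v -> \int[mu]_(x in `[- A, A]) edens V q v x =
    \int[mu]_(x in `[- A, A]) Re (v x) ^+ 2 + \int[mu]_(x in `[- A, A]) Im (v x) ^+ 2 +
    \int[mu]_(x in `[- A, A]) V (nsq (q x)).
  move=> [[_ _ s1 s2] iV]; have [t1 [t2 t3]] := (ig_itvT (a := - A) (b := A) s1,
    (ig_itvT (a := - A) (b := A) s2, ig_itvT (a := - A) (b := A) iV)).
  by rewrite -I_D// -I_D//; exact: igD.
have [[h1 h2 s1 s2] iV] := fp.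
have e3 : 0 < e / 3 by lra.
have l1 : \forall n \near \oo, \int[mu]_(x in `[- A, A]) Re (u x) ^+ 2 - e / 3 <=
    \int[mu]_(x in `[- A, A]) Re (us n x) ^+ 2.
  apply: (lsc_L2_itv A A0 h1 s1 (f_ := fun n => Re \o psis n)) => // [n|n|M e' e'0].
  - by case: (fe n) => [[]].
  - by case: (fe n) => [[]].
  - by have := lu M e' e'0; apply: filterS => n H x /H[].
have l2 : \forall n \near \oo, \int[mu]_(x in `[- A, A]) Im (u x) ^+ 2 - e / 3 <=
    \int[mu]_(x in `[- A, A]) Im (us n x) ^+ 2.
  apply: (lsc_L2_itv A A0 h2 s2 (f_ := fun n => Im \o psis n)) => // [n|n|M e' e'0].
  - by case: (fe n) => [[]].
  - by case: (fe n) => [[]].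
  - by have := lu M e' e'0; apply: filterS => n H x /H[].
have l3 := potential_lsc adm fe fp lu (measurable_itv `[- A, A]) e3.
apply: filterS2 (filterI l1 l2) l3 => n [H1 H2] H3.
by rewrite !split3//; move: H1 H2 H3 => /=; lra.
Qed.

End Limits.

(** * Momentum and energy lost in the limit *)

Section LimitMomentum.
Context {R : realType}.
Local Notation mu := (@lebesgue_measure R).
Local Notation ig A f := (mu.-integrable A (EFin \o f)).
Local Notation Re := (@complex.Re R).
Local Notation Im := (@complex.Im R).
Implicit Types (V f g h J : R -> R) (a b c d e t x y m p A B E K M : R) (psi u : R -> R[i])
  (psis us : nat -> R -> R[i]) (z : R[i]) (N k n : nat).

(** The change of e^{iJ} psi over [-A, A], written without a primitive. It involves psi on [-A, A]
    only and therefore passes to locally uniform limits, which the momentum itself does not. *)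
Definition chord psi u A : R[i] :=
  expi (\int[mu]_(x in `[- A, A]) jdens psi u x) * psi A * conjc (psi (- A)).

Lemma chordE {psi u J A} : ac J (jdens psi u) -> 0 <= A ->
  expi (J A) * psi A * conjc (expi (J (- A)) * psi (- A)) = chord psi u A.
Proof.
move=> aJ A0; rewrite /chord -(acE aJ); last lra.
by rewrite expiD expiN conjM; ring.
Qed.

Lemma chord_ends {psi u z} : mom psi u z -> ccvg +oo (fun A => chord psi u A) z.
Proof.
move=> [J [w1 [w2 [aJ [/cvgNyP c1 /cvgNyP c1'] c2 ->]]]].
have c : ccvg +oo (fun A => expi (J (- A)) * psi (- A)) w1.
  split; apply/cvgyP => e e0.
    by have [A HA] := c1 e e0; exists (- A) => x xA; apply: HA; lra.
  by have [A HA] := c1' e e0; exists (- A) => x xA; apply: HA; lra.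
have [/cvgyP d1 /cvgyP d2] := ccvgM c2 (ccvgJ c).
split; apply/cvgyP => e e0.
  have [A HA] := d1 e e0; exists (Num.max A 0) => x; rewrite ge_max => /andP[Ax x0].
  by rewrite -(chordE aJ x0); exact: HA.
have [A HA] := d2 e e0; exists (Num.max A 0) => x; rewrite ge_max => /andP[Ax x0].
by rewrite -(chordE aJ x0); exact: HA.
Qed.

(* Up to the derivative of P, the difference of the densities only contains u1 and
   u2 multiplied by psi1 - psi2, so that no smallness of u1 - u2 is required. *)
Lemma jdens_stable {psi1 u1 psi2 u2 A B e} : has_deriv psi1 u1 -> has_deriv psi2 u2 -> 0 <= A ->
  (forall x, nsq (psi2 x) <= B ^+ 2) -> 0 <= B -> 0 <= e ->
  (forall x, `|x| <= A -> `|Re (psi1 x) - Re (psi2 x)| <= e /\ `|Im (psi1 x) - Im (psi2 x)| <= e) ->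
  `|\int[mu]_(x in `[- A, A]) jdens psi1 u1 x - \int[mu]_(x in `[- A, A]) jdens psi2 u2 x| <=
    e * (4 * B + 4 * A + \int[mu]_x nsq (u1 x) + \int[mu]_x nsq (u2 x)).
Proof.
move=> h1 h2 A0 HB B0 e0 He; have AA : - A <= A by lra.
have [f1 g1 _ _] := h1; have [f2 g2 _ _] := h2.
have aP := ac_B (ac_mul (ac_B f1 f2) g2) (ac_mul f2 (ac_B g1 g2)).
set P := (X in ac X _) in aP; set dP := (X in ac _ X) in aP.
pose r x := jdens psi1 u1 x - jdens psi2 u2 x - dP x.
have i1 : ig `[- A, A] (jdens psi1 u1) by exact: jdens_ig h1.
have i2 : ig `[- A, A] (jdens psi2 u2) by exact: jdens_ig h2.
have iP : ig `[- A, A] dP := ac_ig aP.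
have ir : ig `[- A, A] r by apply: igB => //; exact: igB.
have in1 := has_deriv_nsq_ig h1; have in2 := has_deriv_nsq_ig h2.
have E : \int[mu]_(x in `[- A, A]) jdens psi1 u1 x - \int[mu]_(x in `[- A, A]) jdens psi2 u2 x =
    P A - P (- A) + \int[mu]_(x in `[- A, A]) r x.
  have -> : \int[mu]_(x in `[- A, A]) r x = \int[mu]_(x in `[- A, A]) jdens psi1 u1 x -
      \int[mu]_(x in `[- A, A]) jdens psi2 u2 x - \int[mu]_(x in `[- A, A]) dP x.
    by rewrite -I_B// -I_B//; exact: igB.
  by rewrite (acE aP AA); ring.
have Pb x : `|x| <= A -> `|P x| <= e * (2 * B).
  move=> xA; have [e1 e2] := He x xA.
  have b1 := abs_Re_le _ _ B0 (HB x); have b2 := abs_Im_le _ _ B0 (HB x).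
  rewrite /P /=; apply: (le_trans (ler_normB _ _)).
  rewrite !normrM (_ : e * (2 * B) = e * B + B * e); last ring.
  by apply: lerD; apply: ler_pM.
have rb : \int[mu]_(x in `[- A, A]) `|r x| <=
    e * (4 * A + \int[mu]_x nsq (u1 x) + \int[mu]_x nsq (u2 x)).
  apply: (@le_trans _ _ (\int[mu]_(x in `[- A, A]) (e * (2 + nsq (u1 x) + nsq (u2 x))))).
    apply: I_le => //; first exact: ig_norm.
      apply: igZ => //; apply: igD => //; last exact: ig_itvT.
      by apply: igD => //; [apply: ig_cont => x; exact: cvg_cst|exact: ig_itvT].
    move=> x /=; rewrite in_itv/= -ler_norml => /He[].
    rewrite /r /dP /jdens /nsq /=.
    set a1 := Re (psi1 x); set b1 := Im (psi1 x); set a2 := Re (psi2 x); set b2 := Im (psi2 x).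
    set c1 := Re (u1 x); set d1 := Im (u1 x); set c2 := Re (u2 x); set d2 := Im (u2 x) => e1 e2.
    rewrite (_ : _ - _ = (c1 + c2) * (b1 - b2) - (a1 - a2) * (d1 + d2)); last ring.
    apply: (le_trans (ler_normB _ _)); rewrite !normrM.
    apply: (@le_trans _ _ (`|c1 + c2| * e + e * `|d1 + d2|)).
      by apply: lerD; apply: ler_pM.
    rewrite mulrC -mulrDr ler_wpM2l//.
    have sq (k : R) : `|k| <= (1 + k ^+ 2) / 2.
      by have := sqr_ge0 (`|k| - 1); rewrite -(real_normK (num_real k)) !expr2; nra.
    have := ler_normD c1 c2; have := ler_normD d1 d2.
    have := sq c1; have := sq c2; have := sq d1; have := sq d2; have := sqr_ge0 c1.
    have := sqr_ge0 c2; have := sqr_ge0 d1; have := sqr_ge0 d2.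
    lra.
  have j1 : ig `[- A, A] (fun x => nsq (u1 x)) by exact: ig_itvT.
  have j2 : ig `[- A, A] (fun x => nsq (u2 x)) by exact: ig_itvT.
  have j0 : ig `[- A, A] (fun _ => 2 : R) by apply: ig_cont => x; exact: cvg_cst.
  rewrite I_Z//; last by apply: igD => //; exact: igD.
  rewrite ler_wpM2l// I_D//; last exact: igD.
  rewrite I_D// I_cst//.
  have s1 : \int[mu]_(x in `[- A, A]) nsq (u1 x) <= \int[mu]_x nsq (u1 x).
    by apply: I_subset => // x _; exact: nsq_ge0.
  have s2 : \int[mu]_(x in `[- A, A]) nsq (u2 x) <= \int[mu]_x nsq (u2 x).
    by apply: I_subset => // x _; exact: nsq_ge0.
  lra.
rewrite E; apply: (le_trans (ler_normD _ _)); have hn := I_norm (measurable_itv _) ir.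
have p1 := Pb A ltac:(by rewrite ger0_norm); have p2 := Pb (- A) ltac:(by rewrite normrN ger0_norm).
have := ler_normB (P A) (P (- A)); lra.
Qed.

Lemma chord_cvg {V psis us psi u A} E : admissible V ->
  (forall n, fin_energy V (psis n) (us n)) -> (forall n, en V (psis n) (us n) <= E) ->
  fin_energy V psi u -> locunif psis psi -> 0 <= A ->
  ccvg \oo (fun n => chord (psis n) (us n) A) (chord psi u A).
Proof.
move=> adm fe eE fp lu A0; have [K K0 HK] := bounded_nsq adm fp.
have B0 := sqrtr_ge0 K; pose B := Num.sqrt K.
have HB x : nsq (psi x) <= B ^+ 2 by rewrite sqr_sqrtr.
have neE (q v : R -> R[i]) : fin_energy V q v -> \int[mu]_x nsq (v x) <= en V q v.
  move=> [hq iq]; apply: I_le => //; [exact: has_deriv_nsq_ig hq|exact: edens_ig|].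
  by move=> x _; rewrite /edens lerDl (admissible_ge0 adm)// nsq_ge0.
apply: ccvgM; last exact: ccvgJ (locunif_ccvg lu).
apply: ccvgM; last exact: locunif_ccvg lu.
apply: ccvg_expi; apply/cvgnP => e e0.
pose C := 4 * B + 4 * A + E + en V psi u.
have C0 : 0 <= C.
  have := eE 0%N; have := en_ge0 (V := V) (psi := psis 0%N) (u := us 0%N) adm.
  by have := en_ge0 (V := V) (psi := psi) (u := u) adm; rewrite /C /B; lra.
have e'0 : 0 < e / (C + 1) by rewrite divr_gt0//; lra.
have [N _ HN] := lu A _ e'0; exists N => n Nn.
apply: (le_trans (jdens_stable (fe n).1 fp.1 A0 HB B0 (ltW e'0) (HN n Nn))).
apply: (@le_trans _ _ (e / (C + 1) * C)); last by rewrite mulrAC ler_pdivrMr; [rewrite ler_pM2l//; lra|lra].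
rewrite ler_pM2l//; have := neE _ _ (fe n); have := neE _ _ fp; have := eE n; rewrite /C; lra.
Qed.

(** A is chosen first, from the limit psi alone; then n tends to infinity with A fixed, so that only
    convergence on [-A, A] is used, through [chord_cvg] and [edens_lsc_itv]. *)
Lemma cut_limit {V psis us psi u p m} {zs : nat -> R[i]} {z} : admissible V -> 0 < p -> 0 < m ->
  (forall psi u z, fin_energy V psi u -> mom psi u z ->
    m / p * Num.min p (acos (Re z)) <= en V psi u) ->
  (forall n, fin_energy V (psis n) (us n)) -> (forall n, mom (psis n) (us n) (zs n)) ->
  ccvg \oo zs (expi p) -> en V (psis n) (us n) @[n --> \oo] --> m ->
  (exists E, forall n, en V (psis n) (us n) <= E) ->
  locunif psis psi -> fin_energy V psi u -> mom psi u z ->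
  en V psi u + m / p * Num.min p (acos (Re (expi p * conjc z))) <= m.
Proof.
move=> adm p0 m0 HK fe mz cz ce [E eE] lu fp mp.
have z1 := mom_unit adm fp mp.
set b := acos _; have ub : nsq (expi p * conjc z) = 1 by rewrite nsqM nsq_expi nsqJ z1 mulr1.
have b0 : 0 <= b := acos_ge0 (unit_Re ub); have bpi : b <= pi := acos_lepi (unit_Re ub).
have cb : cos b = Re (expi p * conjc z) by rewrite acosK// in_itv/= unit_Re.
have mp0 : 0 < m / p by rewrite divr_gt0.
apply/ler_addgt0Pl => e e0; rewrite addrC.
(* The losses add up to four times eta in the energies and m / p times eta in the momentum term. *)
pose eta := e / (5 * (1 + m / p)).
have eta0 : 0 < eta by rewrite divr_gt0//; lra.
have etaE : 4 * eta + m / p * eta <= e.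
  have : eta * (5 * (1 + m / p)) = e by rewrite /eta mulfVK// gt_eqF//; lra.
  have : 0 < eta * (m / p) by exact: mulr_gt0.
  lra.
(* The angle enters through a strict inequality between cosines, which persists for A and n large.
   If b <= eta no such inequality is available, but then t = 0 and acos >= 0 suffices. *)
pose t := Num.max 0 (b - eta).
have t0 : 0 <= t by rewrite le_max lexx.
have tb : b - eta <= t by rewrite le_max lexx orbT.
have tpi : t <= pi by rewrite ge_max pi_ge0/=; lra.
have [d d0 Hd] := cut_lower_bound eta adm p0 m0 eta0 HK.
pose Phi A := Re (expi p * conjc (chord psi u A)) / (Num.sqrt (nsq (psi (- A))) * Num.sqrt (nsq (psi A))).
pose Phin n A := Re (zs n * conjc (chord (psis n) (us n) A)) /
  (Num.sqrt (nsq (psis n (- A))) * Num.sqrt (nsq (psis n A))).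
have [n1 n2] := nsq_cvg adm fp.
have n1' : nsq (psi (- A)) @[A --> +oo] --> (1 : R).
  move/cvgNyP : n1 => n1; apply/cvgyP => e' e'0; have [A HA] := n1 e' e'0.
  by exists (- A) => x xA; apply: HA; lra.
have s1 : Num.sqrt (nsq (psi (- A))) @[A --> +oo] --> (1 : R).
  by rewrite -[X in _ --> X]sqrtr1; apply: (cvg_comp _ _ n1'); exact: sqrt_continuous.
have s2 : Num.sqrt (nsq (psi A)) @[A --> +oo] --> (1 : R).
  by rewrite -[X in _ --> X]sqrtr1; apply: (cvg_comp _ _ n2); exact: sqrt_continuous.
have cPhi : Phi A @[A --> +oo] --> cos b.
  rewrite cb -[X in _ --> X]divr1 -[X in _ / X](mulr1 1); apply: cvgM.
    exact: (ccvgM (ccvg_cst _) (ccvgJ (chord_ends mp))).1.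
  by apply: cvgV; [rewrite mulr1 oner_eq0|exact: cvgM].
have [A [A0 PA [sA sA'] [nA nA'] eA]] : exists A, [/\ 0 <= A, t = 0 \/ Phi A < cos t,
    `|Num.sqrt (nsq (psi (- A))) - 1| < d /\ `|Num.sqrt (nsq (psi A)) - 1| < d,
    0 < nsq (psi (- A)) /\ 0 < nsq (psi A) &
    en V psi u - eta <= \int[mu]_(x in `[- A, A]) edens V psi u x].
  have i := edens_ig fp; have [A0 A00 HA0] := ig_tail i eta0.
  have near1 (q : R -> R) (k : R) : (q x @[x --> +oo] --> (1 : R)) -> 0 < k ->
      \forall x \near +oo, `|q x - 1| < k.
    move=> /cvgrPdist_lt h k0; near=> x; rewrite distrC; near: x; exact: h.
  have pt : \forall A \near +oo, t = 0 \/ Phi A < cos t.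
    have [bt|bt] := leP b eta; first by near=> x; left; rewrite /t max_l//; lra.
    have tE : t = b - eta by rewrite /t max_r//; lra.
    have lt : cos b < cos t by rewrite ltr_cos ?in_itv/= ?b0 ?bpi ?t0 ?tpi// tE; lra.
    by near=> A; right; near: A; exact: (cvgr_lt _ cPhi _ lt).
  have ge : \forall A \near +oo, A0 <= A by apply: nbhs_pinfty_ge; exact: num_real.
  near (pinfty_nbhs R) => A.
  have gA : A0 <= A by near: A; exact: ge.
  have k1 : `|Num.sqrt (nsq (psi (- A))) - 1| < d by near: A; exact: near1.
  have k2 : `|Num.sqrt (nsq (psi A)) - 1| < d by near: A; exact: near1.
  have k3 : `|nsq (psi (- A)) - 1| < 1 by near: A; exact: near1.
  have k4 : `|nsq (psi A) - 1| < 1 by near: A; exact: near1.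
  exists A; split => //; first by near: A; exact: pt.
    move: k3 k4; rewrite !ltr_norml => /andP[k3 _] /andP[k4 _].
    by move: k3 k4; clear; split; lra.
  have nE (X : set (measurableTypeR R)) : \int[mu]_(x in X) `|edens V psi u x| =
      \int[mu]_(x in X) edens V psi u x.
    by apply: I_ext => x _; rewrite ger0_norm// edens_ge0.
  by have := HA0 (- A) A _ gA; rewrite lerN2 => /(_ gA); rewrite !nE /en => /ltW.
have cn x : nsq (psis n x) @[n --> \oo] --> nsq (psi x).
  exact: (ccvg_nsq (locunif_ccvg lu)).
have cs x : Num.sqrt (nsq (psis n x)) @[n --> \oo] --> Num.sqrt (nsq (psi x)).
  by apply: (cvg_comp _ _ (cn x)); exact: sqrt_continuous.
have cPhin : Phin n A @[n --> \oo] --> Phi A.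
  rewrite /Phin /Phi; apply: cvgM.
    exact: (ccvgM cz (ccvgJ (chord_cvg E adm fe eE fp lu A0))).1.
  by apply: cvgV; [rewrite mulf_neq0// gt_eqF// sqrtr_gt0|exact: cvgM].
have near2 x : `|Num.sqrt (nsq (psi x)) - 1| < d ->
    \forall n \near \oo, `|Num.sqrt (nsq (psis n x)) - 1| < d.
  move=> h; have c : `|Num.sqrt (nsq (psis n x)) - 1| @[n --> \oo] --> `|Num.sqrt (nsq (psi x)) - 1|.
    by apply: cvg_norm; apply: cvgB; [exact: cs|exact: cvg_cst].
  exact: cvgr_lt _ c _ h.
have pt : \forall n \near \oo, t = 0 \/ Phin n A < cos t.
  case: PA => [->|h]; first by near=> n; left.
  by near=> n; right; near: n; exact: (cvgr_lt _ cPhin _ h).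
have em : \forall n \near \oo, en V (psis n) (us n) < m + eta.
  by apply: (cvgr_lt _ ce); lra.
have q1 : \forall n \near \oo, 0 < nsq (psis n (- A)) by exact: (cvgr_gt _ (cn (- A)) _ nA).
have q2 : \forall n \near \oo, 0 < nsq (psis n A) by exact: (cvgr_gt _ (cn A) _ nA').
near (nbhs \oo : set_system nat) => n.
have k1 : `|Num.sqrt (nsq (psis n (- A))) - 1| < d by near: n; exact: near2.
have k2 : `|Num.sqrt (nsq (psis n A)) - 1| < d by near: n; exact: near2.
have k3 : 0 < nsq (psis n (- A)) by near: n; exact: q1.
have k4 : 0 < nsq (psis n A) by near: n; exact: q2.
have k5 : t = 0 \/ Phin n A < cos t by near: n; exact: pt.
have k6 : en V (psis n) (us n) < m + eta by near: n; exact: em.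
have k7 : \int[mu]_(x in `[- A, A]) edens V psi u x - eta <=
    \int[mu]_(x in `[- A, A]) edens V (psis n) (us n) x.
  by near: n; exact: edens_lsc_itv.
have [J [w1 [w2 [ew zE]]]] := mom_ends (mz n); have [aJ _ _] := ew.
have AA : - A <= A by rewrite -subr_ge0 opprK addr_ge0.
have := Hd _ _ J w1 w2 (- A) A (fe n) ew AA (ltW k1) (ltW k2) k3 k4.
rewrite /= (chordE aJ A0) -zE -/(Phin n A) => -[u1 H].
have tr : t <= acos (Phin n A).
  case: k5 => [->|h]; first exact: acos_ge0.
  rewrite -[leLHS]cosK ?in_itv/= ?t0 ?tpi//; case/andP: u1 => u1 u2.
  apply: acos_le; [by []|exact: ltW|exact: cos_le1].
have mono : Num.min p b - eta <= Num.min p (acos (Phin n A)).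
  exact: min_shift (ltW eta0) (le_trans tb tr).
have := ler_wpM2l (ltW mp0) mono; rewrite mulrBr.
by move: H k6 k7 eA etaE; clear; lra.
Unshelve. all: by end_near.
Qed.

End LimitMomentum.

(** * Identification of the limit of a minimizing sequence *)

Section MinimizingSequence.
Context {R : realType}.
Local Notation mu := (@lebesgue_measure R).
Local Notation ig A f := (mu.-integrable A (EFin \o f)).
Local Notation Re := (@complex.Re R).
Local Notation Im := (@complex.Im R).
Implicit Types (V f g h J : R -> R) (a b c d e t x y m p r A B E K M : R) (psi u : R -> R[i])
  (psis us : nat -> R -> R[i]) (z : R[i]) (N k n : nat).

(** Let a and b be the distances of the momentum of psi to 0 and to p, so that p <= a + b. If b >=
    p, or if a = 0, the energy would be <= 0; if 0 < a < p, the strict bound is contradicted; if a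
    >= p, the energy is already at least m, which leaves b = 0. *)
Lemma energy_min_identify {V psi u p m} {z} : 0 < p -> p <= pi -> 0 < m ->
  nsq z = 1 -> 0 < en V psi u ->
  m / p * Num.min p (acos (Re z)) <= en V psi u ->
  (0 < acos (Re z) -> acos (Re z) < p -> m / p * acos (Re z) < en V psi u) ->
  en V psi u + m / p * Num.min p (acos (Re (expi p * conjc z))) <= m ->
  z = expi p.
Proof.
move=> p0 ppi m0 z1 en0 K1 K2 C.
have ub : nsq (expi p * conjc z) = 1 by rewrite nsqM nsq_expi nsqJ z1 mulr1.
have mpp : m / p * p = m by rewrite mulfVK// gt_eqF.
have mp0 : 0 < m / p by rewrite divr_gt0.
have sub := acos_subadd ub z1.
have zz : expi p * conjc z * z = expi p.
  by rewrite -mulrA (mulrC _ z) (unitJ _ z1) mulr1.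
rewrite zz Re_expi cosK ?in_itv/= ?(ltW p0)// in sub.
have a0 := acos_ge0 (unit_Re z1); have b0 := acos_ge0 (unit_Re ub).
have cb : cos (acos (Re (expi p * conjc z))) = Re (expi p * conjc z) by rewrite acosK// in_itv/= unit_Re.
set a := acos (Re z) in K1 K2 sub a0; set b := acos _ in C sub b0 cb.
have bE : b = 0.
  have [pb|bp] := leP p b; first by rewrite min_l// mpp in C; lra.
  rewrite (min_r (ltW bp)) in C.
  have [pa|ap] := leP p a.
    rewrite min_l// mpp in K1; apply/eqP; rewrite eq_le b0 andbT.
    by rewrite -(pmulr_rle0 _ mp0); lra.
  have pba : m / p * p <= m / p * (b + a) by rewrite ler_pM2l.
  rewrite mpp mulrDr in pba; move: a0; rewrite le_eqVlt => /orP[/eqP a0|a0].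
    by rewrite -a0 mulr0 in pba; lra.
  by have := K2 a0 ap; lra.
have R1 : Re (expi p * conjc z) = 1 by rewrite -cb bE cos0.
have I0 : Im (expi p * conjc z) = 0.
  by move: ub; rewrite /nsq R1 expr1n => /eqP; rewrite addrC -subr_eq0 addrK sqrf_eq0 => /eqP.
have E1 : expi p * conjc z = 1 by apply: C_eq; rewrite ?R1 ?I0.
by rewrite -zz E1 mul1r.
Qed.

(** The slope m / p is below sqrt 2, so [small_oscillation] is available with a slope kap > m / p;
    near-constant modulus would then cost about kap p, more than m. *)
Lemma nonvanishing {V p m psis us} {zs : nat -> R[i]} : admissible V -> 0 < p -> p <= pi ->
  0 < m -> m < Num.sqrt 2 * p ->
  (forall n, fin_energy V (psis n) (us n)) -> (forall n, mom (psis n) (us n) (zs n)) ->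
  ccvg \oo zs (expi p) -> en V (psis n) (us n) @[n --> \oo] --> m ->
  exists2 e, 0 < e & \forall n \near \oo, exists x, e < `|nsq (psis n x) - 1|.
Proof.
move=> adm p0 ppi m0 ms fe mz [cz _] ce.
have s2 : m / p < Num.sqrt 2 by rewrite ltr_pdivrMr.
have sq2 : Num.sqrt 2 ^+ 2 = 2 :> R by rewrite sqr_sqrtr.
have mp0 : 0 < m / p by rewrite divr_gt0.
pose kap := (m / p + Num.sqrt 2) / 2.
have k1 : m / p < kap by rewrite /kap; lra.
have k0 : 0 < kap by lra.
have k2 : kap ^+ 2 < 2 by rewrite -sq2 ltr_pXn2r ?nnegrE ?sqrtr_ge0 ?ltW// /kap; lra.
have [e e0 H] := small_oscillation kap adm k0 k2; exists e => //.
have mkp : m < kap * p by rewrite -ltr_pdivrMr.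
(* t lies strictly between m / kap and p: kap t still exceeds m, and the momenta, tending to p, are
   eventually at distance at least t from 0. *)
pose t := (m / kap + p) / 2.
have mk : m / kap < p by rewrite ltr_pdivrMr// mulrC.
have mk0 : 0 < m / kap by rewrite divr_gt0.
have tp : t < p by rewrite /t; lra.
have t0 : 0 <= t by rewrite /t; lra.
have kt : m < kap * t by rewrite mulrC -ltr_pdivrMr// /t; lra.
have ct : cos p < cos t by rewrite ltr_cos ?in_itv/= ?t0 ?(ltW p0)//; lra.
rewrite Re_expi in cz; near=> n.
have n1 : Re (zs n) < cos t by near: n; exact: (cvgr_lt _ cz _ ct).
have n2 : en V (psis n) (us n) < kap * t by near: n; exact: (cvgr_lt _ ce _ kt).
apply: contrapT => no.
have sm x : `|nsq (psis n x) - 1| <= e by rewrite leNgt; apply/negP => h; apply: no; exists x.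
have Hn := H _ _ _ (fe n) (mz n) sm.
have /andP[r1 r2] := unit_Re (mom_unit adm (fe n) (mz n)).
have ta : t <= acos (Re (zs n)).
  rewrite -[leLHS]cosK; last by rewrite in_itv/= t0; lra.
  by apply: acos_le; [by []|exact: ltW|exact: cos_le1].
have := le_lt_trans Hn n2; rewrite ltr_pM2l// ltNge ta.
Unshelve. all: by end_near.
Qed.

Lemma minimizing_compact {V p m psis us} {zs : nat -> R[i]} : admissible V -> 0 < p -> p <= pi ->
  0 < m -> m < Num.sqrt 2 * p ->
  (forall psi u, fin_energy V psi u -> mom psi u (expi p) -> m <= en V psi u) ->
  (forall n, fin_energy V (psis n) (us n)) -> (forall n, mom (psis n) (us n) (zs n)) ->
  ccvg \oo zs (expi p) -> en V (psis n) (us n) @[n --> \oo] --> m ->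
  exists s xs psi u, [/\ {homo s : i j / (i < j)%N}, fin_energy V psi u, mom psi u (expi p),
    en V psi u = m /\ (forall k, en V (psis (s k)) (us (s k)) <= m + 1) &
    locunif (fun k => ctrans (xs k) (psis (s k))) psi].
Proof.
move=> adm p0 ppi m0 ms Hm fe mz cz ce.
have [e e0 [N1 _ nv]] := nonvanishing adm p0 ppi m0 ms fe mz cz ce.
have [N2 _ bd] : \forall n \near \oo, en V (psis n) (us n) < m + 1.
  by apply: (cvgr_lt _ ce); lra.
(* Discarding the first N terms makes both eventual properties hold at every index; [s'] restores
   the original numbering. *)
pose N := maxn N1 N2.
have nv' n : exists x, e < `|nsq (psis (N + n)%N x) - 1|.
  by apply: nv => /=; rewrite (leq_trans (leq_maxl N1 N2))// leq_addr.
have bd' n : en V (psis (N + n)%N) (us (N + n)%N) <= m + 1.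
  by apply/ltW/bd => /=; rewrite (leq_trans (leq_maxr N1 N2))// leq_addr.
have [xs Hx] := choice nv'.
pose ps n := ctrans (xs n) (psis (N + n)%N); pose vs n := ctrans (xs n) (us (N + n)%N).
have fs n : fin_energy V (ps n) (vs n) by exact: fin_energy_trans.
have es n : en V (ps n) (vs n) = en V (psis (N + n)%N) (us (N + n)%N) by exact: en_trans.
have mzs n : mom (ps n) (vs n) (zs (N + n)%N) by exact: mom_trans.
have e1 n : en V (ps n) (vs n) <= m + 1 by rewrite es.
have [K K1 HK] := uniform_bound (m + 1) adm.
have Kb n x : nsq (ps n x) <= K by exact: HK (fs n) (e1 n) x.
have K0 : 0 <= K by lra.
have KB n x : nsq (ps n x) <= Num.sqrt K ^+ 2 by rewrite sqr_sqrtr.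
have [s [f [g [hs Hs]]]] := @ascoli R (fun n => Re \o ps n) (fun n => Im \o ps n) (Num.sqrt K)
  (fun n x => abs_Re_le _ _ (sqrtr_ge0 K) (KB n x)) (fun n x => abs_Im_le _ _ (sqrtr_ge0 K) (KB n x))
  (ac_equicontinuous (fun n => Re \o ps n) (fun n => Re \o vs n) (m + 1)
     (fun n => let: And4 q _ _ _ := (fs n).1 in q) (fun n => let: And4 _ _ q _ := (fs n).1 in q)
     (fun n => le_trans (sq_le_en adm (fs n)).1 (e1 n)))
  (ac_equicontinuous (fun n => Im \o ps n) (fun n => Im \o vs n) (m + 1)
     (fun n => let: And4 _ q _ _ := (fs n).1 in q) (fun n => let: And4 _ _ _ q := (fs n).1 in q)
     (fun n => le_trans (sq_le_en adm (fs n)).2 (e1 n))).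
pose psi x := Complex (f x) (g x).
pose s' k := (N + s k)%N.
have hs' : {homo s' : i j / (i < j)%N} by move=> i j ij; rewrite ltn_add2l; exact: hs.
have lu : locunif (fun k => ps (s k)) psi.
  move=> M d d0; have [n1 Hn1] := nat_above M; have [n2 Hn2] := nat_above d^-1.
  exists (maxn n1 n2) => // k /=; rewrite geq_max => /andP[k1 k2] x xM.
  have kd : k.+1%:R^-1 <= d.
    rewrite invf_ple ?posrE//; apply: (le_trans (ltW Hn2)).
    by rewrite ler_nat (leq_trans k2).
  have [|h1 h2] := Hs k x; first by rewrite (le_trans xM)// (le_trans (ltW Hn1))// ler_nat.
  by split; [exact: le_trans h1 kd|exact: le_trans h2 kd].
have [u fp] := limit_fin_energy adm (fun k => fs (s k)) (fun k => e1 (s k)) lu.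
have [q mq] := mom_exists adm fp.
have cz' : ccvg \oo (fun k => zs (s' k)) (expi p).
  by case: cz => c1 c2; split; [exact: (cvg_subseq hs' c1)|exact: (cvg_subseq hs' c2)].
have ce' : en V (ps (s k)) (vs (s k)) @[k --> \oo] --> m.
  by under eq_fun do rewrite es; exact: (cvg_subseq hs' ce).
have low := energy_lower_bound adm p0 ppi m0 ms Hm.
have bdE : exists E, forall k, en V (ps (s k)) (vs (s k)) <= E by exists (m + 1).
have cut := cut_limit adm p0 m0 (fun psi u z (fe1 : fin_energy V psi u) mz1 => (low psi u z fe1 mz1).1)
  (fun k => fs (s k)) (fun k => mzs (s k)) cz' ce' bdE lu fp mq.
(* The translations bring to the origin a point where |psi_n|^2 is off 1 by more than e; the limit
   is off by at least e there, and [energy_barrier] turns this into positive energy. *)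
have en0 : 0 < en V psi u.
  have [K' K'0 HK'] := bounded_nsq adm fp; have [h h0 Hh] := energy_barrier K' e adm K'0 e0.
  apply: (lt_le_trans h0); apply: (@le_trans _ _ (\int[mu]_(x in `[0, 0 + 1]) edens V psi u x)); last exact: en_sub.
  rewrite leNgt; apply/negP => /(Hh psi u 0 fp HK').
  rewrite ltNge => /negP; apply.
  have c : `|nsq (ps (s k) 0) - 1| @[k --> \oo] --> `|nsq (psi 0) - 1|.
    apply: cvg_norm; apply: cvgB; [exact: (ccvg_nsq (locunif_ccvg lu))|exact: cvg_cst].
  rewrite leNgt; apply/negP => lt; near (nbhs \oo : set_system nat) => k.
  have : `|nsq (ps (s k) 0) - 1| < e by near: k; exact: (cvgr_lt _ c _ lt).
  by rewrite /ps /ctrans add0r ltNge ltW.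
have q1 : nsq (expi q) = 1 :> R by exact: nsq_expi.
have [l1 l2] := low psi u _ fp mq.
have qE := energy_min_identify p0 ppi m0 q1 en0 l1 l2 cut.
rewrite qE in mq; exists s', (xs \o s), psi, u; split => //; split; last by move=> k; exact: bd'.
apply/eqP; rewrite eq_le (Hm _ _ fp mq) andbT; apply: le_trans cut.
rewrite lerDl; apply: mulr_ge0; first by apply: divr_ge0; exact: ltW.
rewrite le_min (ltW p0) acos_ge0// unit_Re//.
by rewrite nsqM nsqJ !nsq_expi mulr1.
Unshelve. all: by end_near.
Qed.

End MinimizingSequence.

(** * Strong convergence of derivatives and moduli *)

Section StrongConvergence.
Context {R : realType}.
Local Notation mu := (@lebesgue_measure R).
Local Notation ig A f := (mu.-integrable A (EFin \o f)).
Local Notation Re := (@complex.Re R).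
Local Notation Im := (@complex.Im R).
Implicit Types (V f g h : R -> R) (a b c d e t x y r A E K M : R) (psi u : R -> R[i])
  (psis us : nat -> R -> R[i]) (z : R[i]) (N k n : nat).

Lemma powR_small {r} e x : 0 < r -> 0 < e -> 0 <= x -> x <= e `^ r^-1 -> x `^ r <= e.
Proof.
move=> r0 e0 x0 xe; rewrite -[leRHS](powRr1 (ltW e0)) -(mulVf (lt0r_neq0 r0)) powRrM.
by apply: ge0_ler_powR; rewrite ?nnegrE ?powR_ge0// ltW.
Qed.

Lemma Lnorm_cvg0 r (h_ : nat -> R -> R) : 0 < r ->
  (forall n, ig setT (fun x => `|h_ n x| `^ r)) ->
  (forall e, 0 < e -> \forall n \near \oo, \int[mu]_x (`|h_ n x| `^ r) <= e) ->
  Lnorm mu r%:E (fun x => (h_ n x)%:E) @[n --> \oo] --> 0%E.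
Proof.
move=> r0 ih H.
have E n : Lnorm mu r%:E (fun x => (h_ n x)%:E) = ((\int[mu]_x (`|h_ n x| `^ r)) `^ r^-1)%:E.
  rewrite unlock -poweR_EFin -(I_fin measurableT (ih n)).
  by congr (_ `^ _)%E; apply: eq_integral => x _.
under eq_fun do rewrite E.
apply: cvg_toEFin; apply/cvgnP => e e0.
have [N _ HN] := H (e `^ r) (powR_gt0 _ e0); exists N => n Nn.
have I0 : 0 <= \int[mu]_x (`|h_ n x| `^ r) by apply: I_ge0 => x _; exact: powR_ge0.
rewrite subr0 ger0_norm ?powR_ge0//; apply: powR_small; rewrite ?invr_gt0// invrK.
exact: HN.
Qed.

Lemma energy_split {V psi u} : fin_energy V psi u ->
  en V psi u = \int[mu]_x Re (u x) ^+ 2 + \int[mu]_x Im (u x) ^+ 2 + \int[mu]_x V (nsq (psi x)).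
Proof. by move=> [[_ _ s1 s2] iV]; rewrite -I_D// -I_D//; exact: igD. Qed.

(** The midpoints (g_n + g)/2 are densities of functions that also tend to f, so their norms are
    bounded below; the parallelogram identity turns this into an upper bound for the distance from
    g_n to g. *)
Lemma midpoint_lsc {f g} {f_ g_ : nat -> R -> R} : ac f g -> ig setT (fun x => g x ^+ 2) ->
  (forall n, ac (f_ n) (g_ n)) -> (forall n, ig setT (fun x => g_ n x ^+ 2)) ->
  (forall M e, 0 < e -> \forall n \near \oo, forall x, `|x| <= M -> `|f_ n x - f x| <= e) ->
  forall e, 0 < e -> \forall n \near \oo,
    \int[mu]_x (g_ n x - g x) ^+ 2 <= 2 * \int[mu]_x g_ n x ^+ 2 - 2 * \int[mu]_x g x ^+ 2 + e.
Proof.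
move=> af i2 afn in2 lu e e0; have mg := ac_meas af; have mgn n := ac_meas (afn n).
have := @lsc_L2 R f g (fun n x => 2^-1 * (f_ n x + f x)) (fun n x => 2^-1 * (g_ n x + g x)) af i2.
move=> H.
have H1 n : ig setT (fun x => (g_ n x + g x) ^+ 2) by exact: (sq_D measurableT (mgn n) mg (in2 n) i2).
have H2 n : ig setT (fun x => (2^-1 * (g_ n x + g x)) ^+ 2) by exact: sq_Z.
have H3 := H (fun n => ac_Z 2^-1 (ac_D (afn n) af)) H2.
have : \forall n \near \oo, \int[mu]_x g x ^+ 2 - e / 4 <= \int[mu]_x (2^-1 * (g_ n x + g x)) ^+ 2.
  apply: H3 => [M e' e'0|]; last lra.
  have := lu M (2 * e') ltac:(lra); apply: filterS => n Hn x xM.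
  rewrite (_ : _ - _ = 2^-1 * (f_ n x - f x)); last by field.
  by rewrite normrM ger0_norm ?invr_ge0// -ler_pdivlMl ?invr_gt0// invrK; exact: Hn.
apply: filterS => n; have im := H2 n.
have -> : \int[mu]_x (g_ n x - g x) ^+ 2 = 2 * \int[mu]_x g_ n x ^+ 2 + 2 * \int[mu]_x g x ^+ 2 -
    4 * \int[mu]_x (2^-1 * (g_ n x + g x)) ^+ 2.
  rewrite -!I_Z// -I_D//; [|exact: igZ|exact: igZ].
  rewrite -I_B//; [|apply: igD => //; exact: igZ|exact: igZ].
  by apply: I_ext => x _; field.
lra.
Qed.

(** Each of the three parts of the energy is lower semicontinuous and their sum converges, so no
    part can exceed its limit asymptotically. At most four errors e/4 enter. *)
Lemma limit_parts {V psis us psi u} : admissible V ->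
  (forall n, fin_energy V (psis n) (us n)) -> fin_energy V psi u -> locunif psis psi ->
  en V (psis n) (us n) @[n --> \oo] --> en V psi u ->
  forall e, 0 < e -> \forall n \near \oo, [/\
    \int[mu]_x Re (us n x) ^+ 2 <= \int[mu]_x Re (u x) ^+ 2 + e,
    \int[mu]_x Im (us n x) ^+ 2 <= \int[mu]_x Im (u x) ^+ 2 + e &
    \int[mu]_x V (nsq (psis n x)) <= \int[mu]_x V (nsq (psi x)) + e].
Proof.
move=> adm fe fp lu ce e e0; have [[h1 h2 s1 s2] iV] := fp; have e4 : 0 < e / 4 by lra.
have l1 : \forall n \near \oo, \int[mu]_x Re (u x) ^+ 2 - e / 4 <= \int[mu]_x Re (us n x) ^+ 2.
  apply: (lsc_L2 (u_ := fun n => Re \o psis n) h1 s1) => // [n|n|M e' e'0].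
  - by case: (fe n) => [[]].
  - by case: (fe n) => [[]].
  - by have := lu M e' e'0; apply: filterS => n H x /H[].
have l2 : \forall n \near \oo, \int[mu]_x Im (u x) ^+ 2 - e / 4 <= \int[mu]_x Im (us n x) ^+ 2.
  apply: (lsc_L2 (u_ := fun n => Im \o psis n) h2 s2) => // [n|n|M e' e'0].
  - by case: (fe n) => [[]].
  - by case: (fe n) => [[]].
  - by have := lu M e' e'0; apply: filterS => n H x /H[].
have l3 := potential_lsc adm fe fp lu measurableT e4.
have l4 : \forall n \near \oo, en V (psis n) (us n) < en V psi u + e / 4.
  by apply: (cvgr_lt _ ce); lra.
near=> n.
have k1 : \int[mu]_x Re (u x) ^+ 2 - e / 4 <= \int[mu]_x Re (us n x) ^+ 2 by near: n.
have k2 : \int[mu]_x Im (u x) ^+ 2 - e / 4 <= \int[mu]_x Im (us n x) ^+ 2 by near: n.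
have k3 : \int[mu]_x V (nsq (psi x)) - e / 4 <= \int[mu]_x V (nsq (psis n x)) by near: n.
have k4 : en V (psis n) (us n) < en V psi u + e / 4 by near: n.
by rewrite (energy_split (fe n)) (energy_split fp) in k4;
  move: k1 k2 k3 k4; clear; split; lra.
Unshelve. all: by end_near.
Qed.

Lemma derivative_cvg {V psis us psi u} : admissible V ->
  (forall n, fin_energy V (psis n) (us n)) -> fin_energy V psi u -> locunif psis psi ->
  en V (psis n) (us n) @[n --> \oo] --> en V psi u ->
  forall e, 0 < e -> \forall n \near \oo, \int[mu]_x nsq (us n x - u x) <= e.
Proof.
(* Each of the two components contributes 2 (e/6) + e/6. *)
move=> adm fe fp lu ce e e0; have [[h1 h2 s1 s2] iV] := fp; have e6 : 0 < e / 6 by lra.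
have m1 : \forall n \near \oo, \int[mu]_x (Re (us n x) - Re (u x)) ^+ 2 <=
    2 * \int[mu]_x Re (us n x) ^+ 2 - 2 * \int[mu]_x Re (u x) ^+ 2 + e / 6.
  apply: (midpoint_lsc (f_ := fun n => Re \o psis n) h1 s1) => // [n|n|M e' e'0].
  - by case: (fe n) => [[]].
  - by case: (fe n) => [[]].
  - by have := lu M e' e'0; apply: filterS => n H x /H[].
have m2 : \forall n \near \oo, \int[mu]_x (Im (us n x) - Im (u x)) ^+ 2 <=
    2 * \int[mu]_x Im (us n x) ^+ 2 - 2 * \int[mu]_x Im (u x) ^+ 2 + e / 6.
  apply: (midpoint_lsc (f_ := fun n => Im \o psis n) h2 s2) => // [n|n|M e' e'0].
  - by case: (fe n) => [[]].
  - by case: (fe n) => [[]].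
  - by have := lu M e' e'0; apply: filterS => n H x /H[].
apply: filterS2 (filterI m1 m2) (limit_parts adm fe fp lu ce _ e6) => n [/= k1 k2] [k3 k4 _].
have [[p1 p2 t1 t2] _] := fe n.
have -> : \int[mu]_x nsq (us n x - u x) =
    \int[mu]_x (Re (us n x) - Re (u x)) ^+ 2 + \int[mu]_x (Im (us n x) - Im (u x)) ^+ 2.
  rewrite -I_D//.
  - by apply: I_ext => x _; rewrite /nsq !C_simp.
  - by apply: sq_B => //; [exact: ac_meas p1|exact: ac_meas h1].
  - by apply: sq_B => //; [exact: ac_meas p2|exact: ac_meas h2].
lra.
Qed.

(** Dominated convergence with a dominating function C (V(|psi_n|^2) + V(|psi|^2)) that varies with
    n, its integrals being controlled by [limit_parts]. *)
Lemma modulus_cvg {V psis us psi u} r E : admissible V -> 2 <= r ->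
  (forall n, fin_energy V (psis n) (us n)) -> fin_energy V psi u -> locunif psis psi ->
  en V (psis n) (us n) @[n --> \oo] --> en V psi u ->
  (forall n, en V (psis n) (us n) <= E) -> en V psi u <= E ->
  let D n x := `|Num.sqrt (nsq (psis n x)) - Num.sqrt (nsq (psi x))| `^ r in
  (forall n, ig setT (D n)) /\
  forall e, 0 < e -> \forall n \near \oo, \int[mu]_x D n x <= e.
Proof.
move=> adm r2 fe fp lu ce eE eE'; have [cV _ _ _ _] := adm.
have [K K1 HK] := uniform_bound E adm.
have Kn n x : nsq (psis n x) <= K by exact: HK (fe n) (eE n) x.
have Kp x : nsq (psi x) <= K by exact: HK fp eE' x.
have [c c0 Hc] := potential_quadratic K adm ltac:(lra).
pose S := 2 * Num.sqrt K; have S0 : 0 < S by rewrite mulr_gt0// sqrtr_gt0; lra.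
(* The power r - 2 is absorbed by the bound S on the difference of the moduli; the remaining square
   is at most 2 ((rho_n - 1)^2 + (rho - 1)^2), and (rho - 1)^2 <= V / c. *)
pose C := S `^ (r - 2) * 2 / c.
have C0 : 0 < C by rewrite divr_gt0// mulr_gt0// powR_gt0.
move=> D.
have v0 (q : R -> R[i]) x : 0 <= V (nsq (q x)) by apply: (admissible_ge0 adm); exact: nsq_ge0.
have D0 n x : 0 <= D n x by exact: powR_ge0.
have sq1 t : 0 <= t -> t <= K -> (Num.sqrt t - 1) ^+ 2 <= V t / c.
  move=> t0 tK; rewrite ler_pdivlMr// mulrC; apply: le_trans (Hc t t0 tK).
  rewrite ler_pM2l//; have s0 := sqrtr_ge0 t; rewrite -{2}(sqr_sqrtr t0).
  set s := Num.sqrt t in s0 *.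
  rewrite (_ : s ^+ 2 - 1 = (s - 1) * (s + 1)); last ring.
  by rewrite exprMn ler_peMr ?sqr_ge0// expr_ge1//; lra.
have DC n x : D n x <= C * (V (nsq (psis n x)) + V (nsq (psi x))).
  have a1 := sq1 _ (nsq_ge0 (psis n x)) (Kn n x); have a2 := sq1 _ (nsq_ge0 (psi x)) (Kp x).
  have b1 : Num.sqrt (nsq (psis n x)) <= Num.sqrt K by rewrite ler_wsqrtr.
  have b2 : Num.sqrt (nsq (psi x)) <= Num.sqrt K by rewrite ler_wsqrtr.
  have d1 := sqrtr_ge0 (nsq (psis n x)); have d2 := sqrtr_ge0 (nsq (psi x)).
  rewrite /D; set s1 := Num.sqrt (nsq (psis n x)) in a1 b1 d1 *; set s2 := Num.sqrt _ in a2 b2 d2 *.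
  have -> : r = (r - 2) + 2 by ring.
  rewrite powRD; last by apply/implyP => /eqP h; exfalso; lra.
  have -> : C * (V (nsq (psis n x)) + V (nsq (psi x))) =
     S `^ (r - 2) * (2 * (V (nsq (psis n x)) / c + V (nsq (psi x)) / c)) by rewrite /C; ring.
  apply: ler_pM; rewrite ?powR_ge0//.
    apply: ge0_ler_powR; rewrite ?nnegrE//; [lra|exact: ltW|].
    by rewrite ler_norml /S; apply/andP; split; lra.
  rewrite powR_mulrn// real_normK ?num_real//.
  apply: (@le_trans _ _ (2 * ((s1 - 1) ^+ 2 + (s2 - 1) ^+ 2))); last by rewrite ler_pM2l//; lra.
  rewrite -subr_ge0 (_ : _ - _ = (s1 + s2 - 2) ^+ 2) ?sqr_ge0//; ring.
have msq (q v : R -> R[i]) : fin_energy V q v -> measurable_fun setT (fun x => Num.sqrt (nsq (q x))).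
  move=> [hq _]; apply: cont_meas => x; apply: (@continuous_comp _ _ _ (fun x => nsq (q x)) Num.sqrt).
    exact: (nsq_cont hq).
  exact: sqrt_continuous.
have mD n : measurable_fun setT (D n).
  apply: (measurableT_comp (measurable_powR r)); apply: measurableT_comp => //.
  by apply: measurable_funB; [exact: msq (fe n)|exact: msq fp].
have iV := fp.2; have iVn n := (fe n).2.
have iS n : ig setT (fun x => C * (V (nsq (psis n x)) + V (nsq (psi x)))).
  by apply: igZ => //; exact: igD.
have iD n : ig setT (D n).
  by apply: (ig_le measurableT (mD n) (iS n)) => x _; rewrite ger0_norm.
split => // e e0.
(* G is nonnegative and tends to 2 C V(|psi|^2), so Fatou's lemma for G bounds the integral of D
   from above. *)
pose G n x := C * (V (nsq (psis n x)) + V (nsq (psi x))) - D n x.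
have iG n : ig setT (G n) by exact: igB.
pose L x := 2 * C * V (nsq (psi x)).
have cG x : G n x @[n --> \oo] --> L x.
  rewrite (_ : L x = C * (V (nsq (psi x)) + V (nsq (psi x))) - 0); last by rewrite /L; ring.
  apply: cvgB.
    apply: cvgM; first exact: cvg_cst.
    by apply: cvgD; [exact: (locunif_V cV lu)|exact: cvg_cst].
  have cs : Num.sqrt (nsq (psis n x)) @[n --> \oo] --> Num.sqrt (nsq (psi x)).
    have cn : nsq (psis n x) @[n --> \oo] --> nsq (psi x) by exact: (ccvg_nsq (locunif_ccvg lu)).
    by apply: (cvg_comp _ _ cn); exact: sqrt_continuous.
  move/cvgnP : cs => cs; apply/cvgnP => d d0.
  have [N HN] := cs (d `^ r^-1) (powR_gt0 _ d0); exists N => n Nn.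
  by rewrite subr0 ger0_norm//; apply: powR_small => //; [lra|exact: HN].
have e2 : 0 < e / 2 by lra.
have e3 : 0 < e / (2 * C) by rewrite divr_gt0// mulr_gt0.
have mL : measurable_fun setT L by apply: measurable_funM => //; exact: ig_meas iV.
have G0 n x : setT x -> 0 <= G n x by move=> _; rewrite subr_ge0.
have L0 x : setT x -> 0 <= L x by move=> _; rewrite mulr_ge0// mulr_ge0// ltW.
have fat := fatou_near measurableT iG G0 mL L0 (fun x _ => cG x) _ e2.
apply: filterS2 fat (limit_parts adm fe fp lu ce _ e3) => n k1 [_ _ k2].
have E1 : \int[mu]_x G n x = C * (\int[mu]_x V (nsq (psis n x)) + \int[mu]_x V (nsq (psi x))) - \int[mu]_x D n x.
  rewrite /G I_B//.
  by rewrite I_Z//; [rewrite I_D|exact: igD].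
have E2 : \int[mu]_x L x = 2 * C * \int[mu]_x V (nsq (psi x)) by rewrite /L I_Z.
rewrite E1 E2 in k1.
have k3 : C * \int[mu]_x V (nsq (psis n x)) <= C * \int[mu]_x V (nsq (psi x)) + e / 2.
  have -> : e / 2 = C * (e / (2 * C)) by field; rewrite gt_eqF.
  by rewrite -mulrDr ler_pM2l.
lra.
Qed.

End StrongConvergence.

(** * Translation between the statement and the encoding by e^{iP} *)

Section Conclusion.
Context {R : realType}.
Local Notation Re := (@complex.Re R).
Local Notation Im := (@complex.Im R).
Implicit Types (F V : R -> R) (e m p q x : R) (psi u : R -> R[i]) (psis : nat -> R -> R[i]) (n : nat).

Lemma fin_energy_wderive {F V psi} : (forall s, 0 <= s -> potential F s = V s) ->
  energy_space F psi -> fin_energy V psi (wderiveC psi).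
Proof.
move=> FV Hpsi; have [u [_ iV]] := (energy_spaceP FV).1 Hpsi.
by split => //; apply: wderiveCP; case: Hpsi.
Qed.

(** Representatives of the two classes are chosen at distance less than the infimum plus 1/(n + 1),
    which avoids showing that it is attained; their difference tends to 0. *)
Lemma expi_dist_cvg {qs : nat -> R} {p} :
  dist2pi (class2pi (qs n)) (class2pi p) @[n --> \oo] --> (0 : R) ->
  ccvg \oo (fun n => expi (qs n)) (expi p).
Proof.
move=> /cvgnP c.
have pick n : exists t, expi (qs n) = expi p * expi t /\
    `|t| < dist2pi (class2pi (qs n)) (class2pi p) + n.+1%:R^-1.
  set S := [set d | exists a b, [/\ class2pi (qs n) a, class2pi p b & d = `|a - b|]].
  have hi : has_inf S.
    split; first by exists `|qs n - p|, (qs n), p; rewrite !class2piE.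
    by exists 0 => _ [a [b [_ _ ->]]].
  have i0 : 0 < n.+1%:R^-1 :> R by rewrite invr_gt0.
  have [_ [a [b [ca cb ->]]] lt] := inf_adherent i0 hi.
  exists (a - b); split => //; move: ca cb; rewrite !class2piE /= => <- <-.
  by rewrite -expiD addrC subrK.
have [ts Hts] := choice pick.
have ct : ts n @[n --> \oo] --> (0 : R).
  apply/cvgnP => e e0; have [N1 H1] := c (e / 2) ltac:(lra).
  have [N2 H2] := nat_above (e / 2)^-1; exists (maxn N1 N2) => n; rewrite geq_max => /andP[n1 n2].
  rewrite subr0; apply: le_trans (ltW (Hts n).2) _.
  have k1 := H1 n n1; rewrite subr0 in k1; have k2 := le_trans (ler_norm _) k1.
  rewrite [leRHS]splitr; apply: lerD => //.
  rewrite invf_ple ?posrE//; last by lra.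
  by apply: (le_trans (ltW H2)); rewrite ler_nat (leq_trans n2).
under [X in ccvg _ X _]eq_fun do rewrite (Hts _).1.
rewrite -[X in ccvg _ _ X]mulr1 -expi0; apply: ccvgM; first exact: ccvg_cst.
exact: ccvg_expi.
Qed.

Lemma normc_powR2 (z : R[i]) : `|Normc.normc z| `^ 2 = nsq z.
Proof.
by rewrite powR_mulrn// -normc_sq ger0_norm// normcE sqrtr_ge0.
Qed.

Lemma nsq_diff_ig {psi u psi' u' : R -> R[i]} : has_deriv psi u -> has_deriv psi' u' ->
  (@lebesgue_measure R).-integrable setT (EFin \o (fun x => nsq (u x - u' x))).
Proof.
move=> [h1 h2 s1 s2] [k1 k2 t1 t2].
have i1 := sq_B measurableT (ac_meas h1) (ac_meas k1) s1 t1.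
have i2 := sq_B measurableT (ac_meas h2) (ac_meas k2) s2 t2.
by apply: (ig_ext _ _ (igD measurableT i1 i2)) => // x _; rewrite /nsq !C_simp.
Qed.

Lemma locunif_normc {psis psi} : locunif psis psi ->
  forall r : R, 0 < r -> forall e : R, 0 < e -> \forall k \near \oo, forall x, x \in `[- r, r] ->
    Normc.normc (psis k x - psi x) < e.
Proof.
move=> lu r r0 e e0; have := lu r (e / 2) ltac:(lra); apply: filterS => k Hk x.
rewrite in_itv/= -ler_norml => /Hk[h1 h2].
rewrite normcE -[e]ger0_norm ?(ltW e0)// -sqrtr_sqr ltr_sqrt ?exprn_gt0//.
rewrite /nsq !C_simp -(real_normK (num_real (Re _ - _))) -(real_normK (num_real (Im _ - _))).
have sq (y : R) : `|y| <= e / 2 -> `|y| ^+ 2 <= (e / 2) ^+ 2.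
  by move=> h; rewrite ler_sqr ?nnegrE//; lra.
have := sq _ h1; have := sq _ h2; have : 0 < e ^+ 2 by rewrite exprn_gt0.
rewrite (_ : (e / 2) ^+ 2 = e ^+ 2 / 4); [lra|by field].
Qed.

End Conclusion.

Theorem theorem5p2 (R : realType) (F : R -> R) (p : R)
    (psi_ : nat -> R -> R[i]) :
  assumption_A1 F -> assumption_B1 F ->
  0 < p -> p <= pi ->
  (energy_min F p < (Num.sqrt 2 * p)%:E)%E ->
  (forall n, energy_space F (psi_ n)) ->
  dist2pi (untwisted_momentum (psi_ n)) (class2pi p) @[n --> \oo] --> (0 : R) ->
  energy F (psi_ n) @[n --> \oo] --> energy_min F p ->
  exists (s : nat -> nat) (x_ : nat -> R) (psi : R -> R[i]),
    [/\ {homo s : i j / (i < j)%N},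
        [/\ energy_space F psi,
            untwisted_momentum psi = class2pi p &
            energy F psi = energy_min F p],
        (forall r : R, 0 < r -> forall e : R, 0 < e ->
           \forall k \near \oo, forall x, x \in `[- r, r] ->
             Normc.normc (psi_ (s k) (x + x_ k) - psi x) < e),
        Lnorm lebesgue_measure 2%:E (fun x =>
          (Normc.normc (wderiveC (psi_ (s k)) (x + x_ k) - wderiveC psi x))%:E)
          @[k --> \oo] --> 0%E &
        forall r : R, 2 <= r ->
          Lnorm lebesgue_measure r%:E (fun x =>
            (Normc.normc (psi_ (s k) (x + x_ k)) - Normc.normc (psi x))%:E)
            @[k --> \oo] --> 0%E].
Proof.
move=> A1 B1 p0 ppi lt Hes Hd He; have [V adm FV] := potential_admissible A1 B1.
have fe n := fin_energy_wderive FV (Hes n); have eE n := energyE FV (fe n).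
have [qs mz] := choice (fun n => mom_exists adm (fe n)).
have cz : ccvg \oo (fun n => expi (qs n)) (expi p).
  apply: expi_dist_cvg; move: Hd; under eq_fun => n do
    rewrite (untwistedE adm (fe n) (mz n)) -class2piE; exact.
have min_le psi u : fin_energy V psi u -> mom psi u (expi p) ->
    (energy_min F p <= (en V psi u)%:E)%E.
  move=> fp mp; apply: ereal_inf_lbound; exists psi; last exact: energyE.
  split; first by apply/(energy_spaceP FV); exists u.
  by rewrite (untwistedE adm fp mp) class2piE.
(* The bound by sqrt 2 p excludes +oo, the value of the infimum of the empty set; energies are
   nonnegative, which excludes -oo. *)
have min_fin : energy_min F p \is a fin_num.
  rewrite fin_numE; apply/andP; split; last by rewrite lt_eqF// (lt_trans lt)// ltry.
  apply/eqP => /(lb_ereal_infNy_adherent 0)[_ [psi [Hpsi _] <-]].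
  by rewrite (energyE FV (fin_energy_wderive FV Hpsi)) lte_fin ltNge en_ge0.
pose m := fine (energy_min F p); have mE : energy_min F p = m%:E by rewrite fineK.
have Hm psi u : fin_energy V psi u -> mom psi u (expi p) -> m <= en V psi u.
  by move=> fp mp; have := min_le _ _ fp mp; rewrite mE lee_fin.
have m0 : 0 < m.
  apply: (minimum_gt0 adm p0 ppi) => h h0.
  have [_ [psi [Hpsi Hmom] <-]] := lb_ereal_inf_adherent h0 min_fin.
  have fp := fin_energy_wderive FV Hpsi.
  rewrite -/(energy_min F p) mE (energyE FV fp) -EFinD lte_fin => ltm.
  exists psi, (wderiveC psi); split => //; have [q mq] := mom_exists adm fp.
  move: Hmom; rewrite (untwistedE adm fp mq) class2piE => /seteqP[h1 _].
  by have <- : expi q = expi p := h1 q erefl.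
have ms : m < Num.sqrt 2 * p by move: lt; rewrite mE lte_fin.
have ce : en V (psi_ n) (wderiveC (psi_ n)) @[n --> \oo] --> m.
  have := He; rewrite mE; under eq_fun do rewrite eE; exact: fine_cvg.
have [s [xs [psi [u [hs fu mu [enu bd] lu]]]]] :=
  minimizing_compact adm p0 ppi m0 ms Hm fe mz cz ce.
have Hpsi : energy_space F psi by apply/(energy_spaceP FV); exists u.
(* The limit came with some derivative u, while the claim concerns [wderiveC psi]; both represent
   the same weak derivative and give the same energy. *)
have fp := fin_energy_wderive FV Hpsi.
have enp : en V psi (wderiveC psi) = m.
  by apply: EFin_inj; rewrite -(energyE FV fp) (energyE FV fu) enu.
pose vs k := ctrans (xs k) (wderiveC (psi_ (s k))).
have fs k : fin_energy V (ctrans (xs k) (psi_ (s k))) (vs k) by exact: fin_energy_trans.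
have es k : en V (ctrans (xs k) (psi_ (s k))) (vs k) = en V (psi_ (s k)) (wderiveC (psi_ (s k))).
  exact: en_trans.
have ces : en V (ctrans (xs k) (psi_ (s k))) (vs k) @[k --> \oo] --> en V psi (wderiveC psi).
  by rewrite enp; under eq_fun do rewrite es; exact: (cvg_subseq hs ce).
exists s, xs, psi; split => //.
- by split; rewrite ?(untwistedE adm fu mu) ?class2piE// (energyE FV fu) enu.
- exact: (locunif_normc lu).
- apply: (@Lnorm_cvg0 R 2 (fun k x => Normc.normc (vs k x - wderiveC psi x))) => // [k|e e0].
    under [X in EFin \o X]eq_fun do rewrite normc_powR2; exact: nsq_diff_ig (fs k).1 fp.1.
  have := derivative_cvg adm fs fp lu ces _ e0; apply: filterS => k.
  by under [X in _ -> X <= _]eq_Rintegral do rewrite normc_powR2.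
- move=> r r2.
  have [k||i c] := modulus_cvg r (m + 1) adm r2 fs fp lu ces; [by rewrite es|by rewrite enp; lra|].
  under eq_fun => k do under [X in Lnorm _ _ X]eq_fun do rewrite !normcE.
  by apply: (@Lnorm_cvg0 R r (fun k x => Num.sqrt (nsq (psi_ (s k) (x + xs k))) - Num.sqrt (nsq (psi x)))); [lra|exact: i|exact: c].
Qed.
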